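(* Let $(G,\Sigma,\mu)$ be a twisted Stonian measure groupoid such that the Hilbert space $L^2(G,\Sigma,d^*\mu)$ is separable. Then there exists a second countable twisted Boolean groupoid $(H,\Lambda)$ acting by multipliers on $(G,\Sigma)$ with anchor map $\pi:G^{(0)}\to H^{(0)}$ such that (i) the $*$-homomorphism $\tilde\jmath:C_c(H,\Lambda)\to C_c(G,\Sigma)$ defined by the multiplier action extends to a surjective isometry $J:L^2(H,\Lambda,d^*(\pi_*\mu))\to L^2(G,\Sigma,d^*\mu)$; (ii) $J$ implements an isomorphism (namely $T\mapsto JTJ^{-1}$) of $W^*(H,\Lambda,\pi_*\mu)$ onto $W^*(G,\Sigma,\mu)$ carrying $L^\infty(H^{(0)},\pi_*\mu)$ onto $L^\infty(G^{(0)},\mu)$.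
   Context: $\mathbb T$ is the group of complex numbers of modulus one; $r,d$ are the range and domain maps of a groupoid. Boolean space: locally compact, Hausdorff, totally disconnected. Stonian space: compact, Hausdorff, extremally disconnected. An étale groupoid is a locally compact groupoid (not necessarily Hausdorff, with Hausdorff unit space) whose range and domain maps are local homeomorphisms. A Boolean groupoid is an étale groupoid whose unit space is a Boolean space. Twisted groupoid $(G,\Sigma)$: a central groupoid extension $X\times\mathbb T\rightarrowtail\Sigma\xrightarrow{p}G$ with common unit space $X=G^{(0)}$, where $\Sigma$ is a locally compact groupoid, $X\times\mathbb T$ is (homeomorphically) a locally closed subset of $\Sigma$, and $p$ is a continuous open surjection. Thus $\mathbb T$ acts freely on $\Sigma$ with quotient $G$. It is a twisted Boolean groupoid if $G$ is Boolean; second countable means that $G$ and $\Sigma$ are second countable. Write $\sigma'=p(\sigma)$. A measure $\mu$ on $G^{(0)}$ is quasi-invariant if for every compact open bisection $S$ of $G$ the measures $(r_{|S})^*\mu$ and $(d_{|S})^*\mu$ on $S$ are equivalent. A twisted Stonian measure groupoid $(G,\Sigma,\mu)$ is a twisted Boolean groupoid $(G,\Sigma)$ such that $G^{(0)}$ is a Stonian space, with a quasi-invariant probability measure $\mu$ on $G^{(0)}$ which is strictly positive on non-empty open subsets and vanishes on nowhere dense Borel subsets. A compact continuous bisection $S$ of $\Sigma$ is a compact subset such that $r_{|S}$ and $d_{|S}$ are homeomorphisms onto open subsets of $X$. Put $\Delta_S(\sigma)=\overline\theta$ if $\sigma=\theta s$ with $\theta\in\mathbb T$, $s\in S$, and $\Delta_S(\sigma)=0$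 if $\sigma\notin\mathbb TS$. $C_c(G,\Sigma)$ is the space of finite sums of functions $\Delta_S\cdot(b\circ d)$ with $S$ a compact continuous bisection of $\Sigma$ and $b\in C_c(X)$; it is a $*$-algebra for $f*g(\sigma)=\sum_{\tau'\in r^{-1}(r(\sigma))}f(\tau)g(\tau^{-1}\sigma)$ ($\tau$ any lift of $\tau'\in G$) and $f^*(\sigma)=\overline{f(\sigma^{-1})}$. For a quasi-invariant probability measure $\mu$, $L^2(G,\Sigma,d^*\mu)$ is the completion of $C_c(G,\Sigma)$ for $(f|g)=\int_X\sum_{\gamma\in d^{-1}(x)}(\overline fg)(\gamma)\,d\mu(x)$, and $W^*(G,\Sigma,\mu)$ is the weak closure of the image of $C_c(G,\Sigma)$ under $\mathrm{Reg}(f)\xi=f*\xi$ on $L^2(G,\Sigma,d^*\mu)$. $L^\infty(G^{(0)},\mu)$ is the subalgebra of operators of multiplication $\xi\mapsto (b\circ r)\xi$. Multiplier action of $(H,\Lambda)$ on $(G,\Sigma)$: a continuous left action of the groupoid $\Lambda$ on the space $\Sigma$, with continuous moment map $\rho:\Sigma\to\Lambda^{(0)}=H^{(0)}$ and action map $(l,\sigma)\mapsto l\sigma$ defined when $d(l)=\rho(\sigma)$, commuting with right multiplication, $l(\sigma\tau)=(l\sigma)\tau$, and $\mathbb T$-equivariant, $(\theta l)\sigma=l(\theta\sigma)$ for $\theta\in\mathbb T$. The anchor is $\pi=\rho_{|G^{(0)}}:G^{(0)}\to H^{(0)}$, and $\rho=\pi\circ r$. When $\pi$ is proper (in particular when $G^{(0)}$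 is compact), the action defines a $*$-homomorphism $\tilde\jmath:C_c(H,\Lambda)\to C_c(G,\Sigma)$ by $\tilde\jmath(f)(\sigma)=\sum_{l\in\Lambda:\ l\,d(\sigma)=\sigma}f(l)$. *)

(* Defs.v *)
From HB Require Import structures.
From mathcomp Require Import all_boot all_order all_algebra.
From mathcomp Require Import complex.
From mathcomp Require Import all_classical all_reals all_analysis.

Set Implicit Arguments.
Unset Strict Implicit.
Unset Printing Implicit Defensive.

Import Order.TTheory GRing.Theory Num.Theory.
Import numFieldNormedType.Exports.

Local Open Scope classical_set_scope.
Local Open Scope ring_scope.

(* R[i], typed so that the topology and the norm of a numClosedFieldType are
   found by unification. *)
Definition cplx (R : realType) : numClosedFieldType := R[i].

Definition circle (R : realType) : set (cplx R) := [set z | `|z| = 1].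
Arguments circle : clear implicits.

Section Topology.

Definition embedding_on (T U : topologicalType) (A : set T) (f : T -> U) :=
  [/\ set_inj A f, {within A, continuous f} &
      forall V, open V ->
        exists2 W, open W & f @` (A `&` V) = (f @` A) `&` W].

Definition local_homeomorphism (T U : topologicalType) (f : T -> U) :=
  forall x, exists V, [/\ open V, V x, embedding_on V f & open (f @` V)].

Definition locally_closed (T : topologicalType) (A : set T) :=
  exists U F, [/\ open U, closed F & A = U `&` F].

(* For spaces that need not be Hausdorff: every point has a neighbourhood that
   is compact and Hausdorff in its subspace topology. *)
Definition locally_compact_space (T : topologicalType) :=
  forall x : T, exists K : set T,
    [/\ nbhs x K, compact K & hausdorff_space (set_type K)].

Definition boolean_space (T : topologicalType) :=
  [/\ locally_compact_space T, hausdorff_space T &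
      totally_disconnected [set: T]].

Definition stonian_space (T : topologicalType) :=
  [/\ compact [set: T], hausdorff_space T &
      forall U : set T, open U -> open (closure U)].

Definition nowhere_dense (T : topologicalType) (A : set T) :=
  interior (closure A) = set0.

Definition separable_space (T : topologicalType) :=
  exists2 D : set T, countable D & dense D.

End Topology.

(* A topological groupoid with unit space X. The product [gmul] is total; only
   its values on the composable pairs, where gdom g = grng h, are meaningful. *)
Record top_groupoid (X : topologicalType) := TopGroupoid {
  arrow :> topologicalType;
  grng : arrow -> X;
  gdom : arrow -> X;
  gunit : X -> arrow;
  gmul : arrow -> arrow -> arrow;
  ginv : arrow -> arrow;
  grng_unit : forall x, grng (gunit x) = x;
  gdom_unit : forall x, gdom (gunit x) = x;
  grng_mul : forall g h, gdom g = grng h -> grng (gmul g h) = grng g;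
  gdom_mul : forall g h, gdom g = grng h -> gdom (gmul g h) = gdom h;
  gmulA : forall g h k, gdom g = grng h -> gdom h = grng k ->
    gmul g (gmul h k) = gmul (gmul g h) k;
  gmul1g : forall g, gmul (gunit (grng g)) g = g;
  gmulg1 : forall g, gmul g (gunit (gdom g)) = g;
  grng_inv : forall g, grng (ginv g) = gdom g;
  gdom_inv : forall g, gdom (ginv g) = grng g;
  gmulVg : forall g, gmul (ginv g) g = gunit (gdom g);
  gmulgV : forall g, gmul g (ginv g) = gunit (grng g);
  grng_continuous : continuous grng;
  gdom_continuous : continuous gdom;
  gunit_continuous : continuous gunit;
  ginv_continuous : continuous ginv;
  gmul_continuous :
    {within [set gh : arrow * arrow | gdom gh.1 = grng gh.2],
      continuous (fun gh => gmul gh.1 gh.2)}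
}.

Arguments grng {X} _ _.
Arguments gdom {X} _ _.
Arguments gunit {X} _ _.
Arguments gmul {X} _ _ _.
Arguments ginv {X} _ _.

Section Groupoids.
Variables (X : topologicalType) (G : top_groupoid X).

Definition locally_compact_groupoid :=
  locally_compact_space G /\ hausdorff_space X.

Definition etale_groupoid :=
  [/\ locally_compact_groupoid, local_homeomorphism (grng G) &
      local_homeomorphism (gdom G)].

Definition boolean_groupoid := etale_groupoid /\ boolean_space X.

Definition bisection (S : set G) :=
  [/\ embedding_on S (grng G), open (grng G @` S),
      embedding_on S (gdom G) & open (gdom G @` S)].

Definition compact_bisection (S : set G) := compact S /\ bisection S.

End Groupoids.

(* A twisted groupoid (G, Sigma) over X = G^(0). The circle bundle
   X x T >-> Sigma is [tw_iota], used only on scalars of modulus one. *)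
Record twisted_groupoid (R : realType) (X : topologicalType) :=
  TwistedGroupoid {
  tw_base : top_groupoid X;
  tw_ext : top_groupoid X;
  tw_proj : tw_ext -> tw_base;
  tw_iota : X * cplx R -> tw_ext;
  tw_ext_lc : locally_compact_groupoid tw_ext;
  tw_rng_iota : forall x t, circle R t -> grng tw_ext (tw_iota (x, t)) = x;
  tw_dom_iota : forall x t, circle R t -> gdom tw_ext (tw_iota (x, t)) = x;
  tw_iotaM : forall x s t, circle R s -> circle R t ->
    gmul tw_ext (tw_iota (x, s)) (tw_iota (x, t)) = tw_iota (x, s * t);
  tw_iota1 : forall x, tw_iota (x, 1) = gunit tw_ext x;
  tw_iota_embedding : embedding_on (setT `*` circle R) tw_iota;
  tw_iota_locally_closed : locally_closed (tw_iota @` (setT `*` circle R));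
  tw_rng_proj : forall s, grng tw_base (tw_proj s) = grng tw_ext s;
  tw_dom_proj : forall s, gdom tw_base (tw_proj s) = gdom tw_ext s;
  tw_projM : forall s t, gdom tw_ext s = grng tw_ext t ->
    tw_proj (gmul tw_ext s t) = gmul tw_base (tw_proj s) (tw_proj t);
  tw_proj_continuous : continuous tw_proj;
  tw_proj_open : forall U : set tw_ext, open U -> open (tw_proj @` U);
  tw_proj_surj : forall g, exists s, tw_proj s = g;
  tw_exact : tw_proj @^-1` range (gunit tw_base) =
             tw_iota @` (setT `*` circle R);
  tw_central : forall s t, circle R t ->
    gmul tw_ext (tw_iota (grng tw_ext s, t)) s =
    gmul tw_ext s (tw_iota (gdom tw_ext s, t))
}.

Arguments tw_base {R X} _.
Arguments tw_ext {R X} _.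
Arguments tw_proj {R X} _ _.
Arguments tw_iota {R X} _ _.

Section TwistedGroupoids.
Variables (R : realType) (X : topologicalType) (E : twisted_groupoid R X).
Let C := cplx R.
Let Sigma := tw_ext E.
Let G := tw_base E.

Definition twisted_boolean := boolean_groupoid G.

Definition twisted_second_countable :=
  @second_countable G /\ @second_countable Sigma.

Definition tw_scale (t : C) (s : Sigma) : Sigma :=
  gmul Sigma (tw_iota E (grng Sigma s, t)) s.

Definition tw_lift (g : G) : Sigma := sval (cid (tw_proj_surj g)).

(* When S is a bisection there is at most one scalar t of modulus one with
   s \in t S; the default value 0 of [xget] is used if there is none. *)
Definition Delta (S : set Sigma) (s : Sigma) : C :=
  Num.conj (xget 0 [set t | circle R t /\ exists2 s0, S s0 & s = tw_scale t s0]).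

Definition CcX (b : X -> C) :=
  continuous b /\ compact (closure [set x | b x != 0]).

Definition Cc : set (Sigma -> C) :=
  [set f | exists (n : nat) (S : 'I_n -> set Sigma) (b : 'I_n -> X -> C),
    (forall i, compact_bisection (S i) /\ CcX (b i)) /\
    f = fun s => \sum_(i < n) Delta (S i) s * b i (gdom Sigma s)].

(* The sums over fibres of G below have finite support for functions in Cc,
   and do not depend on the choice of lifts. *)
Definition convolution (f g : Sigma -> C) : Sigma -> C := fun s =>
  \sum_(h \in grng G @^-1` [set grng Sigma s])
     f (tw_lift h) * g (gmul Sigma (ginv Sigma (tw_lift h)) s).

Definition involution (f : Sigma -> C) : Sigma -> C := fun s =>
  Num.conj (f (ginv Sigma s)).

Definition fibre_sum (f g : Sigma -> C) (x : X) : C :=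
  \sum_(h \in gdom G @^-1` [set x]) Num.conj (f (tw_lift h)) * g (tw_lift h).

End TwistedGroupoids.

Arguments Cc {R X} E _.
Arguments tw_scale {R X} E _ _.

Definition borelType (X : ptopologicalType) := g_sigma_algebraType (@open X).

(* Measures are handled as functions on sets, as [integral] does, so that they
   can be applied to images under [pushforward]. *)
Section Measures.
Variables (R : realType) (X : ptopologicalType).
Let C := cplx R.
Implicit Type mu : set (borelType X) -> \bar R.

Definition cintegral mu (F : X -> C) : C :=
  (fine (\int[mu]_(x in [set: borelType X]) (complex.Re (F x))%:E)%E +i*
   fine (\int[mu]_(x in [set: borelType X]) (complex.Im (F x))%:E)%E)%C.

Definition bounded_borel (b : X -> C) :=
  [/\ exists M : C, forall x, `|b x| <= M,
      measurable_fun [set: borelType X]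
        (fun x : borelType X => complex.Re (b x)) &
      measurable_fun [set: borelType X]
        (fun x : borelType X => complex.Im (b x))].

(* The Borel sets of the open bisection S are the Borel sets of G contained in
   S, and those of S have the measures mu (r A) and mu (d A). *)
Definition quasi_invariant (G : top_groupoid X) mu :=
  forall S : set G, open S -> compact_bisection S ->
  forall A : set G, <<s @open G >> A -> A `<=` S ->
    mu (grng G @` A) = 0%E <-> mu (gdom G @` A) = 0%E.

Definition twisted_stonian_measure_groupoid (E : twisted_groupoid R X) mu :=
  [/\ twisted_boolean E /\ stonian_space X,
      quasi_invariant (tw_base E) mu,
      forall U : set X, open U -> U !=set0 -> (0 < mu U)%E &
      forall N : set (borelType X), measurable N ->
        nowhere_dense (N : set X) -> mu N = 0%E].

Definition inner_Cc (E : twisted_groupoid R X) mu (f g : tw_ext E -> C) : C :=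
  cintegral mu (fibre_sum f g).

End Measures.

(* [hdot] is linear in its first argument and antilinear in the second. *)
Record hilbert_space (R : realType) := HilbertSpace {
  hcarrier :> completeNormedModType (cplx R);
  hdot : {dot hcarrier for @Num.conj (cplx R)};
  hnormE : forall x : hcarrier, `|x| ^+ 2 = hdot x x
}.

Arguments hdot {R} _.

(* The completion of Cc for the semi-inner product [inner_Cc], given by its
   Hilbert space and the canonical map of Cc onto a dense subspace; it is unique
   up to a unique isometric isomorphism. Since inner_Cc is linear in its second
   argument, the arguments of hdot are exchanged. *)
Record L2_completion (R : realType) (X : ptopologicalType)
    (E : twisted_groupoid R X) (mu : set (borelType X) -> \bar R) :=
  L2Completion {
  L2 :> hilbert_space R;
  L2_class : (tw_ext E -> cplx R) -> L2;
  L2_class_linear : forall a f g, Cc E f -> Cc E g ->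
    L2_class (fun s => a * f s + g s) = a *: L2_class f + L2_class g;
  L2_class_dot : forall f g, Cc E f -> Cc E g ->
    hdot L2 (L2_class g) (L2_class f) = inner_Cc mu f g;
  L2_class_dense : dense (L2_class @` Cc E)
}.

Arguments L2_class {R X E mu} _ _.

Section Operators.
Variables (R : realType) (K : hilbert_space R).

Definition bounded_operator (T : K -> K) := linear T /\ continuous T.

Definition weak_closure (A : set (K -> K)) : set (K -> K) :=
  [set T | bounded_operator T /\
    forall (s : seq (K * K)) (e : R), 0 < e ->
      exists2 T0, A T0 &
        {in s, forall xy,
          `|hdot K (T xy.1) xy.2 - hdot K (T0 xy.1) xy.2| < (e%:C)%C}].

End Operators.

Section VonNeumann.
Variables (R : realType) (X : ptopologicalType) (E : twisted_groupoid R X).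
Variables (mu : set (borelType X) -> \bar R) (K : L2_completion E mu).
Let C := cplx R.

(* T = Reg f, that is, T is the bounded extension of xi |-> f * xi. *)
Definition is_Reg (f : tw_ext E -> C) (T : K -> K) :=
  bounded_operator T /\
  forall g, Cc E g -> T (L2_class K g) = L2_class K (convolution f g).

Definition Wstar : set (K -> K) :=
  weak_closure [set T | exists2 f, Cc E f & is_Reg f T].

(* The vector xi of the completion is the class of the function h. *)
Definition represented_by (xi : K) (h : tw_ext E -> C) :=
  forall f, Cc E f -> hdot K xi (L2_class K f) = inner_Cc mu f h.

(* For g in Cc and b bounded Borel, (b o r) g is square integrable but need not
   belong to Cc. *)
Definition Linfty : set (K -> K) :=
  [set M | bounded_operator M /\
    exists2 b : X -> C, bounded_borel b &
      forall g, Cc E g ->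
        represented_by (M (L2_class K g))
          (fun s => b (grng (tw_ext E) s) * g s)].

End VonNeumann.

Arguments Wstar {R X E mu} K.
Arguments Linfty {R X E mu} K.

(* A multiplier action of F = (H, Lambda) on E = (G, Sigma). The map [ma_act] is
   total; only its values at (l, s) with d(l) = rho(s) are meaningful. *)
Record multiplier_action (R : realType) (Y X : topologicalType)
    (F : twisted_groupoid R Y) (E : twisted_groupoid R X) :=
  MultiplierAction {
  ma_moment : tw_ext E -> Y;
  ma_act : tw_ext F -> tw_ext E -> tw_ext E;
  ma_moment_continuous : continuous ma_moment;
  ma_act_continuous :
    {within [set ls : tw_ext F * tw_ext E | gdom _ ls.1 = ma_moment ls.2],
      continuous (fun ls => ma_act ls.1 ls.2)};
  ma_moment_act : forall l s, gdom _ l = ma_moment s ->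
    ma_moment (ma_act l s) = grng _ l;
  ma_act1 : forall s, ma_act (gunit _ (ma_moment s)) s = s;
  ma_actM : forall l m s, gdom _ l = grng _ m -> gdom _ m = ma_moment s ->
    ma_act (gmul _ l m) s = ma_act l (ma_act m s);
  ma_moment_mul : forall s t, gdom _ s = grng _ t ->
    ma_moment (gmul _ s t) = ma_moment s;
  ma_dom_act : forall l s, gdom _ l = ma_moment s ->
    gdom _ (ma_act l s) = gdom _ s;
  ma_act_mul : forall l s t, gdom _ l = ma_moment s -> gdom _ s = grng _ t ->
    ma_act l (gmul _ s t) = gmul _ (ma_act l s) t;
  ma_act_scale : forall c l s, circle R c -> gdom _ l = ma_moment s ->
    ma_act (tw_scale F c l) s = ma_act l (tw_scale E c s)
}.

Section MultiplierActions.
Variables (R : realType) (Y X : topologicalType).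
Variables (F : twisted_groupoid R Y) (E : twisted_groupoid R X).
Variable a : multiplier_action F E.
Let C := cplx R.

Definition anchor (x : X) : Y := ma_moment a (gunit (tw_ext E) x).

Definition jtilde (f : tw_ext F -> C) : tw_ext E -> C := fun s =>
  let x := gdom (tw_ext E) s in
  \sum_(l \in [set l | gdom (tw_ext F) l = anchor x /\
                       ma_act a l (gunit (tw_ext E) x) = s]) f l.

Definition Cc_star_hom (j : (tw_ext F -> C) -> (tw_ext E -> C)) :=
  [/\ forall f, Cc F f -> Cc E (j f),
      forall c f g, Cc F f -> Cc F g ->
        j (fun l => c * f l + g l) = (fun s => c * j f s + j g s),
      forall f g, Cc F f -> Cc F g ->
        j (convolution f g) = convolution (j f) (j g) &
      forall f, Cc F f -> j (involution f) = involution (j f)].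

End MultiplierActions.

(* Main.v *)
(* The groupoid (H, Lambda) records a countable part of (G, Sigma). Since L^2 is
   separable, there is a countable family of compact bisections S_i of Sigma,
   closed under products and inverses, such that functions carried by the S_i
   approximate all the terms Delta_S (b o d) in L^2 without increasing the bounds.
   Let pi : X -> Y be the quotient of X which separates the clopen sets d(S_i).
   The arrows of Lambda are the sets t S_i \cap d^-1(pi^-1 y), multiplied as sets,
   and l s is the only element of the product set. The family also contains, as
   sets of units, the closures of the level sets of the ratio of S_i to S_j and
   countably many clopen sets exhausting {x | p S_i(x) = p S_j(x)} up to a nowhere
   dense set. The former make Lambda a groupoid with open charts
   (y, t) |-> t S_i \cap d^-1(pi^-1 y); the latter make h |-> h x injective on the
   fibre of H over pi x for almost every x, so that jtilde preserves the fibrewise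
   inner products almost everywhere and hence defines J.

   If f_n -> f fast enough in L^2, with f_n and f carried by bisections and
   uniformly bounded, then Reg(f_n) -> Reg(f) strongly: this gives the isomorphism
   of von Neumann algebras. On X a Borel set is clopen up to a null set, and a
   clopen set is, up to a null set, a limit superior of preimages of clopen sets
   of Y; hence every bounded Borel function on X is almost everywhere of the form
   b' o pi. *)
Require Import Defs.
From HB Require Import structures.
From mathcomp Require Import all_boot all_order all_algebra.
From mathcomp Require Import complex.
From mathcomp Require Import all_classical all_reals all_analysis.
From mathcomp Require Import measurable_realfun finmap lra ring.
Set Implicit Arguments.
Unset Strict Implicit.
Unset Printing Implicit Defensive.
Import Order.TTheory GRing.Theory Num.Theory.
Import numFieldNormedType.Exports.
Local Open Scope classical_set_scope.
Local Open Scope ring_scope.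

(** * Topology and complex numbers *)

Section ElementaryTopology.
Implicit Types T U : topologicalType.

(** The obstacle is that G need not be Hausdorff. The agreement set {x | p S_i(x) = p S_j(x)} is
    open because G is étale, but it need not be closed, and membership in its closure does not imply
    agreement. Hence only clopen subsets of it enter the family: agreement at one point of such a
    subset means agreement over the whole fibre of pi, and the boundary that is left out is null.
    For the scalar ratio closures do no harm: the level set of an open V and that of the complement
    of the closure of V are disjoint open sets, so neither meets the closure of the other, and this
    forces the ratio to be constant on the fibres of pi. With sets as arrows, the identification of
    s S_j with t S_i over y is an equality, so that no quotient is formed and the groupoid laws are
    inherited from products of sets. One construction serves twice: Sigma with its circle action
    gives Lambda, G with the trivial scaling gives H. The approximations have to respect sup norm
    bounds because the norm of Reg of a term is controlled by the sup of its coefficient, not by its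
    L^2 norm. Separability is therefore used on each set of terms with |b| <= M separately. *)

Lemma nbhs_openP T (x : T) (A : set T) :
  nbhs x A <-> exists2 W, open_nbhs x W & W `<=` A.
Proof. by rewrite nbhsE. Qed.

Lemma openP T (A : set T) :
  open A <-> forall x, A x -> exists V, [/\ open V, V x & V `<=` A].
Proof.
split=> [oA x Ax|h]; first by exists A; split.
rewrite openE => x /h [V [oV Vx VA]].
by apply: (filterS VA); exact: open_nbhs_nbhs.
Qed.

Lemma withinP T U (A : set T) (f : T -> U) :
  {within A, continuous f} <->
  forall x V, A x -> open V -> V (f x) ->
    exists W, [/\ open W, W x & forall z, W z -> A z -> V (f z)].
Proof.
rewrite subspace_continuousP; split=> [h x V Ax oV Vfx|h x Ax V].
  have := h x Ax V (open_nbhs_nbhs (conj oV Vfx)).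
  rewrite nbhs_simpl /within /= !near_simpl => /nbhs_openP [W [oW Wx] WV].
  by exists W; split=> // z Wz Az; exact: WV.
move=> /nbhs_openP [V' [oV' V'x] V'V].
have [W [oW Wx WV]] := h x V' Ax oV' V'x.
rewrite nbhs_simpl /within /= !near_simpl; apply/nbhs_openP; exists W => //.
by move=> z Wz Az; apply: V'V; exact: WV.
Qed.

Lemma contP T U (f : T -> U) :
  continuous f <->
  forall x V, open V -> V (f x) ->
    exists W, [/\ open W, W x & forall z, W z -> V (f z)].
Proof.
split=> [h x V oV Vfx|h].
  by exists (f @^-1` V); split=> //; apply: open_comp => // + _; exact: h.
apply/continuousP => V oV; apply/openP => x Vx.
by have [W [? ? WV]] := h x V oV Vx; exists W; split.
Qed.

Lemma within_subset_continuous T U (A B : set T) (f : T -> U) :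
  A `<=` B -> {within B, continuous f} -> {within A, continuous f}.
Proof.
move=> AB /withinP h; apply/withinP => x V Ax oV Vx.
have [W [? ? WV]] := h x V (AB _ Ax) oV Vx.
by exists W; split=> // z Wz /AB; exact: WV.
Qed.

Lemma open_setX T U (A : set T) (B : set U) :
  open A -> open B -> open (A `*` B).
Proof.
move=> oA oB; rewrite openE => -[x y] [/= Ax By].
by exists (A, B) => //; split; exact: open_nbhs_nbhs.
Qed.

Lemma open_prodP T U (A : set (T * U)) (x : T) (y : U) :
  open A -> A (x, y) -> exists V W,
    [/\ open V, open W, V x, W y & forall v w, V v -> W w -> A (v, w)].
Proof.
rewrite openE => oA /oA [[P Q] [/=]].
rewrite !nbhsE => -[V [oV Vx] VP] [W [oW Wy] WQ] PQA.
by exists V, W; split=> // v w Vv Ww; apply: PQA; split; [exact: VP|exact: WQ].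
Qed.

Lemma hausdorff_sep T (x y : T) : hausdorff_space T -> x <> y ->
  exists V W, [/\ open V, open W, V x, W y & V `&` W = set0].
Proof.
rewrite open_hausdorff => h /eqP /h [[V W] [/= Vx Wy] [oV oW /eqP VW]].
by exists V, W; split=> //; exact: set_mem.
Qed.

Lemma hausdorff_intro T :
  (forall x y : T, x <> y ->
    exists V W, [/\ open V, open W, V x, W y & V `&` W = set0]) ->
  hausdorff_space T.
Proof.
move=> h; rewrite open_hausdorff => x y /eqP /h [V [W [oV oW Vx Wy VW]]].
by exists (V, W); [split; exact: mem_set|split=> //; rewrite VW].
Qed.

Lemma hausdorff_set_type T (K : set T) :
  (forall x y : T, K x -> K y -> x <> y -> exists V W,
    [/\ open V, open W, V x, W y & V `&` W `&` K = set0]) ->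
  hausdorff_space (set_type K).
Proof.
move=> h; apply: hausdorff_intro => -[x Kx] [y Ky] xy.
have xy' : x <> y by move=> e; apply: xy; exact: eq_exist.
have Kx' := set_mem Kx; have Ky' := set_mem Ky.
have [V [W [oV oW Vx Wy VWK]]] := h x y Kx' Ky' xy'.
exists (set_val @^-1` V), (set_val @^-1` W); split.
- by exists V.
- by exists W.
- by [].
- by [].
apply/seteqP; split=> // -[z Kz] [/= Vz Wz].
have : (V `&` W `&` K) z by split; [split|exact: set_mem].
by rewrite VWK.
Qed.

Lemma compact_image_closed T U (f : T -> U) (S C : set T) :
  compact S -> hausdorff_space U -> {within S, continuous f} ->
  closed C -> closed (f @` (S `&` C)).
Proof.
move=> cS hU cf clC; apply: compact_closed => //.
apply: continuous_compact; last exact: compact_closedI.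
exact: within_subset_continuous cf.
Qed.

(** The part of S outside V is compact, so its image is closed; the complement of this image is the
    open set that cuts out the image of the part inside V. *)
Lemma compact_embedding T U (f : T -> U) (S : set T) :
  compact S -> hausdorff_space U -> set_inj S f ->
  {within S, continuous f} -> embedding_on S f.
Proof.
move=> cS hU injf cf; split=> // V oV.
exists (~` (f @` (S `&` ~` V))).
  by apply: closed_openC; apply: compact_image_closed => //; exact: open_closedC.
apply/seteqP; split=> [_ [x [Sx Vx] <-]|_ [[x Sx <-] nVx]].
  split; first by exists x.
  move=> [z [Sz nVz] fzx]; apply: nVz.
  by rewrite (injf z x _ _ fzx)//; exact: mem_set.
exists x => //; split=> //; apply: contrapT => nV; apply: nVx.
by exists x.
Qed.

Lemma embedding_inv T U (f : T -> U) (S : set T) (g : U -> T) :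
  embedding_on S f -> (forall x, S x -> g (f x) = x) ->
  {within f @` S, continuous g}.
Proof.
move=> [_ _ emb] gK; apply/withinP => _ V [x Sx <-] oV; rewrite gK// => Vx.
have [W oW eW] := emb V oV.
have : (f @` S `&` W) (f x) by rewrite -eW; exists x.
move=> [_ Wfx]; exists W; split=> // z Wz [y Sy yz]; subst z.
have : (f @` (S `&` V)) (f y) by rewrite eW; split=> //; exists y.
move=> [y' [Sy' Vy'] e]; suff -> : g (f y) = y' by [].
by rewrite -e gK.
Qed.

(** Regularity gives an open neighbourhood of x whose closure lies in U; extremal disconnectedness
    makes that closure clopen. *)
Lemma stonian_clopen T (U : set T) (x : T) : stonian_space T -> open U -> U x ->
  exists e, [/\ clopen e, e x & e `<=` U].
Proof.
move=> [cT hT stT] oU Ux.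
have reg : regular_space T.
  by move=> y; apply: (@compact_regular _ y setT) => //; exact: filterT.
have [V] := reg x U (open_nbhs_nbhs (conj oU Ux)).
rewrite nbhsE => -[V' [oV' V'x] V'V] VU.
exists (closure V'); split.
- by split; [exact: stT|exact: closed_closure].
- exact: subset_closure.
- exact: subset_trans (closureS V'V) VU.
Qed.

(** The complements of the [F i] cover the compact complement of U, so finitely many of them do. *)
Lemma compact_capI (T : ptopologicalType) (I : choiceType) (D : set I) (F : I -> set T) (U : set T) :
  compact [set: T] -> open U -> (forall i, closed (F i)) ->
  \bigcap_(i in D) F i `<=` U ->
  exists D' : {fset I}, (forall i, i \in D' -> D i) /\
    \bigcap_(i in [set i | i \in D']) F i `<=` U.
Proof.
move=> cT oU clF DU.
have cU : compact (~` U).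
  by apply: (subclosed_compact _ cT) => //; exact: open_closedC.
rewrite compact_cover in cU.
have [||D' D'D D'U] := cU I D (fun i => ~` F i).
- by move=> i _; exact: closed_openC.
- move=> x nUx; apply: contrapT => h; apply: nUx; apply: DU => i Di.
  by apply: contrapT => nF; apply: h; exists i.
exists D'; split=> [i /D'D|x h]; first exact: set_mem.
apply: contrapT => nUx; have [i iD' nF] := D'U x nUx.
by apply: nF; exact: h.
Qed.

End ElementaryTopology.


Section NormedTopology.
Variable K : numFieldType.
Implicit Type V : normedModType K.

Lemma open_norm_ball V (x : V) (e : K) : open [set y | `|x - y| < e].
Proof.
rewrite openE => y /= xy; apply/nbhs_normP; exists (e - `|x - y|).
  by rewrite /= subr_gt0.
move=> z /= yz; rewrite -(subrKA y); apply: le_lt_trans (ler_normD _ _) _.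
by rewrite addrC -ltrBrDr.
Qed.

Lemma open_norm_ballP V (A : set V) (x : V) : open A -> A x ->
  exists2 e : K, 0 < e & forall y, `|x - y| < e -> A y.
Proof.
move=> oA Ax; have /nbhs_normP [e e0 eA] := open_nbhs_nbhs (conj oA Ax).
by exists e => // y xy; apply: eA.
Qed.

Lemma continuous_norm_intro (T : topologicalType) V (f : T -> V) :
  (forall x (e : K), 0 < e -> exists W, [/\ open W, W x &
    forall z, W z -> `|f x - f z| < e]) -> continuous f.
Proof.
move=> h; apply/contP => x A oA Afx.
have [e e0 eA] := open_norm_ballP oA Afx.
have [W [oW Wx hW]] := h x e e0.
by exists W; split=> // z Wz; apply: eA; exact: hW.
Qed.

Lemma within_continuousM (T : topologicalType) (A : set T) (f g : T -> K) :
  {within A, continuous f} -> {within A, continuous g} ->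
  {within A, continuous (fun x => f x * g x)}.
Proof.
move=> /subspace_continuousP cf /subspace_continuousP cg.
by apply/subspace_continuousP => x Ax; apply: cvgM; [exact: cf|exact: cg].
Qed.

End NormedTopology.

Section WithinContinuity.
Implicit Types T U W : topologicalType.

Lemma continuous_within T U (A : set T) (f : T -> U) :
  continuous f -> {within A, continuous f}.
Proof. exact: continuous_subspaceT. Qed.

Lemma within_continuous T U (f : T -> U) :
  {within [set: T], continuous f} -> continuous f.
Proof.
move=> /withinP h; apply/contP => x V oV Vx.
by have [Z [? ? ZV]] := h x V I oV Vx; exists Z; split=> // z /ZV; exact.
Qed.

Lemma fst_continuous T U : continuous (@fst T U).
Proof. by move=> x; exact: cvg_fst. Qed.

Lemma snd_continuous T U : continuous (@snd T U).
Proof. by move=> x; exact: cvg_snd. Qed.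

Lemma within_comp T U W (A : set T) (B : set U) (f : T -> U) (g : U -> W) :
  {within A, continuous f} -> {within B, continuous g} ->
  (forall x, A x -> B (f x)) -> {within A, continuous (fun x => g (f x))}.
Proof.
move=> /withinP cf /withinP cg AB; apply/withinP => x V Ax oV Vx.
have [Z [oZ Zx ZV]] := cg (f x) V (AB _ Ax) oV Vx.
have [Z' [oZ' Zx' ZV']] := cf x Z Ax oZ Zx.
by exists Z'; split=> // z Zz Az; apply: ZV; [exact: ZV'|exact: AB].
Qed.

Lemma within_compT T U W (A : set T) (f : T -> U) (g : U -> W) :
  {within A, continuous f} -> continuous g ->
  {within A, continuous (fun x => g (f x))}.
Proof.
move=> cf cg; exact: (@within_comp _ _ _ A setT f g cf (continuous_within cg)).
Qed.

Lemma within_pair T U W (A : set T) (f : T -> U) (g : T -> W) :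
  {within A, continuous f} -> {within A, continuous g} ->
  {within A, continuous (fun x => (f x, g x))}.
Proof.
move=> /withinP cf /withinP cg; apply/withinP => x V Ax oV.
move=> /(open_prodP oV) [P [Q [oP oQ Px Qx PQV]]].
have [Z1 [oZ1 Zx1 ZP]] := cf x P Ax oP Px.
have [Z2 [oZ2 Zx2 ZQ]] := cg x Q Ax oQ Qx.
exists (Z1 `&` Z2); split=> //; first exact: openI.
by move=> z [? ?] Az; apply: PQV; [exact: ZP|exact: ZQ].
Qed.

Lemma within_preimage_open T U (A : set T) (f : T -> U) (V : set U) :
  open A -> {within A, continuous f} -> open V -> open (A `&` f @^-1` V).
Proof.
move=> oA /withinP cf oV; apply/openP => x [Ax Vx].
have [Z [oZ Zx ZV]] := cf x V Ax oV Vx.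
exists (Z `&` A); split=> //; first exact: openI.
by move=> z [Zz Az]; split=> //; exact: ZV.
Qed.

End WithinContinuity.


Section ComplexNumbers.
Variable R : realType.
Local Notation C := (cplx R).

Lemma normc_ge_Im (x : R[i]) : (`|complex.Im x|%:C)%C <= `|x|.
Proof.
rewrite normc_def lecR -sqrtr_sqr ler_wsqrtr //.
by rewrite lerDr sqr_ge0.
Qed.

Lemma normc_le_ReIm (x : R[i]) :
  `|x| <= ((`|complex.Re x| + `|complex.Im x|)%:C)%C.
Proof.
rewrite normc_def lecR -[leRHS]ger0_norm ?addr_ge0// -sqrtr_sqr ler_wsqrtr//.
have := normr_ge0 (complex.Re x); have := normr_ge0 (complex.Im x).
by rewrite -(real_normK (num_real (complex.Re x))) -(real_normK (num_real (complex.Im x))); nra.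
Qed.

Lemma gt0_cplxE (e : C) : 0 < e -> exists2 r : R, 0 < r & e = (r%:C)%C.
Proof.
move=> e0; have : e \is Num.real by rewrite realE ltW.
by move=> /RRe_real ee; exists (complex.Re e) => //; rewrite -ltcR ee.
Qed.

Lemma Re_cplx_continuous : continuous (fun z : C => complex.Re z : R).
Proof.
apply: continuous_norm_intro => z e e0.
exists [set w | `|z - w| < (e%:C)%C]; split; first exact: open_norm_ball.
  by rewrite /= subrr normr0 ltcR.
move=> w /= zw; rewrite -ltcR; apply: le_lt_trans zw.
by have := normc_ge_Re (z - w); case: (z) (w) => a b [c d].
Qed.

Lemma Im_cplx_continuous : continuous (fun z : C => complex.Im z : R).
Proof.
apply: continuous_norm_intro => z e e0.
exists [set w | `|z - w| < (e%:C)%C]; split; first exact: open_norm_ball.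
  by rewrite /= subrr normr0 ltcR.
move=> w /= zw; rewrite -ltcR; apply: le_lt_trans zw.
by have := normc_ge_Im (z - w); case: (z) (w) => a b [c d].
Qed.

Lemma conj_cplx_continuous : continuous (@Num.conj C).
Proof.
apply: continuous_norm_intro => z e e0.
exists [set w | `|z - w| < e]; split; first exact: open_norm_ball.
  by rewrite /= subrr normr0.
by move=> w /= zw; rewrite -rmorphB norm_conjC.
Qed.

Lemma within_cplxM (T : topologicalType) (A : set T) (f g : T -> C) :
  {within A, continuous f} -> {within A, continuous g} ->
  {within A, continuous (fun x => f x * g x)}.
Proof. exact: (@within_continuousM C). Qed.

Lemma cplx_continuousM (T : topologicalType) (f g : T -> C) :
  continuous f -> continuous g -> continuous (fun x => f x * g x).
Proof.
move=> cf cg; apply: within_continuous.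
exact: (within_cplxM (continuous_within cf) (continuous_within cg)).
Qed.

Lemma circle1 : circle R 1. Proof. exact: normr1. Qed.

Lemma circleM (s t : C) : circle R s -> circle R t -> circle R (s * t).
Proof. by rewrite /circle /= normrM => -> ->; rewrite mulr1. Qed.

Lemma circle_conj (t : C) : circle R t -> circle R (Num.conj t).
Proof. by rewrite /circle /= norm_conjC. Qed.

Lemma circle_conjM (t : C) : circle R t -> Num.conj t * t = 1.
Proof. by move=> ct; rewrite mulrC -normCK ct expr1n. Qed.

Lemma circle_mulC (t : C) : circle R t -> t * Num.conj t = 1.
Proof. by move=> ct; rewrite mulrC circle_conjM. Qed.

Lemma circle_neq0 (t : C) : circle R t -> t != 0.
Proof. by rewrite -normr_eq0 /circle /= => ->; exact: oner_neq0. Qed.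

(** The circle is a closed subset of the image of the square [-1, 1]^2 under (a, b) |-> a + ib. *)
Lemma compact_circle : compact (circle R).
Proof.
pose f (x : R * R) : C := (x.1 +i* x.2)%C.
have fc : continuous f.
  apply: continuous_norm_intro => -[a b] _ /gt0_cplxE [e e0 ->].
  exists ([set x | `|a - x| < e / 2] `*` [set x | `|b - x| < e / 2]); split.
  - by apply: open_setX; exact: open_norm_ball.
  - by split; rewrite /= subrr normr0 divr_gt0.
  - move=> [c d] [/= ac bd]; apply: le_lt_trans (normc_le_ReIm _) _.
    by rewrite ltcR /=; lra.
have cb : compact (f @` (`[-1, 1]%classic `*` `[-1, 1]%classic)).
  apply: continuous_compact; first exact: continuous_subspaceT.
  by apply: compact_setX; exact: segment_compact.
apply: (subclosed_compact _ cb).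
  have -> : circle R = (fun z : C => `|z|) @^-1` [set 1] by [].
  have nc : continuous (fun z : C => `|z| : C).
    apply: continuous_norm_intro => z e e0.
    exists [set w | `|z - w| < e]; split; first exact: open_norm_ball.
      by rewrite /= subrr normr0.
    by move=> w /=; apply: le_lt_trans; exact: ler_dist_dist.
  move/continuous_closedP : nc; apply.
  exact: (accessible_closed_set1 (hausdorff_accessible (@norm_hausdorff _ _))).
move=> z cz; exists (complex.Re z, complex.Im z); last by case: (z).
have h1 := normc_ge_Re z; have h2 := normc_ge_Im z.
move: h1 h2; rewrite cz !lecR !ler_norml => h1 h2.
by split; rewrite /= in_itv.
Qed.

(** The discs of radius 1/(m+1) about Gaussian rationals. That even the closure lies in U is what
    later lets closures of level sets tell two values apart. *)
Lemma cplx_countable_base : exists V : nat -> set C, (forall n, open (V n)) /\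
  forall (z : C) U, open U -> U z -> exists n, V n z /\ closure (V n) `<=` U.
Proof.
pose c (p q : rat) : C := (ratr p +i* ratr q)%C.
pose V (n : nat) : set C := if (choice.unpickle n : option (rat * rat * nat)) is Some (p, q, m)
  then [set z | `|c p q - z| < m.+1%:R^-1] else set0.
exists V; split=> [n|z U oU Uz].
  rewrite /V; case: choice.unpickle => [[[p q] m]|]; last exact: open0.
  exact: open_norm_ball.
have [_ /gt0_cplxE [e e0 ->] eU] := open_norm_ballP oU Uz.
(* A point of the closure is reached from z in three steps, through the centre and through a point
   of the disc, each shorter than the radius; hence a radius below e/3. *)
have [m [k [k0 ke me']]] : exists (m : nat) (k : R),
    [/\ 0 < k, k < e / 3 & (m.+1%:R^-1 : C) = (k%:C)%C].
  have e3 : 0 < e / 3 by rewrite divr_gt0.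
  have [m hm] := ltr_add_invr e3.
  exists m, (m.+1%:R^-1); split; first by rewrite invr_gt0.
  - by rewrite add0r in hm.
  - by rewrite fmorphV /= rmorph_nat.
have near_rat (a : R) : exists p : rat, `|ratr p - a| < k / 2.
  have [|p] := @rat_in_itvoo R a (a + k / 2); first by lra.
  rewrite in_itv /= => /andP [? ?]; exists p; rewrite ger0_norm; lra.
have [p hp] := near_rat (complex.Re z).
have [q hq] := near_rat (complex.Im z).
have zc : `|c p q - z| < m.+1%:R^-1.
  rewrite me'; apply: le_lt_trans (normc_le_ReIm _) _.
  by move: hp hq; rewrite ltcR /c; case: (z) => a b /=; lra.
exists (choice.pickle (p, q, m)); rewrite /V choice.pickleK; split=> // w clw.
apply: eU.
have [|w' [cw' ww']] := clw [set w' | `|w - w'| < m.+1%:R^-1].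
  apply: open_nbhs_nbhs; split; first exact: open_norm_ball.
  by rewrite /= subrr normr0 me' ltcR.
have -> : z - w = (z - c p q) + (c p q - w') + (w' - w) by ring.
apply: le_lt_trans (ler_normD _ _) _.
apply: le_lt_trans (lerD (ler_normD _ _) (lexx _)) _.
rewrite -(distrC w w') -(distrC (c p q) z).
have : `|c p q - z| + `|c p q - w'| + `|w - w'| <
    m.+1%:R^-1 + m.+1%:R^-1 + m.+1%:R^-1 by exact: (ltrD (ltrD zc cw') ww').
move=> /lt_le_trans; apply.
by rewrite me' -!rmorphD /= lecR; lra.
Qed.

End ComplexNumbers.

(** * Twisted groupoids and convolution *)

Section FiniteSums.
Variables (K : fieldType) (I : choiceType).
Implicit Types (A : set I) (f g : I -> K).

(** A sum with infinite support has the default value 0, which would break additivity. With finite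
    supports, all three sums can be taken over the union of the two supports. *)
Lemma fsbig_linear A (a : K) f g :
  finite_set (A `&` [set i | f i != 0]) ->
  finite_set (A `&` [set i | g i != 0]) ->
  \sum_(i \in A) (a * f i + g i) =
  a * (\sum_(i \in A) f i) + \sum_(i \in A) g i.
Proof.
move=> ff fg; set B := (A `&` [set i | f i != 0]) `|` (A `&` [set i | g i != 0]).
have fB : finite_set B by rewrite finite_setU.
have BA : B `<=` A by move=> i [[]|[]].
have out i : (A `\` B) i -> f i = 0 /\ g i = 0.
  move=> [Ai nB]; split; apply/eqP; apply: contrapT => /negP h; apply: nB.
    by left.
  by right.
rewrite -(@fsbig_widen _ _ _ _ B A)//; last first.
  by move=> i /out [/= -> ->]; rewrite mulr0 addr0.
rewrite -[X in a * X](@fsbig_widen _ _ _ _ B A)//; last by move=> i /out [].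
rewrite -[X in _ + X](@fsbig_widen _ _ _ _ B A)//; last by move=> i /out [].
by rewrite fsbig_split// -fsbig_distrr.
Qed.

Lemma fsbig_single A f (i0 : I) : A i0 ->
  (forall i, A i -> i <> i0 -> f i = 0) -> \sum_(i \in A) f i = f i0.
Proof.
move=> Ai0 h; rewrite -(@fsbig_widen _ _ _ _ [set i0])//.
- by rewrite fsbig_set1.
- by move=> _ ->.
- by move=> i [Ai /= ?]; exact: h.
Qed.

Lemma fsbig_scale A (a : K) f : finite_set (A `&` [set i | f i != 0]) ->
  \sum_(i \in A) a * f i = a * (\sum_(i \in A) f i).
Proof.
move=> ff; have := @fsbig_linear A a f (fun=> 0) ff.
rewrite [X in _ + X]fsbig1// addr0 => <-.
  by apply: eq_fsbigr => i _; rewrite addr0.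
by apply: (@sub_finite_set _ _ set0) => // i []; rewrite /= eqxx.
Qed.

Lemma fsbig_morph A (phi : {rmorphism K -> K}) f :
  finite_set (A `&` [set i | f i != 0]) ->
  \sum_(i \in A) phi (f i) = phi (\sum_(i \in A) f i).
Proof.
set B := (A `&` _) => fB; have BA : B `<=` A by move=> i [].
have out i : (A `\` B) i -> f i = 0.
  by move=> [Ai nB]; apply/eqP; apply: contrapT => /negP h; apply: nB.
rewrite -(@fsbig_widen _ _ _ _ B A)//; last by move=> i /out /= ->; rewrite rmorph0.
rewrite -[X in phi X](@fsbig_widen _ _ _ _ B A)//.
by rewrite !fsbig_finite// rmorph_sum.
Qed.

Lemma finite_set_inj_image (J : Type) (A : set I) (B : set J) (h : I -> J) :
  (forall i j, A i -> A j -> h i = h j -> i = j) ->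
  finite_set B -> h @` A `<=` B -> finite_set A.
Proof.
move=> hi fB /sub_finite_set /(_ fB); apply: card_le_finite.
have /card_eqPle [_ ]// : (h @` A #= A)%card.
by apply: inj_card_eq => i j /set_mem Ai /set_mem Aj; exact: hi.
Qed.

End FiniteSums.

Section GroupoidAlgebra.
Variables (X : topologicalType) (G : top_groupoid X).
Implicit Types g h : G.
Local Notation r := (grng G).
Local Notation d := (gdom G).
Local Notation "g ** h" := (gmul G g h) (at level 40, left associativity).
Local Notation inv := (ginv G).

Lemma gmulKg g h : d g = r h -> inv g ** (g ** h) = h.
Proof. by move=> e; rewrite gmulA ?gdom_inv// gmulVg e gmul1g. Qed.

Lemma gmulVKg g h : r g = r h -> g ** (inv g ** h) = h.
Proof. by move=> e; rewrite gmulA ?grng_inv ?gdom_inv// gmulgV e gmul1g. Qed.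

Lemma gmulgK g h : d g = r h -> (g ** h) ** inv h = g.
Proof. by move=> e; rewrite -gmulA ?grng_inv// gmulgV -e gmulg1. Qed.

Lemma gmulgKV g h : d g = d h -> (g ** inv h) ** h = g.
Proof. by move=> e; rewrite -gmulA ?grng_inv ?gdom_inv// gmulVg -e gmulg1. Qed.

Lemma ginv_unique g h : d g = r h -> g ** h = gunit G (r g) -> h = inv g.
Proof.
move=> e gh; rewrite -[LHS](gmulKg e) gh.
by rewrite -[in RHS](gmulg1 (inv g)) gdom_inv.
Qed.

Lemma ginvK g : inv (inv g) = g.
Proof.
by apply/esym/ginv_unique; rewrite ?gdom_inv// gmulVg grng_inv.
Qed.

Lemma ginvM g h : d g = r h -> inv (g ** h) = inv h ** inv g.
Proof.
move=> e; apply/esym/ginv_unique.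
  by rewrite gdom_mul// grng_mul ?grng_inv ?gdom_inv.
rewrite gmulA ?grng_inv ?gdom_inv ?gdom_mul//.
by rewrite gmulgK// gmulgV grng_mul.
Qed.

End GroupoidAlgebra.

Section SetOperations.
Variables (X : topologicalType) (G : top_groupoid X).
Implicit Types S T : set G.

Definition bmul S T : set G := [set k | exists g h,
  [/\ S g, T h, gdom G g = grng G h & k = gmul G g h]].

Definition dinj S := forall g h, S g -> S h -> gdom G g = gdom G h -> g = h.
Definition rinj S := forall g h, S g -> S h -> grng G g = grng G h -> g = h.

(** By compactness of S and Hausdorffness of X, the embedding clauses come down to injectivity of d
    and r on S. *)
Lemma cbisP S : hausdorff_space X ->
  compact_bisection S <->
  [/\ compact S, dinj S, rinj S, open (gdom G @` S) & open (grng G @` S)].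
Proof.
move=> hX; split=> [[cS [[ir _ _] or [id _ _] od]]|[cS id ir od or]].
  split=> // g h Sg Sh e; [apply: id|apply: ir] => //; exact: mem_set.
split=> //; split=> //; apply: compact_embedding => //.
- by move=> g h /set_mem Sg /set_mem Sh; exact: ir.
- apply: continuous_subspaceT; exact: grng_continuous.
- by move=> g h /set_mem Sg /set_mem Sh; exact: id.
- apply: continuous_subspaceT; exact: gdom_continuous.
Qed.

(** The section of d over d(S) with values in S. With the unit at x as default value, [dsec_dom]
    holds for every x. *)
Definition dsec S (x : X) : G := xget (gunit G x) [set g | S g /\ gdom G g = x].

Lemma dsecP S x : (gdom G @` S) x -> S (dsec S x) /\ gdom G (dsec S x) = x.
Proof.
by move=> [g Sg <-]; rewrite /dsec; case: xgetP => [_ _ []//|/(_ g)[]].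
Qed.

Lemma dsec_dom S x : gdom G (dsec S x) = x.
Proof. by rewrite /dsec; case: xgetP => [_ _ []//|_]; rewrite gdom_unit. Qed.

Lemma dsecE S g : dinj S -> S g -> dsec S (gdom G g) = g.
Proof.
move=> id Sg; have [S' e] : S (dsec S (gdom G g)) /\ _ := dsecP (imageP _ Sg).
exact: id.
Qed.

Lemma dsec_continuous S : compact_bisection S ->
  {within gdom G @` S, continuous (dsec S)}.
Proof.
move=> [_ [_ _ emb _]]; apply: (embedding_inv emb) => g Sg; apply: dsecE => //.
by case: emb => id _ _ g' h' Sg' Sh'; apply: id; exact: mem_set.
Qed.

Hypothesis hX : hausdorff_space X.

Lemma open_dom_image S (V : set G) : compact_bisection S -> open V ->
  open (gdom G @` (S `&` V)).
Proof.
move=> [_ [_ _ [_ _ emb] od]] oV; have [W oW ->] := emb V oV; exact: openI.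
Qed.

Lemma open_rng_image S (V : set G) : compact_bisection S -> open V ->
  open (grng G @` (S `&` V)).
Proof.
move=> [_ [[_ _ emb] or _ _]] oV; have [W oW ->] := emb V oV; exact: openI.
Qed.

(** The product is the image of the composable pairs of S and T, which form a compact set because X
    is Hausdorff; G itself may fail to be. Its domain is the image under d of the part of T with
    range in d(S), which is open because d is relatively open on T; the range is treated
    symmetrically. *)
Lemma cbis_bmul S T : compact_bisection S -> compact_bisection T ->
  compact_bisection (bmul S T).
Proof.
move=> bS bT; have [cS dS rS odS orS] := (cbisP S hX).1 bS.
have [cT dT rT odT orT] := (cbisP T hX).1 bT.
apply/(cbisP _ hX); split.
- pose D := [set gh : G * G | gdom G gh.1 = grng G gh.2].
  have -> : bmul S T = (fun gh => gmul G gh.1 gh.2) @` (S `*` T `&` D).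
    apply/seteqP; split=> [k [g [h [Sg Th e ->]]]|_ [[g h] [[/= Sg Th] e] <-]].
      by exists (g, h).
    by exists g, h.
  apply: continuous_compact.
    apply: within_subset_continuous (@gmul_continuous _ G).
    by move=> ? [].
  apply: compact_closedI; first exact: compact_setX.
  rewrite -openC; apply/openP => -[g h] /= ne.
  have [V [W [oV oW Vg Wh VW]]] := hausdorff_sep hX ne.
  exists ((gdom G @^-1` V) `*` (grng G @^-1` W)); split=> //.
    apply: open_setX; apply: open_comp => // ? _.
      exact: gdom_continuous.
    exact: grng_continuous.
  move=> [g' h'] [/= Vg' Wh'] e; rewrite /D /= in e.
  have : (V `&` W) (gdom G g') by split=> //; rewrite /= e.
  by rewrite VW.
- move=> _ _ [g [h [Sg Th e ->]]] [g' [h' [Sg' Th' e' ->]]].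
  rewrite !gdom_mul// => eh; have hh := dT _ _ Th Th' eh; subst h'.
  by rewrite (dS g g')// e e'.
- move=> _ _ [g [h [Sg Th e ->]]] [g' [h' [Sg' Th' e' ->]]].
  rewrite !grng_mul// => eg; have gg := rS _ _ Sg Sg' eg; subst g'.
  by rewrite (rT h h')// -e -e'.
- have -> : gdom G @` bmul S T = gdom G @` (T `&` grng G @^-1` (gdom G @` S)).
    apply/seteqP; split=> [_ [_ [g [h [Sg Th e ->]]] <-]|_ [h [Th [g Sg e]] <-]].
      by rewrite gdom_mul//; exists h => //; split=> //; exists g.
    by exists (gmul G g h); [exists g, h|rewrite gdom_mul].
  apply: open_dom_image => //; apply: open_comp => // ? _; exact: grng_continuous.
- have -> : grng G @` bmul S T = grng G @` (S `&` gdom G @^-1` (grng G @` T)).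
    apply/seteqP; split=> [_ [_ [g [h [Sg Th e ->]]] <-]|_ [g [Sg [h Th e]] <-]].
      by rewrite grng_mul//; exists g => //; split=> //; exists h.
    by exists (gmul G g h); [exists g, h|rewrite grng_mul].
  apply: open_rng_image => //; apply: open_comp => // ? _; exact: gdom_continuous.
Qed.

Lemma cbis_binv S : compact_bisection S -> compact_bisection (ginv G @` S).
Proof.
move=> bS; have [cS dS rS odS orS] := (cbisP S hX).1 bS.
apply/(cbisP _ hX); split.
- apply: continuous_compact => //; apply: continuous_subspaceT.
  exact: ginv_continuous.
- move=> _ _ [g Sg <-] [h Sh <-]; rewrite !gdom_inv => e; congr (ginv G _).
  exact: rS.
- move=> _ _ [g Sg <-] [h Sh <-]; rewrite !grng_inv => e; congr (ginv G _).
  exact: dS.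
- by rewrite image_comp (_ : _ \o _ = grng G)//; apply/funext => g /=; rewrite gdom_inv.
- by rewrite image_comp (_ : _ \o _ = gdom G)//; apply/funext => g /=; rewrite grng_inv.
Qed.

Lemma dom_image_unit (e : set X) : gdom G @` (gunit G @` e) = e.
Proof.
rewrite image_comp -[RHS]image_id; apply: eq_imagel => x _ /=.
by rewrite gdom_unit.
Qed.

Lemma rng_image_unit (e : set X) : grng G @` (gunit G @` e) = e.
Proof.
rewrite image_comp -[RHS]image_id; apply: eq_imagel => x _ /=.
by rewrite grng_unit.
Qed.

Lemma cbis_unit (e : set X) : compact [set: X] -> clopen e ->
  compact_bisection (gunit G @` e).
Proof.
move=> cX [oe ce]; apply/(cbisP _ hX); split.
- apply: continuous_compact; last exact: (subclosed_compact ce cX).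
  by apply: continuous_subspaceT; exact: gunit_continuous.
- by move=> _ _ [x _ <-] [y _ <-]; rewrite !gdom_unit => ->.
- by move=> _ _ [x _ <-] [y _ <-]; rewrite !grng_unit => ->.
- by rewrite dom_image_unit.
- by rewrite rng_image_unit.
Qed.

Lemma bmul_unitE S (e : set X) :
  bmul S (gunit G @` e) = S `&` gdom G @^-1` e.
Proof.
apply/seteqP; split=> [_ [g [_ [Sg [x ex <-] e1 ->]]]|g [Sg eg]].
  rewrite grng_unit in e1; rewrite -e1 gmulg1; split=> //=.
  by rewrite e1.
exists g, (gunit G (gdom G g)); split=> //; last by rewrite gmulg1.
by rewrite grng_unit.
Qed.

Lemma bmul_unitEl S (e : set X) :
  bmul (gunit G @` e) S = S `&` grng G @^-1` e.
Proof.
apply/seteqP; split=> [_ [_ [g [[x ex <-] Sg e1 ->]]]|g [Sg eg]].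
  rewrite gdom_unit in e1; rewrite e1 gmul1g; split=> //=.
  by rewrite -e1.
exists (gunit G (grng G g)), g; split=> //; last by rewrite gmul1g.
by rewrite gdom_unit.
Qed.

End SetOperations.

Section TwistedAlgebra.
Variables (R : realType) (X : topologicalType) (E : twisted_groupoid R X).
Local Notation C := (cplx R).
Local Notation Sigma := (tw_ext E).
Local Notation G := (tw_base E).
Local Notation r := (grng Sigma).
Local Notation d := (gdom Sigma).
Local Notation sc := (tw_scale E).
Local Notation T := (circle R).
Local Notation p := (tw_proj E).
Local Notation "g ** h" := (gmul Sigma g h) (at level 40, left associativity).
Implicit Types (s t : Sigma) (a b c : C).

Lemma tw_hausdorff : hausdorff_space X.
Proof. by have [_] := tw_ext_lc E. Qed.

Lemma rng_scale c s : T c -> r (sc c s) = r s.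
Proof. by move=> cc; rewrite /tw_scale grng_mul ?tw_rng_iota ?tw_dom_iota. Qed.

Lemma dom_scale c s : T c -> d (sc c s) = d s.
Proof. by move=> cc; rewrite /tw_scale gdom_mul ?tw_dom_iota. Qed.

Lemma scaleA a b s : T a -> T b -> sc a (sc b s) = sc (a * b) s.
Proof.
move=> ca cb; rewrite /tw_scale grng_mul ?tw_dom_iota// tw_rng_iota//.
by rewrite gmulA ?tw_dom_iota ?tw_rng_iota// tw_iotaM.
Qed.

Lemma scale1 s : sc 1 s = s.
Proof. by rewrite /tw_scale tw_iota1 gmul1g. Qed.

Lemma scaleMl c s t : T c -> d s = r t -> sc c s ** t = sc c (s ** t).
Proof.
move=> cc e; rewrite /tw_scale grng_mul// gmulA// ?tw_dom_iota//.
Qed.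

Lemma scaleMr c s t : T c -> d s = r t -> s ** sc c t = sc c (s ** t).
Proof.
move=> cc e; rewrite -scaleMl// {2}/tw_scale tw_central//.
by rewrite /tw_scale -e -gmulA ?tw_dom_iota ?tw_rng_iota.
Qed.

Lemma iota_inj x y a b : T a -> T b ->
  tw_iota E (x, a) = tw_iota E (y, b) -> x = y /\ a = b.
Proof.
move=> ca cb e; have [inj _ _] := tw_iota_embedding E.
have : (x, a) = (y, b) by apply: inj => //; apply: mem_set; split.
by case.
Qed.

Lemma scale_inj a b s : T a -> T b -> sc a s = sc b s -> a = b.
Proof.
move=> ca cb e; have : sc a s ** ginv _ s = sc b s ** ginv _ s by rewrite e.
rewrite !scaleMl ?grng_inv// gmulgV /tw_scale !grng_unit.
have u (t : C) : T t -> tw_iota E (r s, t) ** gunit Sigma (r s) = tw_iota E (r s, t).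
  by move=> ct; rewrite -{2}(tw_dom_iota E (r s) ct) gmulg1.
by rewrite !u// => /iota_inj [].
Qed.

Lemma proj_unit x : p (gunit _ x) = gunit _ x.
Proof.
have : (p @^-1` range (gunit G)) (gunit _ x).
  by rewrite tw_exact -tw_iota1; exists (x, 1) => //; split=> //; exact: circle1.
move=> [x' _ e]; rewrite -e; congr (gunit _ _).
by rewrite -(grng_unit G x') e tw_rng_proj grng_unit.
Qed.

Lemma proj_iota x c : T c -> p (tw_iota E (x, c)) = gunit _ x.
Proof.
move=> cc; have : (tw_iota E @` (setT `*` T)) (tw_iota E (x, c)) by exists (x, c).
rewrite -tw_exact => -[x' _ e]; rewrite -e; congr (gunit _ _).
by rewrite -(grng_unit G x') e tw_rng_proj tw_rng_iota.
Qed.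

Lemma proj_scale c s : T c -> p (sc c s) = p s.
Proof.
move=> cc; rewrite /tw_scale tw_projM ?tw_dom_iota// proj_iota//.
by rewrite -tw_rng_proj gmul1g.
Qed.

Lemma proj_inv s : p (ginv _ s) = ginv _ (p s).
Proof.
apply: ginv_unique; first by rewrite tw_dom_proj tw_rng_proj grng_inv.
by rewrite -tw_projM ?grng_inv// gmulgV proj_unit tw_rng_proj.
Qed.

(** The quotient t s^-1 projects to a unit, so by exactness it belongs to the circle bundle. *)
Lemma proj_eq s t : p s = p t -> exists2 c, T c & t = sc c s.
Proof.
move=> e.
have rst : r s = r t by rewrite -!tw_rng_proj e.
have dst : d s = d t by rewrite -!tw_dom_proj e.
have : (p @^-1` range (gunit G)) (t ** ginv _ s).
  exists (r t) => //; rewrite tw_projM ?grng_inv// proj_inv -e gmulgV.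
  by rewrite tw_rng_proj rst.
rewrite tw_exact => -[[x c] [_ /= cc] ec].
exists c => //; rewrite -(gmulgKV (esym dst)) -ec /tw_scale.
suff -> : x = r s by [].
by rewrite -(tw_rng_iota E x cc) ec grng_mul ?grng_inv.
Qed.

Lemma scaleV c s : T c -> ginv _ (sc c s) = sc (Num.conj c) (ginv _ s).
Proof.
move=> cc; have cc' := circle_conj cc; apply/esym/ginv_unique.
  by rewrite dom_scale// rng_scale// grng_inv.
rewrite scaleMr ?dom_scale ?grng_inv// scaleMl ?grng_inv// scaleA//.
by rewrite circle_conjM// scale1 gmulgV rng_scale.
Qed.

Lemma lift_proj s : exists2 c, T c & tw_lift (p s) = sc c s.
Proof.
by apply: proj_eq; rewrite /tw_lift; case: cid.
Qed.

Lemma proj_lift (h : G) : p (tw_lift h) = h.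
Proof. by rewrite /tw_lift; case: cid. Qed.

Lemma rng_lift (h : G) : r (tw_lift h) = grng _ h.
Proof. by rewrite -tw_rng_proj proj_lift. Qed.

Lemma dom_lift (h : G) : d (tw_lift h) = gdom _ h.
Proof. by rewrite -tw_dom_proj proj_lift. Qed.

(** Such functions are the sections of the line bundle over G associated with the twist. For them
    |f| and conj(f) g are functions on G, so that fibre sums do not depend on the lifts chosen by
    [tw_lift]. *)
Definition equivariant (f : Sigma -> C) :=
  forall c s, T c -> f (sc c s) = Num.conj c * f s.

Lemma DeltaE (S : set Sigma) c s : dinj S -> S s -> T c ->
  Delta S (sc c s) = Num.conj c.
Proof.
move=> iS Ss cc; rewrite /Delta; congr (Num.conj _); case: xgetP.
  move=> b _ [cb [s0 Ss0 e]]; have es : s = s0.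
    by apply: iS => //; rewrite -(dom_scale s cc) e dom_scale.
  by subst s0; apply: (scale_inj cb cc (esym e)).
by move=> /(_ c) []; split=> //; exists s.
Qed.

Lemma Delta1 (S : set Sigma) s : dinj S -> S s -> Delta S s = 1.
Proof.
move=> iS Ss; rewrite -{1}(scale1 s) DeltaE//; last exact: circle1.
exact: rmorph1.
Qed.

Lemma Delta0 (S : set Sigma) s :
  (forall c t, T c -> S t -> s <> sc c t) -> Delta S s = 0.
Proof.
move=> h; rewrite /Delta; case: xgetP => [c _ [cc [t St e]]|_].
  by have := h c t cc St.
exact: rmorph0.
Qed.

Lemma DeltaP (S : set Sigma) s : dinj S ->
  (exists c t, [/\ T c, S t, s = sc c t & Delta S s = Num.conj c]) \/
  ((forall c t, T c -> S t -> s <> sc c t) /\ Delta S s = 0).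
Proof.
move=> iS; have [[c [t [cc St e]]]|h] :=
    pselect (exists c t, [/\ T c, S t & s = sc c t]).
  by left; exists c, t; rewrite e DeltaE.
right; have h' c t : T c -> S t -> s <> sc c t.
  by move=> cc St e; apply: h; exists c, t.
by split=> //; exact: Delta0.
Qed.

Lemma Delta_neq0 (S : set Sigma) s : dinj S -> Delta S s != 0 ->
  exists c t, [/\ T c, S t & s = sc c t].
Proof.
move=> iS; have [[c [t [? ? ? _]]]|[_ ->]] := DeltaP s iS; last by rewrite eqxx.
by exists c, t.
Qed.

Lemma Delta_proj (S : set Sigma) s t : dinj S -> Delta S s != 0 -> S t ->
  (d s = d t) -> p s = p t.
Proof.
move=> iS /(Delta_neq0 iS) [c [u [cc Su ->]]] St; rewrite dom_scale// => e.
by rewrite (iS _ _ Su St e) proj_scale.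
Qed.

Lemma Delta_equivariant (S : set Sigma) : dinj S -> equivariant (Delta S).
Proof.
move=> iS a s ca; have [[c [t [cc St es ->]]]|[h ->]] := DeltaP s iS.
  by rewrite es scaleA// DeltaE//; [rewrite rmorphM|exact: circleM].
rewrite mulr0 Delta0// => c t cc St e.
have ca' := circle_conj ca.
apply: (h (Num.conj a * c) t) => //; first exact: circleM.
by rewrite -scaleA// -e scaleA// circle_conjM// scale1.
Qed.

Lemma Delta_norm (S : set Sigma) s : dinj S -> `|Delta S s| <= 1.
Proof.
move=> iS; have [[c [t [cc _ _ ->]]]|[_ ->]] := DeltaP s iS.
  by rewrite norm_conjC cc.
by rewrite normr0.
Qed.

End TwistedAlgebra.

Section CompactlySupported.
Variables (R : realType) (X : topologicalType) (E : twisted_groupoid R X).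
Hypothesis cX : compact [set: X].
Local Notation C := (cplx R).
Local Notation Sigma := (tw_ext E).
Local Notation G := (tw_base E).
Local Notation r := (grng Sigma).
Local Notation d := (gdom Sigma).
Local Notation sc := (tw_scale E).
Local Notation T := (circle R).
Local Notation p := (tw_proj E).
Local Notation "g ** h" := (gmul Sigma g h) (at level 40, left associativity).
Implicit Types (f g : Sigma -> C) (S : set Sigma) (b : X -> C).

Definition Ccterm S b : Sigma -> C := fun s => Delta S s * b (d s).

Lemma cbis_dinj S : compact_bisection S -> dinj S.
Proof. by move=> /(cbisP _ (tw_hausdorff E)) []. Qed.

Lemma cbis_rinj S : compact_bisection S -> rinj S.
Proof. by move=> /(cbisP _ (tw_hausdorff E)) []. Qed.

Lemma CcX_compact b : continuous b -> CcX b.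
Proof.
move=> cb; split=> //; apply: (subclosed_compact _ cX) => //.
exact: closed_closure.
Qed.

Lemma Cc0 : Cc E (fun=> 0).
Proof.
exists 0%N, (fun=> set0), (fun=> fun=> 0); split; first by case.
by apply/funext => s; rewrite big_ord0.
Qed.

Lemma Cc_cons S b f : compact_bisection S -> continuous b -> Cc E f ->
  Cc E (fun s => Ccterm S b s + f s).
Proof.
move=> bS cb [n [Si [bi [h ->]]]].
exists n.+1, (fun i => if unlift ord0 i is Some j then Si j else S),
  (fun i => if unlift ord0 i is Some j then bi j else b); split.
  move=> i; case: unliftP => [j _|_]; first exact: h.
  by split=> //; exact: CcX_compact.
apply/funext => s; rewrite big_ord_recl /= unlift_none; congr (_ + _).
by apply: eq_bigr => i _; rewrite liftK.
Qed.

(** Induction on the number of terms. Membership in [Cc] is carried along, since the step of most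
    applications needs it for the remaining sum. *)
Lemma Cc_ind (P : (Sigma -> C) -> Prop) : P (fun=> 0) ->
  (forall S b f, compact_bisection S -> continuous b -> Cc E f -> P f ->
    P (fun s => Ccterm S b s + f s)) ->
  forall f, Cc E f -> P f.
Proof.
move=> P0 PS f [n [S [b [h ->]]]].
suff : Cc E (fun s => \sum_(i < n) Delta (S i) s * b i (d s)) /\
  P (fun s => \sum_(i < n) Delta (S i) s * b i (d s)) by case.
elim: n S b h => [|n ih] S b h.
  have -> : (fun s => \sum_(i < 0) Delta (S i) s * b i (d s)) = (fun=> 0 : C).
    by apply/funext => s; rewrite big_ord0.
  by split=> //; exact: Cc0.
have -> : (fun s => \sum_(i < n.+1) Delta (S i) s * b i (d s)) =
  (fun s => Ccterm (S ord0) (b ord0) s +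
    \sum_(i < n) Delta (S (lift ord0 i)) s * b (lift ord0 i) (d s)).
  by apply/funext => s; rewrite big_ord_recl.
have [Cf Pf] := ih (S \o lift ord0) (b \o lift ord0) (fun i => h (lift ord0 i)).
have [bS [cb _]] := h ord0.
by split; [exact: Cc_cons|exact: PS].
Qed.

Lemma Cc_term S b : compact_bisection S -> continuous b -> Cc E (Ccterm S b).
Proof.
move=> bS cb; rewrite (_ : Ccterm S b = (fun s => Ccterm S b s + 0)).
  by apply: Cc_cons => //; exact: Cc0.
by apply/funext => s; rewrite addr0.
Qed.

Lemma Cc_lin (a : C) f g : Cc E f -> Cc E g -> Cc E (fun s => a * f s + g s).
Proof.
move=> Cf Cg; move: f Cf; apply: Cc_ind => [|S b f bS cb Cf ih].
  by rewrite (_ : (fun s => _) = g)//; apply/funext => s; rewrite mulr0 add0r.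
rewrite (_ : (fun s => _) =
  (fun s => Ccterm S (fun x => a * b x) s + (a * f s + g s))).
  apply: (Cc_cons bS _ ih).
  exact: (cplx_continuousM (@cst_continuous _ _ a) cb).
by apply/funext => s; rewrite /Ccterm; ring.
Qed.

Lemma Cc_equivariant f : Cc E f -> equivariant f.
Proof.
move: f; apply: Cc_ind => [c s _|S b f bS cb _ ih c s cc]; first by rewrite mulr0.
rewrite ih// /Ccterm dom_scale// Delta_equivariant//; last exact: cbis_dinj.
by ring.
Qed.

Definition fibre_finite f := forall x,
  finite_set ([set h : G | gdom G h = x] `&` [set h | f (tw_lift h) != 0]) /\
  finite_set ([set h : G | grng G h = x] `&` [set h | f (tw_lift h) != 0]).

(** A bisection meets each fibre of d and each fibre of r in at most one arrow. *)
Lemma Cc_fibre_finite f : Cc E f -> fibre_finite f.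
Proof.
move: f; apply: Cc_ind => [x|S b f bS cb _ ih x].
  by split; apply: (@sub_finite_set _ _ set0) => // h /= []; rewrite eqxx.
have iS := cbis_dinj bS; have jS := cbis_rinj bS.
have aux (A : set G) : finite_set (A `&` [set h | f (tw_lift h) != 0]) ->
    finite_set (A `&` [set h | exists2 s, S s & h = p s]) ->
    finite_set (A `&` [set h | Ccterm S b (tw_lift h) + f (tw_lift h) != 0]).
  move=> f1 f2; apply: (@sub_finite_set _ _ ((A `&` [set h | f (tw_lift h) != 0])
     `|` (A `&` [set h | exists2 s, S s & h = p s]))); last by rewrite finite_setU.
  move=> h [Ah /= nz]; have [fh|fh] := eqVneq (f (tw_lift h)) 0; last by left.
  right; split=> //; rewrite fh addr0 /Ccterm in nz.
  have {}nz : Delta S (tw_lift h) != 0 by apply: contraNneq nz => ->; rewrite mul0r.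
  have [c [t [cc St e]]] := Delta_neq0 iS nz.
  by exists t => //; rewrite -(proj_scale t cc) -e proj_lift.
have [f1 f2] := ih x; split; apply: aux => //.
- apply: (@sub_finite_set _ _ [set p (dsec S x)]) => // h [/= hx [s Ss e]].
  by rewrite e -(dsecE iS Ss) -hx e tw_dom_proj.
- have [[s0 Ss0 s0x]|h0] := pselect (exists2 s, S s & r s = x).
    apply: (@sub_finite_set _ _ [set p s0]) => // h [/= hx [s Ss e]].
    by rewrite e; congr p; apply: jS => //; rewrite s0x -hx e tw_rng_proj.
  apply: (@sub_finite_set _ _ set0) => // h [/= hx [s Ss e]].
  by apply: h0; exists s => //; rewrite -hx e tw_rng_proj.
Qed.

Lemma equivariant_lift f s : equivariant f -> exists2 c, T c &
  tw_lift (p s) = sc c s /\ f (tw_lift (p s)) = Num.conj c * f s.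
Proof.
by move=> ef; have [c cc e] := lift_proj s; exists c; rewrite // e ef.
Qed.

Lemma conv_term S b g s t : compact_bisection S -> equivariant g ->
  S t -> r t = r s -> convolution (Ccterm S b) g s = b (d t) * g (ginv _ t ** s).
Proof.
move=> bS eg St e; have iS := cbis_dinj bS.
rewrite /convolution (@fsbig_single _ _ _ _ (p t)).
- have [c cc ec] := lift_proj t.
  have cc' := circle_conj cc.
  rewrite ec /Ccterm dom_scale// DeltaE// scaleV// scaleMl ?gdom_inv// eg//.
  by rewrite conjCK -mulrA mulrCA (mulrA (Num.conj c)) circle_conjM// mul1r.
- by rewrite /= tw_rng_proj.
- move=> h /= hs hp; have [[c [u [cc Su eh _]]]|[_ e0]] := DeltaP (tw_lift h) iS.
    exfalso; apply: hp; rewrite -(proj_lift h) eh proj_scale//; congr p.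
    apply: (cbis_rinj bS) => //; rewrite e -hs -(rng_scale u cc) -eh.
    by rewrite rng_lift.
  by rewrite /Ccterm e0 !mul0r.
Qed.

Lemma conv_term0 S b g s : compact_bisection S ->
  (forall t, S t -> r t <> r s) -> convolution (Ccterm S b) g s = 0.
Proof.
move=> bS ne; have iS := cbis_dinj bS; rewrite /convolution fsbig1// => h /= hs.
have [[c [u [cc Su eh _]]]|[_ e]] := DeltaP (tw_lift h) iS.
  by case: (ne u Su); rewrite -hs -(rng_scale u cc) -eh rng_lift.
by rewrite /Ccterm e !mul0r.
Qed.

Lemma conv_linear_l (a : C) f1 f2 g : fibre_finite f1 -> fibre_finite f2 ->
  convolution (fun s => a * f1 s + f2 s) g =
  (fun s => a * convolution f1 g s + convolution f2 g s).
Proof.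
move=> ff1 ff2; apply/funext => s; rewrite /convolution -fsbig_linear.
- by apply: eq_fsbigr => h _; ring.
- apply: sub_finite_set (ff1 (r s)).2 => h [/= hs nz]; split=> //.
  by apply: contraNneq nz => ->; rewrite mul0r.
- apply: sub_finite_set (ff2 (r s)).2 => h [/= hs nz]; split=> //.
  by apply: contraNneq nz => ->; rewrite mul0r.
Qed.

Lemma conv_linear_r (a : C) f g1 g2 : fibre_finite f ->
  convolution f (fun s => a * g1 s + g2 s) =
  (fun s => a * convolution f g1 s + convolution f g2 s).
Proof.
move=> ff; apply/funext => s; rewrite /convolution -fsbig_linear.
- by apply: eq_fsbigr => h _; ring.
- apply: sub_finite_set (ff (r s)).2 => h [/= hs nz]; split=> //.
  by apply: contraNneq nz => ->; rewrite mul0r.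
- apply: sub_finite_set (ff (r s)).2 => h [/= hs nz]; split=> //.
  by apply: contraNneq nz => ->; rewrite mul0r.
Qed.

Lemma conv0l g : convolution (fun=> 0) g = (fun=> 0 : C).
Proof. by apply/funext => s; rewrite /convolution fsbig1// => h _; rewrite mul0r. Qed.

Lemma conv0r f : convolution f (fun=> 0) = (fun=> 0 : C).
Proof. by apply/funext => s; rewrite /convolution fsbig1// => h _; rewrite mulr0. Qed.

Lemma conv_Cc_cons S b f g : compact_bisection S -> continuous b -> Cc E f ->
  convolution (fun s => Ccterm S b s + f s) g =
  (fun s => convolution (Ccterm S b) g s + convolution f g s).
Proof.
move=> bS cb Cf.
have := @conv_linear_l 1 (Ccterm S b) f g (Cc_fibre_finite (Cc_term bS cb))
  (Cc_fibre_finite Cf).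
under eq_fun do rewrite mul1r; move=> ->.
by under eq_fun do rewrite mul1r.
Qed.

Lemma clopen_dom_image S : compact_bisection S -> clopen (d @` S).
Proof.
move=> bS; have [cS _ _ oS _] := (cbisP _ (tw_hausdorff E)).1 bS.
split=> //; apply: compact_closed; first exact: (tw_hausdorff E).
apply: continuous_compact => //; apply: continuous_subspaceT.
exact: gdom_continuous.
Qed.

Lemma continuous_clopen_extension (A : set X) b : clopen A ->
  {within A, continuous b} ->
  continuous (fun x => if `[< A x >] then b x else 0 : C).
Proof.
move=> [oA cA] /withinP wb; apply/contP => x V oV.
case: asboolP => [Ax Vx|nA V0].
  have [W [oW Wx WV]] := wb x V Ax oV Vx.
  exists (W `&` A); split=> //; first exact: openI.
  by move=> z [Wz Az]; rewrite asboolT//; exact: WV.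
exists (~` A); split=> //; first exact: closed_openC.
by move=> z nAz; rewrite asboolF.
Qed.

(** For composable t in S1 and u in S2 one has d(tu) = d(u) and d(t) = r(u). The coefficient b1 is
    thus transported along u, which [dsec S2] recovers from d(u); the value 0 off the clopen set
    d(S2) keeps the new coefficient continuous. *)
Lemma conv_termE S1 S2 b1 b2 : compact_bisection S1 -> compact_bisection S2 ->
  convolution (Ccterm S1 b1) (Ccterm S2 b2) = Ccterm (bmul S1 S2) (fun x =>
    if `[< (d @` S2) x >] then b1 (r (dsec S2 x)) * b2 x else 0).
Proof.
move=> bS1 bS2; apply/funext => s.
have i2 := cbis_dinj bS2; have i1 := cbis_dinj bS1.
have i12 := cbis_dinj (cbis_bmul (tw_hausdorff E) bS1 bS2).
have eq2 : equivariant (Ccterm S2 b2).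
  by move=> c t cc; rewrite /Ccterm Delta_equivariant// dom_scale// mulrA.
have [[t St e]|ne] := pselect (exists2 t, S1 t & r t = r s); last first.
  rewrite conv_term0//; last by move=> t St e; apply: ne; exists t.
  rewrite /Ccterm Delta0 ?mul0r// => c _ cc [t [u [St Su tu ->]]] es.
  by apply: ne; exists t => //; rewrite es rng_scale// grng_mul.
rewrite (conv_term _ bS1 eq2 St e) /Ccterm gdom_mul ?gdom_inv//.
have [[c [u [cc Su eu ->]]]|[h0 ->]] := DeltaP (ginv _ t ** s) i2.
  have tu : d t = r u.
    by rewrite -(rng_scale u cc) -eu grng_mul ?gdom_inv ?grng_inv.
  have es : s = sc c (t ** u) by rewrite -scaleMr// -eu gmulVKg.
  have ds : d s = d u by rewrite es dom_scale// gdom_mul.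
  rewrite {1 2}es DeltaE//; last by exists t, u.
  rewrite -es ds dsecE// asboolT; last by exists u.
  by rewrite -tu; ring.
rewrite mul0r mulr0 Delta0 ?mul0r// => c _ cc [t' [u [St' Su tu ->]]] es.
have et : t' = t.
  by apply: (cbis_rinj bS1) => //; rewrite e es rng_scale// grng_mul.
subst t'; apply: (h0 c u) => //.
by rewrite es scaleMr ?gdom_inv ?grng_mul// gmulKg.
Qed.

Lemma Cc_conv f g : Cc E f -> Cc E g -> Cc E (convolution f g).
Proof.
move=> Cf Cg; move: f Cf; apply: Cc_ind => [|S b f bS cb Cf ih].
  by rewrite conv0l; exact: Cc0.
rewrite conv_Cc_cons//.
suff Cs : Cc E (convolution (Ccterm S b) g).
  rewrite (_ : (fun s => _) =
    (fun s => 1 * convolution (Ccterm S b) g s + convolution f g s)).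
    exact: Cc_lin.
  by apply/funext => s; rewrite mul1r.
move: g Cg {ih}; apply: Cc_ind => [|S' b' g bS' cb' Cg ih].
  by rewrite conv0r; exact: Cc0.
have -> : convolution (Ccterm S b) (fun s => Ccterm S' b' s + g s) =
    (fun s => 1 * convolution (Ccterm S b) (Ccterm S' b') s +
      convolution (Ccterm S b) g s).
  rewrite -conv_linear_r; last exact/Cc_fibre_finite/Cc_term.
  by congr convolution; apply/funext => s; rewrite mul1r.
apply: Cc_lin => //; rewrite conv_termE//; apply: Cc_term.
  by apply: cbis_bmul => //; exact: (tw_hausdorff E).
apply: continuous_clopen_extension; first exact: clopen_dom_image.
have h1 := within_compT (dsec_continuous bS') (@grng_continuous _ Sigma).
exact: (within_cplxM (within_compT h1 cb) (continuous_within cb')).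
Qed.

End CompactlySupported.

(** * Multiplier actions *)

Section MultiplierActionTheory.
Variables (R : realType) (Y X : topologicalType).
Variables (F : twisted_groupoid R Y) (E : twisted_groupoid R X).
Variable m : multiplier_action F E.
Hypotheses (cX : compact [set: X]) (cY : compact [set: Y]).
Local Notation C := (cplx R).
Local Notation T := (circle R).
Local Notation Sigma := (tw_ext E).
Local Notation Lambda := (tw_ext F).
Local Notation r := (grng Sigma).
Local Notation d := (gdom Sigma).
Local Notation rL := (grng Lambda).
Local Notation dL := (gdom Lambda).
Local Notation act := (ma_act m).
Local Notation pi := (anchor m).
Local Notation "g ** h" := (gmul _ g h) (at level 40, left associativity).
Implicit Types (l k : Lambda) (s t : Sigma) (x : X) (f g : Lambda -> C).

Lemma moment_anchor s : ma_moment m s = pi (r s).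
Proof.
by rewrite /anchor -{1}(gmul1g s) ma_moment_mul// gdom_unit.
Qed.

Lemma anchor_continuous : continuous pi.
Proof.
move=> x; apply: continuous_comp; first exact: gunit_continuous.
exact: ma_moment_continuous.
Qed.

(** Since it commutes with right multiplication, the action is determined by its values at units. *)
Lemma act_unit_mul l s : dL l = pi (r s) -> act l s = act l (gunit _ (r s)) ** s.
Proof.
move=> e; rewrite -ma_act_mul ?gdom_unit//; first by rewrite gmul1g.
Qed.

Lemma dom_act_unit l x : dL l = pi x -> d (act l (gunit _ x)) = x.
Proof. by move=> e; rewrite ma_dom_act// gdom_unit. Qed.

Lemma anchor_rng_act l s : dL l = pi (r s) -> pi (r (act l s)) = rL l.
Proof. by move=> e; rewrite -moment_anchor ma_moment_act// moment_anchor. Qed.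

Lemma rng_act_unit l s : dL l = pi (r s) -> r (act l s) = r (act l (gunit _ (r s))).
Proof. by move=> e; rewrite act_unit_mul// grng_mul// dom_act_unit. Qed.

Lemma act_scaleE c l s : T c -> dL l = pi (r s) ->
  act (tw_scale F c l) s = tw_scale E c (act l s).
Proof.
move=> cc e; rewrite ma_act_scale ?moment_anchor// /tw_scale !tw_central//.
by rewrite ma_act_mul ?moment_anchor ?tw_rng_iota// ma_dom_act// moment_anchor.
Qed.

Lemma actKV l s : rL l = pi (r s) -> act l (act (ginv _ l) s) = s.
Proof.
move=> e; rewrite -ma_actM ?grng_inv ?gdom_inv ?moment_anchor//.
by rewrite gmulgV e -moment_anchor ma_act1.
Qed.

Lemma actK l s : dL l = pi (r s) -> act (ginv _ l) (act l s) = s.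
Proof.
move=> e; rewrite -ma_actM ?grng_inv ?gdom_inv ?moment_anchor//.
by rewrite gmulVg e -moment_anchor ma_act1.
Qed.

(** The index set of the sum that defines [jtilde]. *)
Definition act_fibre s : set Lambda :=
  [set l | dL l = pi (d s) /\ act l (gunit _ (d s)) = s].

Lemma act_fibre_rng s l : act_fibre s l -> rL l = pi (r s).
Proof.
move=> [e es]; rewrite -{1}es anchor_rng_act ?grng_unit//.
Qed.

(** Two lifts of one arrow of H differ by a scalar, which must be 1 because the circle acts freely
    on Sigma. *)
Lemma act_fibre_inj s l k : act_fibre s l -> act_fibre s k ->
  tw_proj F l = tw_proj F k -> l = k.
Proof.
move=> [el es] [ek ek'] /proj_eq [c cc e]; rewrite e.
suff -> : c = 1 by rewrite scale1.
apply: (@scale_inj _ _ E _ _ s) => //; first exact: circle1.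
by rewrite scale1 -{1}es -act_scaleE ?grng_unit// -e.
Qed.

Lemma act_fibre_act l s k : dL l = pi (r s) ->
  act_fibre (act l s) k <-> act_fibre s (ginv _ l ** k) /\ rL k = rL l.
Proof.
move=> e; split=> [h|[[h1 h2] h3]].
  have rk : rL k = rL l by rewrite (act_fibre_rng h) anchor_rng_act.
  split=> //; case: h; rewrite ma_dom_act ?moment_anchor// => dk ak.
  split; first by rewrite gdom_mul// gdom_inv.
  by rewrite ma_actM ?gdom_inv ?moment_anchor ?grng_unit// ak actK.
rewrite gdom_mul ?gdom_inv// in h1.
split; first by rewrite ma_dom_act// moment_anchor.
rewrite ma_dom_act ?moment_anchor// -[in RHS]h2.
by rewrite -ma_actM ?grng_mul ?gdom_mul ?grng_inv ?gdom_inv ?moment_anchor ?grng_unit// gmulVKg.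
Qed.

(** The set of all l x with l in S and x a unit. Functions carried by S are sent by [jtilde] to
    functions carried by this set, see [jtilde_term]. *)
Definition bisection_act (S : set Lambda) : set Sigma :=
  [set s | exists2 l, S l & act_fibre s l].

Lemma bisection_act_unit S l x : S l -> dL l = pi x ->
  bisection_act S (act l (gunit _ x)).
Proof. by move=> Sl e; exists l => //; split; rewrite dom_act_unit. Qed.

Lemma dom_bisection_act S : d @` bisection_act S = pi @^-1` (dL @` S).
Proof.
apply/seteqP; split=> [_ [s [l Sl [e _]] <-]|x [l Sl e]]; first by exists l.
by exists (act l (gunit _ x)); [exact: bisection_act_unit|rewrite dom_act_unit].
Qed.

Lemma act_inv_unit l x : rL l = pi x ->
  act l (gunit _ (r (act (ginv _ l) (gunit _ x)))) =
  ginv _ (act (ginv _ l) (gunit _ x)).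
Proof.
move=> e; set s := act _ (gunit _ x).
have el : dL (ginv _ l) = pi (r (gunit Sigma x)) by rewrite gdom_inv grng_unit.
have ls : dL l = pi (r s) by rewrite anchor_rng_act// grng_inv.
have ds : d s = x by rewrite dom_act_unit// gdom_inv.
rewrite -(gmulgV s) ma_act_mul ?moment_anchor ?grng_inv//.
have -> : act l s = gunit _ (d s) by rewrite actKV ?grng_unit// ds.
by rewrite -[X in gunit _ X](grng_inv s) gmul1g.
Qed.

Lemma rng_bisection_act S : r @` bisection_act S = pi @^-1` (rL @` S).
Proof.
apply/seteqP; split=> [_ [s [l Sl h] <-]|x [l Sl e]].
  by exists l => //; exact: act_fibre_rng.
exists (ginv _ (act (ginv _ l) (gunit _ x))).
  rewrite -act_inv_unit//; apply: bisection_act_unit => //.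
  by rewrite anchor_rng_act ?grng_inv// gdom_inv grng_unit.
by rewrite grng_inv dom_act_unit// gdom_inv.
Qed.

Lemma act_fibre_unitE s l : act_fibre s l -> act (ginv _ l) s = gunit _ (d s).
Proof. by move=> [e es]; rewrite -{1}es actK ?grng_unit. Qed.

Lemma dinj_bisection_act S : dinj S -> dinj (bisection_act S).
Proof.
move=> iS s t [l Sl [dl ls]] [k Sk [dk ks]] e.
have lk : l = k by apply: iS => //; rewrite dl dk e.
by rewrite -ls -ks lk e.
Qed.

(** If r(s) = r(t), then s and t arise from the same l. Now l^-1 s is the unit at d(s), while its
    range depends on s only through r(s); hence d(s) = d(t). *)
Lemma rinj_bisection_act S : rinj S -> rinj (bisection_act S).
Proof.
move=> iS s t [l Sl ls] [k Sk ks] e.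
have rl := act_fibre_rng ls; have rk := act_fibre_rng ks.
have lk : l = k by apply: iS => //; rewrite rl rk e.
subst k; suff est : d s = d t by rewrite -ls.2 -ks.2 est.
rewrite -(grng_unit Sigma (d s)) -(grng_unit Sigma (d t)).
rewrite -(act_fibre_unitE ls) -(act_fibre_unitE ks).
by rewrite rng_act_unit ?gdom_inv// [RHS]rng_act_unit ?gdom_inv// e.
Qed.

Lemma cbis_act S : compact_bisection S -> compact_bisection (bisection_act S).
Proof.
move=> bS; have [cS dS rS odS orS] := (cbisP _ (tw_hausdorff F)).1 bS.
apply/(cbisP _ (tw_hausdorff E)); split.
- pose D := [set lx : Lambda * X | dL lx.1 = pi lx.2].
  have -> : bisection_act S = (fun lx => act lx.1 (gunit _ lx.2)) @` (S `*` setT `&` D).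
    apply/seteqP; split=> [s [l Sl [dl ls]]|_ [[l x] [[/= Sl _] e] <-]].
      by exists (l, d s).
    exact: bisection_act_unit.
  apply: continuous_compact.
    have c1 : {within S `*` setT `&` D, continuous (fun lx : Lambda * X => (lx.1, gunit Sigma lx.2))}.
      apply: within_pair; first exact: (continuous_within (@fst_continuous _ _)).
      have c2 := continuous_within (A := S `*` setT `&` D) (@snd_continuous Lambda X).
      exact: (within_compT c2 (@gunit_continuous _ Sigma)).
    have c3 := within_comp c1 (@ma_act_continuous _ _ _ _ _ m).
    by apply: c3 => -[l x] [].
  apply: compact_closedI; first exact: compact_setX.
  rewrite -openC; apply/openP => -[l x] /= ne.
  have [V [W [oV oW Vl Wx VW]]] := hausdorff_sep (tw_hausdorff F) ne.
  exists ((dL @^-1` V) `*` (pi @^-1` W)); split=> //.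
    apply: open_setX; apply: open_comp => // ? _.
      exact: gdom_continuous.
    exact: anchor_continuous.
  move=> [l' x'] [/= Vl' Wx'] e; rewrite /D /= in e.
  have : (V `&` W) (dL l') by split=> //; rewrite /= e.
  by rewrite VW.
- exact: dinj_bisection_act.
- exact: rinj_bisection_act.
- rewrite dom_bisection_act; apply: open_comp => // ? _; exact: anchor_continuous.
- rewrite rng_bisection_act; apply: open_comp => // ? _; exact: anchor_continuous.
Qed.

Lemma act_fibre_scale c s l : T c -> act_fibre (tw_scale E c s) (tw_scale F c l) <->
  act_fibre s l.
Proof.
have dir b t k : T b -> act_fibre t k -> act_fibre (tw_scale E b t) (tw_scale F b k).
  move=> cb [dk kt]; split; rewrite !dom_scale//.
  by rewrite act_scaleE ?grng_unit// kt.
move=> cc; split; last exact: dir.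
move=> /(dir _ _ _ (circle_conj cc)); rewrite !scaleA ?circle_conjM// ?scale1//.
all: exact: circle_conj.
Qed.

(** At most one index l lies in the circle multiples of S: the candidates have the same domain,
    hence the same image in H, and [act_fibre_inj] applies. *)
Lemma jtilde_term S (b : Y -> C) : compact_bisection S ->
  jtilde m (Ccterm S b) = Ccterm (bisection_act S) (b \o pi).
Proof.
move=> bS; apply/funext => s; have iS := cbis_dinj bS.
have iS' := dinj_bisection_act iS.
rewrite /jtilde -/(act_fibre s).
have [[l [[dl ls] nz]]|h] :=
    pselect (exists l, act_fibre s l /\ Delta S l != 0).
  have [c [k [cc Sk lk]]] := Delta_neq0 iS nz.
  rewrite (@fsbig_single _ _ _ _ l)//; last first.
    move=> l' al' ll'; apply/eqP; apply: contraT => nz'.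
    exfalso; apply: ll'; apply: (act_fibre_inj al') => //.
    have {}nz' : Delta S l' != 0 by apply: contraNneq nz' => e; rewrite /Ccterm e mul0r.
    rewrite lk proj_scale//; apply: (Delta_proj iS nz') => //.
    by rewrite al'.1 -dl lk dom_scale.
  have dk : dL k = pi (d s) by rewrite -dl lk dom_scale.
  rewrite /Ccterm /= dl lk DeltaE//; congr (_ * _).
  rewrite -ls lk act_scaleE ?grng_unit// DeltaE//.
  exact: bisection_act_unit.
rewrite fsbig1; last first.
  move=> l al; rewrite /Ccterm; have [->|nz] := eqVneq (Delta S l) 0.
    by rewrite mul0r.
  by case: h; exists l.
rewrite /Ccterm Delta0 ?mul0r// => c t cc [k Sk kt] es.
apply: h; exists (tw_scale F c k); split; first by rewrite es act_fibre_scale.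
by rewrite DeltaE// conjC_eq0 circle_neq0.
Qed.

Lemma act_fibre_finite f s : Cc F f -> finite_set (act_fibre s `&` [set l | f l != 0]).
Proof.
move=> Cf; have [ff _] := Cc_fibre_finite cY Cf (pi (d s)).
apply: (@finite_set_inj_image _ _ _ _ (tw_proj F) _ ff).
  by move=> l k [al _] [ak _]; exact: (act_fibre_inj al ak).
move=> _ [l [al nz] <-]; split; first by rewrite /= tw_dom_proj al.1.
have [c cc [_ e]] := equivariant_lift l (Cc_equivariant cY Cf).
by rewrite /= e mulf_neq0// conjC_eq0 circle_neq0.
Qed.

Lemma jtilde_linear (a : C) f g : Cc F f -> Cc F g ->
  jtilde m (fun l => a * f l + g l) = (fun s => a * jtilde m f s + jtilde m g s).
Proof.
move=> Cf Cg; apply/funext => s; rewrite /jtilde -/(act_fibre s).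
by rewrite fsbig_linear//; exact: act_fibre_finite.
Qed.

Lemma jtilde0 : jtilde m (fun=> 0) = (fun=> 0).
Proof. by apply/funext => s; rewrite /jtilde fsbig1. Qed.

Lemma jtilde_cons S (b : Y -> C) f : compact_bisection S -> continuous b -> Cc F f ->
  jtilde m (fun l => Ccterm S b l + f l) =
  (fun s => Ccterm (bisection_act S) (b \o pi) s + jtilde m f s).
Proof.
move=> bS cb Cf; rewrite -(jtilde_term b bS).
have := jtilde_linear 1 (Cc_term cY bS cb) Cf.
under eq_fun do rewrite mul1r; move=> ->.
by under eq_fun do rewrite mul1r.
Qed.

Lemma Cc_jtilde f : Cc F f -> Cc E (jtilde m f).
Proof.
move: f; apply: (Cc_ind cY) => [|S b f bS cb Cf ih].
  by rewrite jtilde0; exact: Cc0.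
rewrite jtilde_cons//; apply: (Cc_cons cX (cbis_act bS) _ ih).
by move=> x; apply: continuous_comp; [exact: anchor_continuous|exact: cb].
Qed.

(** At s both sides involve only the k in S with r(k) = pi (r s) and the t above it with r(t) =
    r(s). Then s = k (t^-1 s), and l |-> k^-1 l identifies the index sets at s and at t^-1 s. *)
Lemma jtilde_act S (b : Y -> C) g : compact_bisection S -> Cc F g ->
  jtilde m (convolution (Ccterm S b) g) =
  convolution (Ccterm (bisection_act S) (b \o pi)) (jtilde m g).
Proof.
move=> bS Cg; apply/funext => s.
have eg := Cc_equivariant cY Cg; have ejg := Cc_equivariant cX (Cc_jtilde Cg).
have bS' := cbis_act bS.
have [[k Sk ks]|h] := pselect (exists2 k, S k & rL k = pi (r s)); last first.
  rewrite (conv_term0 _ _ bS'); last first.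
    by move=> t [k Sk kt] e; apply: h; exists k; rewrite // -e; exact: act_fibre_rng.
  rewrite /jtilde -/(act_fibre s) fsbig1// => l al.
  rewrite (conv_term0 _ _ bS)// => k Sk e.
  by apply: h; exists k; rewrite // e; exact: act_fibre_rng.
have : (r @` bisection_act S) (r s) by rewrite rng_bisection_act; exists k.
move=> [t [k' Sk' kt] rts].
have kk' : k' = k by apply: (cbis_rinj bS) => //; rewrite ks -rts; exact: act_fibre_rng.
subst k'.
rewrite (conv_term _ bS' ejg _ rts); last by exists k.
have kd : dL k = pi (d t) by case: kt.
have ku : dL k = pi (r (ginv _ t ** s)) by rewrite grng_mul ?gdom_inv// grng_inv.
have es : s = act k (ginv _ t ** s).
  rewrite act_unit_mul// grng_mul ?gdom_inv// grng_inv kt.2.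
  by rewrite gmulVKg.
rewrite /jtilde -/(act_fibre s) -/(act_fibre _) -fsbig_scale; last exact: act_fibre_finite.
under eq_fsbigr => l /set_mem al.
  rewrite (conv_term _ bS eg Sk); last by rewrite ks (act_fibre_rng al).
  over.
rewrite /= kd.
have -> : act_fibre (ginv _ t ** s) = [set ginv _ k ** l | l in act_fibre s].
  apply/seteqP; split=> [l al|_ [l al <-]].
    have rl : dL k = rL l by rewrite (act_fibre_rng al).
    exists (k ** l); last by rewrite gmulKg.
    by rewrite es; apply/act_fibre_act => //; rewrite gmulKg// grng_mul.
  by move: al; rewrite {1}es => /(act_fibre_act _ ku) [].
rewrite fsbig_image//.
move=> l l' /set_mem al /set_mem al' e.
have rl : rL k = rL l by rewrite ks (act_fibre_rng al).
have rl' : rL k = rL l' by rewrite ks (act_fibre_rng al').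
by rewrite -(gmulVKg rl) e gmulVKg.
Qed.

Lemma jtilde_conv f g : Cc F f -> Cc F g ->
  jtilde m (convolution f g) = convolution (jtilde m f) (jtilde m g).
Proof.
move=> Cf Cg; move: f Cf; apply: (Cc_ind cY) => [|S b f bS cb Cf ih].
  by rewrite conv0l jtilde0 conv0l.
rewrite (conv_Cc_cons cY)// jtilde_cons// (conv_Cc_cons cX _ (cbis_act bS)); last 2 first.
- by move=> x; apply: continuous_comp; [exact: anchor_continuous|exact: cb].
- exact: Cc_jtilde.
rewrite -ih -jtilde_act//.
have := jtilde_linear 1 (Cc_conv cY (Cc_term cY bS cb) Cg) (Cc_conv cY Cf Cg).
under eq_fun do rewrite mul1r; move=> ->.
by under eq_fun do rewrite mul1r.
Qed.

Lemma act_fibre_inv s l : act_fibre s l -> act_fibre (ginv _ s) (ginv _ l).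
Proof.
move=> al; split; first by rewrite !gdom_inv (act_fibre_rng al).
rewrite gdom_inv -{1}(gmulgV s) ma_act_mul ?grng_inv//; last first.
  by rewrite gdom_inv moment_anchor (act_fibre_rng al).
by rewrite (act_fibre_unitE al) -[X in gunit _ X](grng_inv s) gmul1g.
Qed.

Lemma jtilde_involution f : Cc F f ->
  jtilde m (involution f) = involution (jtilde m f).
Proof.
move=> Cf; apply/funext => s; rewrite /involution /jtilde.
rewrite -/(act_fibre s) -/(act_fibre (ginv _ s)).
rewrite -(@fsbig_morph C _ _ (@Num.conj C)); last exact: act_fibre_finite.
rewrite (@reindex_fsbig _ _ _ _ _ (ginv Lambda) (act_fibre s) (act_fibre (ginv _ s)))//.
split.
- by move=> l; exact: act_fibre_inv.
- by move=> l k _ _ e; rewrite -(ginvK l) e ginvK.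
- move=> l al; exists (ginv _ l); last exact: ginvK.
  by have := act_fibre_inv al; rewrite ginvK.
Qed.

Lemma jtilde_star_hom : Cc_star_hom (jtilde m).
Proof.
split; first exact: Cc_jtilde.
- by move=> c f g Cf Cg; exact: jtilde_linear.
- exact: jtilde_conv.
- exact: jtilde_involution.
Qed.

End MultiplierActionTheory.

(** * Groupoids of slices *)

(* Data from which a groupoid over Y is built out of a groupoid G over X: the
   arrows are the pieces t S_i \cap d^-1 (pi^-1 y) of the bisections S_i, with
   product the product of sets. [ss_compat] says that the charts
   (y, t) |-> t S_i \cap d^-1 (pi^-1 y) have open images. *)
Record slice_system (R : realType) (X Y : topologicalType) (G : top_groupoid X) :=
  SliceSystem {
  ss_pi : X -> Y;
  ss_scale : cplx R -> G -> G;
  ss_S : nat -> set G;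
  ss_D : nat -> set Y;
  ss_slice := fun i t y =>
    [set g | exists s, [/\ ss_S i s, ss_pi (gdom G s) = y & g = ss_scale t s]];
  ss_hausdorff : hausdorff_space Y;
  ss_surj : forall y, exists x, ss_pi x = y;
  ss_scale_rng : forall t g, circle R t -> grng G (ss_scale t g) = grng G g;
  ss_scale_dom : forall t g, circle R t -> gdom G (ss_scale t g) = gdom G g;
  ss_scale1 : forall g, ss_scale 1 g = g;
  ss_scaleM : forall s t g h, circle R s -> circle R t -> gdom G g = grng G h ->
    gmul G (ss_scale s g) (ss_scale t h) = ss_scale (s * t) (gmul G g h);
  ss_scaleV : forall t g, circle R t ->
    ginv G (ss_scale t g) = ss_scale (Num.conj t) (ginv G g);
  ss_dinj : forall i, dinj (ss_S i);
  ss_rinj : forall i, rinj (ss_S i);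
  ss_dom : forall i, gdom G @` ss_S i = ss_pi @^-1` ss_D i;
  ss_D_open : forall i, open (ss_D i);
  ss_D_compact : forall i, compact (ss_D i);
  ss_fibre : forall i g h, ss_S i g -> ss_S i h ->
    ss_pi (gdom G g) = ss_pi (gdom G h) -> ss_pi (grng G g) = ss_pi (grng G h);
  ss_continuous : forall i g (V : set Y), ss_S i g -> open V ->
    V (ss_pi (grng G g)) -> exists W, [/\ open W, W (ss_pi (gdom G g)) &
      forall h, ss_S i h -> W (ss_pi (gdom G h)) -> V (ss_pi (grng G h))];
  ss_one : exists i, ss_S i = range (gunit G);
  ss_inv : forall i, exists j, ss_S j = ginv G @` ss_S i;
  ss_mul : forall i j, exists k, ss_S k = bmul (ss_S i) (ss_S j);
  ss_compat : forall i j s t y (N : set (cplx R)), circle R s -> circle R t ->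
    ss_D i y -> ss_D j y -> ss_slice j s y = ss_slice i t y -> open N -> N t ->
    exists W M, [/\ open W, open M, W y, M s & forall z u, W z -> M u ->
      circle R u -> ss_D j z -> ss_D i z /\
      exists v, [/\ N v, circle R v & ss_slice j u z = ss_slice i v z]]
}.

Section SliceArrows.
Variables (R : realType) (X Y : topologicalType) (G : top_groupoid X).
Variable A : slice_system R Y G.
Local Notation C := (cplx R).
Local Notation T := (circle R).
Local Notation pi := (ss_pi A).
Local Notation S := (ss_S A).
Local Notation D := (ss_D A).
Local Notation sc := (ss_scale A).
Local Notation slice := (@ss_slice _ _ _ _ A).
Local Notation r := (grng G).
Local Notation d := (gdom G).

Definition is_slice (l : set G) :=
  exists i t y, [/\ T t, D i y & l = slice i t y].

Record slice_arrow := SliceArrow { aset : set G; asetP : is_slice aset }.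

Lemma aset_inj (l m : slice_arrow) : aset l = aset m -> l = m.
Proof.
by case: l m => [l lP] [m mP] /= e; subst m; rewrite (Prop_irrelevance lP mP).
Qed.

HB.instance Definition _ := gen_eqMixin slice_arrow.
HB.instance Definition _ := gen_choiceMixin slice_arrow.

Definition chart i t y (l : slice_arrow) := [/\ T t, D i y & aset l = slice i t y].

Lemma chart_ex (l : slice_arrow) : exists i t y, chart i t y l.
Proof. by have [i [t [y [? ? ?]]]] := asetP l; exists i, t, y. Qed.

Lemma chart_mk i t y : T t -> D i y -> exists l, chart i t y l.
Proof.
move=> tt Dy; have h : is_slice (slice i t y) by exists i, t, y.
by exists (SliceArrow h).
Qed.

Lemma chart_uniq i t y l m : chart i t y l -> chart i t y m -> l = m.
Proof. by move=> [_ _ el] [_ _ em]; apply: aset_inj; rewrite el em. Qed.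

(** The final topology for the charts (y, t) |-> slice i t y, stated through boxes W x N. An arrow
    is tested in all of its charts; that one chart is enough, the charts being open maps, is the
    content of [chart_image_open]. *)
Definition slice_open (O : set slice_arrow) := forall i t y l, chart i t y l ->
  O l -> exists W N, [/\ open W, open N, W y, N t &
    forall z u m, W z -> N u -> chart i u z m -> O m].

Let slice_openT : slice_open setT.
Proof. by move=> i t y l _ _; exists setT, setT; split=> //; exact: openT. Qed.

Let slice_openI : setI_closed slice_open.
Proof.
move=> O1 O2 h1 h2 i t y l cl [Ol1 Ol2].
have [W1 [N1 [oW1 oN1 Wy1 Nt1 H1]]] := h1 i t y l cl Ol1.
have [W2 [N2 [oW2 oN2 Wy2 Nt2 H2]]] := h2 i t y l cl Ol2.
exists (W1 `&` W2), (N1 `&` N2); split; [exact: openI|exact: openI|by []|by []|].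
move=> z u m [Wz1 Wz2] [Nu1 Nu2] cm; split; [exact: (H1 z u)|exact: (H2 z u)].
Qed.

Let slice_open_bigU (J : Type) (f : J -> set slice_arrow) :
  (forall j, slice_open (f j)) -> slice_open (\bigcup_j f j).
Proof.
move=> h i t y l cl [j _ fl].
have [W [N [oW oN Wy Nt H]]] := h j i t y l cl fl.
by exists W, N; split=> // z u m Wz Nu cm; exists j => //; exact: (H z u).
Qed.

HB.instance Definition _ := isOpenTopological.Build slice_arrow
  slice_openT slice_openI slice_open_bigU.

Lemma slice_openE (O : set slice_arrow) : open O = slice_open O.
Proof. by []. Qed.

Lemma S_full i y x : D i y -> pi x = y -> exists s, S i s /\ d s = x.
Proof.
move=> Dy e; have : (pi @^-1` D i) x by rewrite /= e.
by rewrite -ss_dom => -[s Ss <-]; exists s.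
Qed.

Lemma S_dom i s : S i s -> D i (pi (d s)).
Proof.
move=> Ss; suff : (pi @^-1` D i) (d s) by [].
by rewrite -ss_dom; exists s.
Qed.

Lemma chart_dom i t y l g : chart i t y l -> aset l g -> pi (d g) = y.
Proof.
by move=> [tt Dy ->] [s [Ss e ->]]; rewrite ss_scale_dom.
Qed.

Lemma arrow_ne l : exists g, aset l g.
Proof.
have [i [t [y [tt Dy ->]]]] := chart_ex l.
have [x e] := ss_surj A y; have [s [Ss ds]] := S_full Dy e.
by exists (sc t s), s; rewrite ds.
Qed.

Definition apick l : G := sval (cid (arrow_ne l)).

Lemma apickP l : aset l (apick l).
Proof. by rewrite /apick; case: cid. Qed.

Definition adom l : Y := pi (d (apick l)).
Definition arng l : Y := pi (r (apick l)).

Lemma chart_adom i t y l : chart i t y l -> adom l = y.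
Proof. by move=> cl; exact: (chart_dom cl (apickP l)). Qed.

Lemma adomE l g : aset l g -> pi (d g) = adom l.
Proof.
have [i [t [y cl]]] := chart_ex l => lg.
by rewrite (chart_adom cl) (chart_dom cl lg).
Qed.

Lemma arngE l g : aset l g -> pi (r g) = arng l.
Proof.
have [i [t [y cl]]] := chart_ex l => lg; have lp := apickP l.
have e1 := chart_dom cl lg; have e2 := chart_dom cl lp.
rewrite /arng; case: cl => tt Dy el; rewrite el in lg lp.
case: lg lp e1 e2 => [s [Ss _ ->]] [u [Su _ ->]].
rewrite !ss_scale_rng// !ss_scale_dom// => e1 e2.
by apply: (ss_fibre Ss Su); rewrite e1 e2.
Qed.

Lemma arrow_dinj l : dinj (aset l).
Proof.
have [i [t [y [tt Dy ->]]]] := chart_ex l.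
move=> _ _ [g [Sg _ ->]] [h [Sh _ ->]]; rewrite !ss_scale_dom// => e.
by rewrite (ss_dinj Sg Sh e).
Qed.

Lemma arrow_rinj l : rinj (aset l).
Proof.
have [i [t [y [tt Dy ->]]]] := chart_ex l.
move=> _ _ [g [Sg _ ->]] [h [Sh _ ->]]; rewrite !ss_scale_rng// => e.
by rewrite (ss_rinj Sg Sh e).
Qed.

Lemma arrow_dfull l x : pi x = adom l -> exists g, aset l g /\ d g = x.
Proof.
have [i [t [y cl]]] := chart_ex l; rewrite (chart_adom cl) => e.
case: cl => tt Dy ->; have [s [Ss ds]] := S_full Dy e.
by exists (sc t s); rewrite ss_scale_dom//; split=> //; exists s; rewrite ds.
Qed.

Lemma slice_inv i j t g : T t -> S i g -> S j = ginv G @` S i ->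
  ginv G @` (slice i t (pi (d g))) = slice j (Num.conj t) (pi (r g)).
Proof.
move=> tt Sg ej; apply/seteqP; split.
  move=> _ [_ [s [Ss e ->]] <-]; exists (ginv G s); split.
  - by rewrite ej; exists s.
  - by rewrite gdom_inv; exact: ss_fibre Ss Sg e.
  - by rewrite ss_scaleV.
move=> _ [s [Ss e ->]]; exists (sc t (ginv G s)); last first.
  by rewrite ss_scaleV// ginvK.
exists (ginv G s); split=> //.
  by move: Ss; rewrite ej => -[u Su <-]; rewrite ginvK.
have Sg' : S j (ginv G g) by rewrite ej; exists g.
have := ss_fibre Ss Sg'; rewrite gdom_inv e => /(_ erefl) e'.
by rewrite gdom_inv e' grng_inv.
Qed.

Lemma D_inv i j g : S i g -> S j = ginv G @` S i -> D j (pi (r g)).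
Proof.
move=> Sg ej; rewrite -gdom_inv; apply: S_dom.
by rewrite ej; exists g.
Qed.

Lemma inv_is_slice l : is_slice (ginv G @` aset l).
Proof.
have [i [t [y [tt Dy ->]]]] := chart_ex l; have [x e] := ss_surj A y.
have [s [Ss ds]] := S_full Dy e; have [j ej] := ss_inv A i.
exists j, (Num.conj t), (pi (r s)); split; first exact: circle_conj.
  exact: D_inv Ss ej.
by rewrite -(slice_inv tt Ss ej) ds e.
Qed.

Definition ainv l := SliceArrow (inv_is_slice l).

Lemma one_is_slice y : is_slice (gunit G @` (pi @^-1` [set y])).
Proof.
have [i ei] := ss_one A; have [x ex] := ss_surj A y.
have Dy : D i y by rewrite -ex -(gdom_unit G x); apply: S_dom; rewrite ei; exists x.
exists i, 1, y; split=> //; first exact: circle1.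
apply/seteqP; split=> [_ [z /= e <-]|g [u [Ss e ->]]].
  by exists (gunit G z); rewrite gdom_unit ss_scale1 ei; split=> //; exists z.
move: Ss e; rewrite ei => -[z _ <-]; rewrite gdom_unit ss_scale1 => e.
by exists z.
Qed.

Definition aone y := SliceArrow (one_is_slice y).

Lemma chart_one i y : S i = range (gunit G) -> chart i 1 y (aone y).
Proof.
move=> ei; have [x ex] := ss_surj A y; split; first exact: circle1.
  by rewrite -ex -(gdom_unit G x); apply: S_dom; rewrite ei; exists x.
apply/seteqP; split=> [_ [z /= e <-]|g [u [Ss e ->]]].
  by exists (gunit G z); rewrite gdom_unit ss_scale1 ei; split=> //; exists z.
move: Ss e; rewrite ei => -[z _ <-]; rewrite gdom_unit ss_scale1 => e.
by exists z.
Qed.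

Lemma slice_mul i j k s t y z : T s -> T t -> D i y -> D j z ->
  S k = bmul (S i) (S j) -> (forall g, S j g -> pi (d g) = z -> pi (r g) = y) ->
  D k z /\ bmul (slice i s y) (slice j t z) = slice k (s * t) z.
Proof.
move=> ts tt Dy Dz ek h; split.
  have [x ex] := ss_surj A z; have [v [Sv dv]] := S_full Dz ex.
  have [|u [Su du]] := S_full Dy (x := r v).
    by apply: h => //; rewrite dv.
  rewrite -ex -dv -(gdom_mul du); apply: S_dom; rewrite ek.
  by exists u, v.
apply/seteqP; split.
  move=> _ [_ [_ [[u [Su du ->]] [v [Sv dv ->]] e ->]]].
  rewrite ss_scale_dom// ss_scale_rng// in e.
  exists (gmul G u v); split; last by rewrite ss_scaleM.
    by rewrite ek; exists u, v.
  by rewrite gdom_mul.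
move=> _ [w [Sw dw ->]]; move: Sw dw; rewrite ek => -[u [v [Su Sv e ->]]].
rewrite gdom_mul// => dv; exists (sc s u), (sc t v); split.
- by exists u; split=> //; rewrite e; exact: h.
- by exists v.
- by rewrite ss_scale_dom// ss_scale_rng.
- by rewrite ss_scaleM.
Qed.

Lemma slice_mul_chart i j k s t y z l m : chart i s y l -> chart j t z m ->
  adom l = arng m -> S k = bmul (S i) (S j) ->
  D k z /\ bmul (aset l) (aset m) = slice k (s * t) z.
Proof.
move=> cl cm e ek; have el := chart_adom cl.
case: (cl) (cm) => ts Dy -> [tt Dz em]; rewrite em.
apply: slice_mul => // g Sg dg.
rewrite -el e -(@arngE m (sc t g)) ?ss_scale_rng//.
by rewrite em; exists g.
Qed.

Lemma mul_is_slice l m : adom l = arng m -> is_slice (bmul (aset l) (aset m)).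
Proof.
have [i [s [y cl]]] := chart_ex l; have [j [t [z cm]]] := chart_ex m => e.
have [k ek] := ss_mul A i j; have [Dk ->] := slice_mul_chart cl cm e ek.
exists k, (s * t), z; split=> //.
by apply: circleM; [case: cl|case: cm].
Qed.

(** The default l is met only where the product set is not a slice, which [mul_is_slice] excludes
    for composable arrows. *)
Definition amul l m : slice_arrow :=
  if pselect (is_slice (bmul (aset l) (aset m))) is left h then SliceArrow h else l.

Lemma aset_mul l m : adom l = arng m -> aset (amul l m) = bmul (aset l) (aset m).
Proof.
move=> e; rewrite /amul; case: pselect => // nh.
by case: nh; exact: mul_is_slice.
Qed.

Lemma chart_mul i j k s t y z l m : chart i s y l -> chart j t z m ->
  adom l = arng m -> S k = bmul (S i) (S j) -> chart k (s * t) z (amul l m).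
Proof.
move=> cl cm e ek; have [Dk eq] := slice_mul_chart cl cm e ek.
split=> //; last by rewrite aset_mul.
by apply: circleM; [case: cl|case: cm].
Qed.

Lemma chart_inv i j t y l : chart i t y l -> S j = ginv G @` S i ->
  chart j (Num.conj t) (arng l) (ainv l).
Proof.
move=> [tt Dy el] ej; have [x ex] := ss_surj A y.
have [s [Ss ds]] := S_full Dy ex.
have er : arng l = pi (r s).
  by rewrite -(@arngE l (sc t s)) ?ss_scale_rng// el; exists s; rewrite ds.
rewrite er; split; first exact: circle_conj.
  exact: D_inv Ss ej.
by rewrite /= el -(slice_inv tt Ss ej) ds ex.
Qed.

Lemma adom_one y : adom (aone y) = y.
Proof. by have := apickP (aone y) => -[x /= e ex]; rewrite /adom -ex gdom_unit. Qed.

Lemma arng_one y : arng (aone y) = y.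
Proof. by have := apickP (aone y) => -[x /= e ex]; rewrite /arng -ex grng_unit. Qed.

Lemma adom_inv l : adom (ainv l) = arng l.
Proof.
have := apickP (ainv l) => -[g lg eg].
by rewrite /adom -eg gdom_inv; exact: arngE.
Qed.

Lemma arng_inv l : arng (ainv l) = adom l.
Proof.
have := apickP (ainv l) => -[g lg eg].
by rewrite /arng -eg grng_inv; exact: adomE.
Qed.

Lemma adom_mul l m : adom l = arng m -> adom (amul l m) = adom m.
Proof.
move=> e; have := apickP (amul l m); rewrite aset_mul// => -[g [h [lg mh gh eq]]].
by rewrite {1}/adom eq gdom_mul//; exact: adomE.
Qed.

Lemma arng_mul l m : adom l = arng m -> arng (amul l m) = arng l.
Proof.
move=> e; have := apickP (amul l m); rewrite aset_mul// => -[g [h [lg mh gh eq]]].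
by rewrite {1}/arng eq grng_mul//; exact: arngE.
Qed.

Lemma amulA l m n : adom l = arng m -> adom m = arng n ->
  amul l (amul m n) = amul (amul l m) n.
Proof.
move=> e1 e2; apply: aset_inj.
rewrite !aset_mul ?arng_mul ?adom_mul//; apply/seteqP; split.
  move=> _ [g [_ [lg [h [k [mh nk e -> e' ->]]]]]].
  rewrite grng_mul// in e'.
  exists (gmul G g h), k; split=> //; last by rewrite gmulA.
    by exists g, h.
  by rewrite gdom_mul.
move=> _ [_ [k [[g [h [lg mh e ->]]] nk e' ->]]].
rewrite gdom_mul// in e'.
exists g, (gmul G h k); split=> //; last by rewrite gmulA.
  by exists h, k.
by rewrite grng_mul.
Qed.

Lemma amul1a l : amul (aone (arng l)) l = l.
Proof.
apply: aset_inj; rewrite aset_mul ?adom_one//; apply/seteqP; split.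
  move=> _ [_ [g [[x _ <-] lg e ->]]].
  by rewrite gdom_unit in e; rewrite e gmul1g.
move=> g lg; exists (gunit G (r g)), g; split; rewrite ?gdom_unit ?gmul1g//.
by exists (r g) => //=; exact: arngE.
Qed.

Lemma amula1 l : amul l (aone (adom l)) = l.
Proof.
apply: aset_inj; rewrite aset_mul ?arng_one//; apply/seteqP; split.
  move=> _ [g [_ [lg [x _ <-] e ->]]].
  by rewrite grng_unit in e; rewrite -e gmulg1.
move=> g lg; exists g, (gunit G (d g)); split; rewrite ?grng_unit ?gmulg1//.
by exists (d g) => //=; exact: adomE.
Qed.

Lemma amulVa l : amul (ainv l) l = aone (adom l).
Proof.
apply: aset_inj; rewrite aset_mul ?adom_inv//; apply/seteqP; split.
  move=> _ [_ [g [[h lh <-] lg e ->]]].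
  rewrite gdom_inv in e; rewrite (arrow_rinj lh lg e) gmulVg.
  by exists (d g) => //=; exact: adomE.
move=> _ [x /= ex <-]; have [g [lg dg]] := arrow_dfull ex.
exists (ginv G g), g; split=> //.
- by rewrite gdom_inv.
- by rewrite gmulVg dg.
Qed.

Lemma ainvK l : ainv (ainv l) = l.
Proof.
apply: aset_inj; rewrite /= image_comp -[RHS]image_id; apply: eq_imagel => g _.
exact: ginvK.
Qed.

Lemma amulaV l : amul l (ainv l) = aone (arng l).
Proof. by rewrite -{1}(ainvK l) amulVa adom_inv. Qed.

(** An arrow of the image may be presented in another chart j. By [ss_compat] a whole box of chart j
    is covered by chart i, with scalars that stay in N. *)
Lemma chart_image_open i (W : set Y) (N : set C) : open W -> open N ->
  open [set l | exists t y, [/\ W y, N t & chart i t y l]].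
Proof.
move=> oW oN; rewrite slice_openE => j s y l cl [t [y' [Wy Nt cl']]].
have ey : y' = y by rewrite -(chart_adom cl) (chart_adom cl').
subst y'; case: (cl) (cl') => ts Djy el [tt Diy el'].
have [W1 [M [oW1 oM Wy1 Ms H]]] :=
  ss_compat ts tt Diy Djy (etrans (esym el) el') oN Nt.
exists (W1 `&` W), M; split=> //; first exact: openI.
move=> z u m [W1z Wz] Mu [tu Djz em].
have [Diz [v [Nv tv ev]]] := H z u W1z Mu tu Djz.
by exists v, z; split=> //; split=> //; rewrite em.
Qed.

Lemma adom_continuous : continuous adom.
Proof.
apply/contP => l V oV Vl; exists (adom @^-1` V); split=> //.
rewrite slice_openE => i t y m cm /= Vm; exists V, setT; split=> //.
- exact: openT.
- by rewrite -(chart_adom cm).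
- by move=> z u n Vz _ cn; rewrite /= (chart_adom cn).
Qed.

Lemma arng_open_chart i t y l (V : set Y) : chart i t y l -> open V -> V (arng l) ->
  exists W, [/\ open W, W y & forall z u m, W z -> chart i u z m -> V (arng m)].
Proof.
move=> cl oV Vl; have lp := apickP l; have er := arngE lp; have ed := chart_dom cl lp.
case: (cl) => tt Dy el; rewrite el in lp.
case: lp => s [Ss ds es]; rewrite es ss_scale_rng// in er.
have [|W [oW Wy WV]] := @ss_continuous _ _ _ _ A i s V Ss oV; first by rewrite er.
exists W; split=> //; first by rewrite -ds.
move=> z u m Wz cm; have mp := apickP m; rewrite -(arngE mp).
case: (cm) => tu Dz em; rewrite em in mp; case: mp => v [Sv dv ->].
by rewrite ss_scale_rng//; apply: WV => //; rewrite dv.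
Qed.

Lemma arng_continuous : continuous arng.
Proof.
apply/contP => l V oV Vl; exists (arng @^-1` V); split=> //.
rewrite slice_openE => i t y m cm /= Vm.
have [W [oW Wy H]] := arng_open_chart cm oV Vm.
exists W, setT; split=> //; first exact: openT.
by move=> z u n Wz _ cn; exact: (H z u).
Qed.

Lemma aone_continuous : continuous aone.
Proof.
have [i ei] := ss_one A; apply/contP => y V oV Vy.
have [W [N [oW oN Wy Nt H]]] := oV i 1 y _ (chart_one y ei) Vy.
by exists W; split=> // z Wz; apply: (H z 1) => //; exact: chart_one.
Qed.

Lemma ainv_continuous : continuous ainv.
Proof.
apply/contP => l V oV Vl; exists (ainv @^-1` V); split=> //.
rewrite slice_openE => i t y m cm /= Vm; have [j ej] := ss_inv A i.
have [W [N [oW oN Wy Nt H]]] := oV _ _ _ _ (chart_inv cm ej) Vm.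
have [W' [oW' Wy' H']] := arng_open_chart cm oW Wy.
exists W', (Num.conj @^-1` N); split=> //.
  by apply: open_comp => // z _; exact: conj_cplx_continuous.
move=> z u n Wz Nu cn; apply: (H (arng n) (Num.conj u)) => //.
  exact: (H' z u).
exact: chart_inv cn ej.
Qed.

Lemma cplx_mul_open (s t : C) (N : set C) : open N -> N (s * t) ->
  exists P Q, [/\ open P, open Q, P s, Q t & forall a b, P a -> Q b -> N (a * b)].
Proof.
move=> oN Nst.
have cm : continuous (fun x : C * C => x.1 * x.2).
  exact: (cplx_continuousM (@fst_continuous C C) (@snd_continuous C C)).
have [Z [oZ Zst ZN]] := (contP _).1 cm (s, t) N oN Nst.
have [P [Q [oP oQ Ps Qt H]]] := open_prodP oZ Zst.
by exists P, Q; split=> // a b Pa Qb; apply: (ZN (a, b)); exact: H.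
Qed.

(** In charts the product keeps the base point of the right factor and multiplies the scalars, so
    its continuity is that of multiplication in C. *)
Lemma amul_continuous :
  {within [set gh : slice_arrow * slice_arrow | adom gh.1 = arng gh.2],
    continuous (fun gh => amul gh.1 gh.2)}.
Proof.
apply/withinP => -[l m] V /= e oV Vlm.
have [i [s [y cl]]] := chart_ex l; have [j [t [z cm]]] := chart_ex m.
have [k ek] := ss_mul A i j.
have [W [N [oW oN Wz Nt H]]] := oV _ _ _ _ (chart_mul cl cm e ek) Vlm.
have [P [Q [oP oQ Ps Qt PQ]]] := cplx_mul_open oN Nt.
exists ([set l | exists t y, [/\ setT y, P t & chart i t y l]] `*`
        [set l | exists t y, [/\ W y, Q t & chart j t y l]]); split.
- by apply: open_setX; apply: chart_image_open => //; exact: openT.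
- by split; [exists s, y|exists t, z].
move=> [l' m'] [/= [a [y' [_ Pa cl']]] [b [z' [Wz' Qb cm']]]] e'.
apply: (H z' (a * b)) => //; first exact: PQ.
exact: chart_mul cl' cm' e' ek.
Qed.

Definition slice_groupoid : top_groupoid Y := @TopGroupoid Y slice_arrow
  arng adom aone amul ainv arng_one adom_one arng_mul adom_mul amulA amul1a amula1
  arng_inv adom_inv amulVa amulaV arng_continuous adom_continuous aone_continuous
  ainv_continuous amul_continuous.

Definition chart_set i : set slice_arrow := [set l | exists t y, chart i t y l].

Lemma chart_set_open i : open (chart_set i).
Proof.
rewrite (_ : chart_set i = [set l | exists t y, [/\ setT y, setT t & chart i t y l]]).
  by apply: chart_image_open; exact: openT.
by apply/seteqP; split=> l [t [y h]]; exists t, y => //; case: h.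
Qed.

Lemma chart_set_compact i : compact (chart_set i).
Proof.
have [[l0 _]|h] := pselect (chart_set i !=set0); last first.
  rewrite (_ : chart_set i = set0); first exact: compact0.
  by apply/seteqP; split=> // l il; apply: h; exists l.
pose c (yt : Y * C) : slice_arrow := xget l0 [set l | chart i yt.2 yt.1 l].
have cE y t : T t -> D i y -> chart i t y (c (y, t)).
  move=> tt Dy; rewrite /c; case: xgetP => [? _ //|] /=.
  by have [l cl] := chart_mk tt Dy => /(_ l).
have -> : chart_set i = c @` (D i `*` T).
  apply/seteqP; split=> [l [t [y cl]]|_ [[y t] [/= Dy tt] <-]].
    have [tt Dy _] := cl; exists (y, t) => //.
    exact: (chart_uniq (cE y t tt Dy) cl).
  by exists t, y; exact: cE.
have cDT : compact (D i `*` T) by apply: compact_setX; [exact: ss_D_compact|exact: compact_circle].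
apply: continuous_compact; last exact: cDT.
apply/withinP => -[y t] V [/= Dy tt] oV Vl.
have [W [N [oW oN Wy Nt H]]] := oV _ _ _ _ (cE y t tt Dy) Vl.
exists (W `*` N); split=> //; first exact: open_setX.
by move=> [z u] [/= Wz Nu] [/= Dz tu]; apply: (H z u) => //; exact: cE.
Qed.

(** The two extreme cases, both used: for Sigma the scalar can be read off the slice, and for G,
    with trivial scaling, slices do not depend on it. *)
Definition slice_free := forall i s t y, T s -> T t -> D i y ->
  slice i s y = slice i t y -> s = t.

Definition slice_trivial := forall i s t y, T s -> T t -> slice i s y = slice i t y.

(** Each chart domain is open and compact. Two of its arrows over different points of Y are
    separated by d; over the same point they are separated by their scalars in the free case and are
    equal in the trivial one. *)
Lemma slice_locally_compact : slice_free \/ slice_trivial ->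
  locally_compact_groupoid slice_groupoid.
Proof.
move=> ft; split; last exact: (ss_hausdorff A).
move=> l; have [i [t [y cl]]] := chart_ex l.
exists (chart_set i); split.
- by apply: open_nbhs_nbhs; split; [exact: chart_set_open|exists t, y].
- exact: chart_set_compact.
apply: hausdorff_set_type => l1 l2 [t1 [y1 c1]] [t2 [y2 c2]] ne.
have [ey|ney] := pselect (y1 = y2).
  case: ft => [free|triv]; last first.
    exfalso; apply: ne; apply: aset_inj; case: c1 c2 => [tt1 _ ->] [tt2 _ ->].
    by rewrite ey; exact: triv.
  have nt : t1 <> t2.
    by move=> et; apply: ne; apply: (chart_uniq c1); rewrite ey et.
  have [V [W [oV oW V1 W2 VW]]] := hausdorff_sep (@norm_hausdorff C C) nt.
  exists [set l | exists t y, [/\ setT y, V t & chart i t y l]],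
    [set l | exists t y, [/\ setT y, W t & chart i t y l]]; split.
  - by apply: chart_image_open => //; exact: openT.
  - by apply: chart_image_open => //; exact: openT.
  - by exists t1, y1.
  - by exists t2, y2.
  apply/seteqP; split=> // m [[[s [z [_ Vs cs]]] [u [z' [_ Wu cu]]]] _].
  have ez : z = z' by rewrite -(chart_adom cs) (chart_adom cu).
  subst z'; case: (cs) (cu) => [ts Dz es] [tu _ eu].
  have e : s = u by apply: (free i s u z) => //; rewrite -es -eu.
  by subst u; have : (V `&` W) s by []; rewrite VW.
have [V [W [oV oW V1 W2 VW]]] := hausdorff_sep (ss_hausdorff A) ney.
exists (adom @^-1` V), (adom @^-1` W); split.
- by apply: open_comp => // ? _; exact: adom_continuous.
- by apply: open_comp => // ? _; exact: adom_continuous.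
- by rewrite /= (chart_adom c1).
- by rewrite /= (chart_adom c2).
apply/seteqP; split=> // m [[/= Vm Wm] _].
by have : (V `&` W) (adom m) by []; rewrite VW.
Qed.

Lemma adom_chart_set i : slice_trivial -> adom @` chart_set i = D i.
Proof.
move=> triv; apply/seteqP; split=> [_ [l [t [y cl]] <-]|y Dy].
  by rewrite (chart_adom cl); case: cl.
have [l cl] := chart_mk (circle1 R) Dy.
by exists l; [exists 1, y|exact: chart_adom cl].
Qed.

Lemma adom_local_homeo : slice_trivial -> local_homeomorphism adom.
Proof.
move=> triv l; have [i [t [y cl]]] := chart_ex l.
exists (chart_set i); split.
- exact: chart_set_open.
- by exists t, y.
- apply: compact_embedding.
  + exact: chart_set_compact.
  + exact: (ss_hausdorff A).
  + move=> l1 l2 /set_mem [t1 [y1 c1]] /set_mem [t2 [y2 c2]].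
    rewrite (chart_adom c1) (chart_adom c2) => ey; apply: aset_inj.
    by case: c1 c2 => [tt1 _ ->] [tt2 _ ->]; rewrite ey; exact: triv.
  + exact: continuous_within adom_continuous.
- by rewrite adom_chart_set//; exact: ss_D_open.
Qed.

(** Inversion exchanges range and domain, so inverses of chart domains serve as neighbourhoods. *)
Lemma arng_local_homeo : slice_trivial -> local_homeomorphism arng.
Proof.
move=> triv l; have [i [t [y cl]]] := chart_ex (ainv l).
have er : arng @` (ainv @^-1` chart_set i) = adom @` chart_set i.
  apply/seteqP; split=> [_ [m im <-]|_ [m im <-]].
    by exists (ainv m) => //; exact: adom_inv.
  by exists (ainv m); rewrite /= ?ainvK// arng_inv.
exists (ainv @^-1` chart_set i); split.
- by apply: open_comp => [? _|]; [exact: ainv_continuous|exact: chart_set_open].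
- by exists t, y.
- apply: compact_embedding.
  + have -> : ainv @^-1` chart_set i = ainv @` chart_set i.
      by apply/seteqP; split=> [m im|_ [m im <-]]; [exists (ainv m); rewrite ?ainvK|rewrite /= ainvK].
    apply: continuous_compact; last exact: chart_set_compact.
    exact: continuous_within ainv_continuous.
  + exact: (ss_hausdorff A).
  + move=> l1 l2 /set_mem [t1 [y1 c1]] /set_mem [t2 [y2 c2]].
    rewrite -!adom_inv (chart_adom c1) (chart_adom c2) => ey.
    rewrite -(ainvK l1) -(ainvK l2); congr ainv; apply: aset_inj.
    by case: c1 c2 => [tt1 _ ->] [tt2 _ ->]; rewrite ey; exact: triv.
  + exact: continuous_within arng_continuous.
- by rewrite er adom_chart_set//; exact: ss_D_open.
Qed.

Lemma slice_etale : slice_trivial -> etale_groupoid slice_groupoid.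
Proof.
move=> triv; split.
- by apply: slice_locally_compact; right.
- exact: arng_local_homeo.
- exact: adom_local_homeo.
Qed.

Lemma slice_second_countable (B : nat -> set Y) : (forall n, open (B n)) ->
  (forall y U, open U -> U y -> exists n, B n y /\ B n `<=` U) ->
  @second_countable slice_arrow.
Proof.
move=> oB hB; have [V [oV hV]] := cplx_countable_base R.
pose b (x : nat * nat * nat) := [set l | exists t y,
  [/\ B x.1.2 y, V x.2 t & chart x.1.1 t y l]].
exists (range b).
  by apply: card_le_trans (card_image_le b setT) _; exact: countableP.
split; first by move=> _ [x _ <-]; exact: chart_image_open.
move=> l P /nbhs_openP [Q [oQ Ql] QP].
have [i [t [y cl]]] := chart_ex l.
have [W [N [oW oN Wy Nt H]]] := oQ i t y l cl Ql.
have [n [Bn BW]] := hB y W oW Wy; have [k [Vk VN]] := hV t N oN Nt.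
exists (b (i, n, k)).
  by split; [exists (i, n, k)|exists t, y].
move=> m [u [z [Bz Vu cm]]]; apply: QP; apply: (H z u) => //; first exact: BW.
by apply: VN; exact: subset_closure.
Qed.

End SliceArrows.


Arguments chart {R X Y G} A i t y l.
Arguments chart_set {R X Y G} A i _.
Arguments aone {R X Y G} A y.

(** * The quotient of the unit space *)

Section CountableClosure.
Variables (T : Type) (op : T -> T -> nat -> T) (a0 : nat -> T).

(** Trees are formal expressions: a leaf names a generator and the label of a node names one of the
    operations [op _ _ n]. They form a countable type, so their values enumerate the closure of the
    family. *)
Fixpoint closure_eval (t : GenTree.tree nat) : T :=
  match t with
  | GenTree.Leaf n => a0 n
  | GenTree.Node n (t1 :: t2 :: _) => op (closure_eval t1) (closure_eval t2) n
  | _ => a0 0%N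
  end.

Lemma countable_closure (P : T -> Prop) : (forall n, P (a0 n)) ->
  (forall x y n, P x -> P y -> P (op x y n)) ->
  exists a : nat -> T, [/\ forall n, P (a n), forall n, exists m, a m = a0 n &
    forall i j n, exists m, a m = op (a i) (a j) n].
Proof.
move=> h0 hop; pose code t := choice.pickle (t : GenTree.tree nat).
pose a n := if (choice.unpickle n : option (GenTree.tree nat)) is Some t
  then closure_eval t else a0 0%N.
have aE t : a (code t) = closure_eval t by rewrite /a /code choice.pickleK.
have aP n : exists t, a n = closure_eval t.
  by rewrite /a; case: choice.unpickle => [t|]; [exists t|exists (GenTree.Leaf 0%N)].
have evP : forall t, P (closure_eval t).
  fix ev 1 => -[n|n [|t1 [|t2 ts]]] /=; [exact: h0|exact: h0|exact: h0|].
  by apply: hop; exact: ev.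
exists a; split=> [n|n|i j n].
- by have [t ->] := aP n.
- by exists (code (GenTree.Leaf n)); rewrite aE.
- have [t1 ->] := aP i; have [t2 ->] := aP j.
  by exists (code (GenTree.Node n [:: t1; t2])); rewrite aE.
Qed.

End CountableClosure.

Section QuotientSpace.
Variables (X : ptopologicalType) (e : nat -> set X).

(** A point is the truth table of x with respect to the sets [e n]. Once these are clopen in a
    compact space and closed under complements and intersections, this is the Stone space of the
    Boolean algebra that they form. *)
Record quot := Quot { qval : nat -> Prop; qvalP : exists x, qval = e ^~ x }.

Definition qpi (x : X) : quot := @Quot (e ^~ x) (ex_intro _ x erefl).

Lemma qpiE x y : qpi x = qpi y <-> forall n, e n x <-> e n y.
Proof.
split=> [[] exy n|h]; first by have := congr1 (fun f => f n) exy => /= ->.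
rewrite /qpi; have exy : e ^~ x = e ^~ y by apply/funext => n; exact/propext.
move: (ex_intro _ x _) (ex_intro _ y _); rewrite exy => p1 p2.
by rewrite (Prop_irrelevance p1 p2).
Qed.

Lemma qpi_surj y : exists x, qpi x = y.
Proof.
case: y => v [x ev]; exists x; subst v; by rewrite /qpi; congr Quot.
Qed.

HB.instance Definition _ := gen_eqMixin quot.
HB.instance Definition _ := gen_choiceMixin quot.
HB.instance Definition _ := isPointed.Build quot (qpi point).

Definition qopen (O : set quot) := open (qpi @^-1` O).

Let qopenT : qopen setT. Proof. exact: openT. Qed.

Let qopenI : setI_closed qopen.
Proof. by move=> A B oA oB; exact: openI. Qed.

Let qopen_bigU (I : Type) (f : I -> set quot) : (forall i, qopen (f i)) ->
  qopen (\bigcup_i f i).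
Proof. move=> h; rewrite /qopen preimage_bigcup; apply: bigcup_open => i _; exact: h. Qed.

HB.instance Definition _ := isOpenTopological.Build quot qopenT qopenI qopen_bigU.

Lemma qpi_continuous : continuous qpi.
Proof. by apply/continuousP => V; exact. Qed.

Hypothesis cX : compact [set: X].
Hypothesis clopen_e : forall n, clopen (e n).
Hypothesis e_compl : forall n, exists m, e m = ~` e n.
Hypothesis e_cap : forall n m, exists k, e k = e n `&` e m.

Lemma qpi_sat n x y : qpi x = qpi y -> e n x -> e n y.
Proof. by move=> /qpiE /(_ n) []. Qed.

Lemma qpi_preimage n : qpi @^-1` (qpi @` e n) = e n.
Proof.
apply/seteqP; split=> [x [y ey] h|x ex]; last by exists x.
exact: qpi_sat h ey.
Qed.

Lemma qopen_e n : open (qpi @` e n).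
Proof.
by have [oe _] := clopen_e n; rewrite -[open _]/(open (qpi @^-1` _)) qpi_preimage.
Qed.

Lemma e_cap_fset (J : {fset nat}) (x : X) : (forall n, n \in J -> e n x) ->
  exists k, e k x /\ e k `<=` \bigcap_(n in [set n | n \in J]) e n.
Proof.
move=> h; suff : forall s : seq nat, (forall n : nat, n \in s -> e n x) ->
    exists k, e k x /\ forall z, e k z -> forall n : nat, n \in s -> e n z.
  move=> /(_ (enum_fset J) h) [k [kx H]]; exists k; split=> // z kz n /= nJ; exact: H.
elim=> [|n s ih] hs.
  (* For the empty intersection some member of the family that contains x is still needed: either
     [e 0] or its complement. *)
  have [n en] := e_compl 0%N; have [ex|nex] := pselect (e 0%N x); first by exists 0%N.
  by exists n; rewrite en.
have [|k [kx H]] := ih; first by move=> m ms; apply: hs; rewrite inE ms orbT.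
have [j ej] := e_cap n k; exists j; rewrite ej; split.
  by split=> //; apply: hs; rewrite inE eqxx.
by move=> z [nz kz] m; rewrite inE => /orP [/eqP ->//|]; exact: H.
Qed.

(** A tube lemma: the fibre of x is the intersection of the clopen sets [e n] that contain x, so by
    compactness finitely many of these already meet inside U. It turns a property of one fibre into
    a property near a point of the quotient. *)
Lemma qpi_nbhd (U : set X) x : open U -> (forall z, qpi z = qpi x -> U z) ->
  exists n, e n x /\ e n `<=` U.
Proof.
move=> oU h.
have [||J [JD JU]] := @compact_capI X nat [set n | e n x] e U cX oU.
- by move=> n; case: (clopen_e n).
- move=> z hz; apply: h; apply/qpiE => n; split=> [enz|]; last exact: hz.
  apply: contrapT => nex; have [m em] := e_compl n.
  by have := hz m; rewrite /= em; exact.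
have [k [kx kJ]] := e_cap_fset JD.
by exists k; split=> //; exact: subset_trans kJ JU.
Qed.

Lemma quot_hausdorff : hausdorff_space quot.
Proof.
apply: hausdorff_intro => y z; have [x <-] := qpi_surj y; have [w <-] := qpi_surj z.
move=> ne; have [n [exn nexn]] : exists n, e n x /\ ~ e n w.
  apply: contrapT => h; apply: ne; apply/qpiE => n; split=> [ex|ew].
    by apply: contrapT => nex; apply: h; exists n.
  apply: contrapT => nex; have [m em] := e_compl n.
  by apply: h; exists m; rewrite em; split=> // /(_ ew).
have [m em] := e_compl n.
exists (qpi @` e n), (qpi @` e m); split; [exact: qopen_e|exact: qopen_e|by exists x| |].
  by exists w; rewrite // em.
apply/seteqP; split=> // _ [[u eu <-] [v ev /qpi_sat euv]].
by have := euv m ev; rewrite em.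
Qed.

Lemma quot_compact : compact [set: quot].
Proof.
have -> : [set: quot] = qpi @` setT.
  by apply/seteqP; split=> // y _; have [x <-] := qpi_surj y; exists x.
apply: continuous_compact => //; exact: continuous_within qpi_continuous.
Qed.

Lemma quot_base (y : quot) U : open U -> U y -> exists n, (qpi @` e n) y /\ qpi @` e n `<=` U.
Proof.
have [x <-] := qpi_surj y => oU Ux.
have [n [enx enU]] := @qpi_nbhd (qpi @^-1` U) x oU (fun z ez => eq_ind_r U Ux ez).
by exists n; split; [exists x|move=> _ [z ez <-]; exact: enU].
Qed.

Lemma quot_boolean : boolean_space quot.
Proof.
split.
- move=> y; exists setT; split; [exact: filterT|exact: quot_compact|].
  apply: hausdorff_set_type => u v _ _ uv.
  have [V [W [? ? ? ? VW]]] := hausdorff_sep quot_hausdorff uv.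
  by exists V, W; split=> //; rewrite VW set0I.
- exact: quot_hausdorff.
- apply: zero_dimension_totally_disconnected => y z /eqP yz.
  have [V [W [oV oW Vy Wz VW]]] := hausdorff_sep quot_hausdorff yz.
  have [n [ny nV]] := quot_base oV Vy.
  exists (qpi @` e n); split=> //.
    split; first exact: qopen_e.
    apply: compact_closed; first exact: quot_hausdorff.
    apply: continuous_compact; first exact: continuous_within qpi_continuous.
    by apply: (subclosed_compact _ cX) => //; case: (clopen_e n).
  by move=> /nV Vz; have : (V `&` W) z by []; rewrite VW.
Qed.

End QuotientSpace.

(** * The reduced twisted groupoid *)

Section Ratio.
Variables (R : realType) (X : topologicalType) (E : twisted_groupoid R X).
Local Notation C := (cplx R).
Local Notation T := (circle R).
Local Notation Sigma := (tw_ext E).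
Local Notation G := (tw_base E).
Local Notation r := (grng Sigma).
Local Notation d := (gdom Sigma).
Local Notation sc := (tw_scale E).
Local Notation p := (tw_proj E).
Implicit Types (S : set Sigma) (V : set C).

(** The set where S1 and S2 pass through the same arrow of G, so that S2(x) = c S1(x), and where the
    ratio c lies in V. *)
Definition ratio_set S1 S2 V : set X := [set x | exists s c,
  [/\ S1 s, d s = x, T c, V c & S2 (sc c s)]].

Lemma ratioS S1 S2 V W : V `<=` W -> ratio_set S1 S2 V `<=` ratio_set S1 S2 W.
Proof.
by move=> VW x [s [c [? ? ? Vc ?]]]; exists s, c; split=> //; exact: VW.
Qed.

Lemma ratio_uniq S1 S2 s c x V : dinj S1 -> dinj S2 -> S1 s -> d s = x ->
  T c -> S2 (sc c s) -> ratio_set S1 S2 V x -> V c.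
Proof.
move=> i1 i2 Ss ds tc Sc [s' [c' [Ss' ds' tc' Vc' Sc']]].
have es : s = s' by apply: i1 => //; rewrite ds ds'.
subst s'; suff -> : c = c' by [].
by apply: (@scale_inj _ _ E _ _ s) => //; apply: i2 => //; rewrite !dom_scale.
Qed.

Lemma ratio_proj S1 S2 s s' : S1 s -> S2 s' -> p s = p s' ->
  ratio_set S1 S2 setT (d s).
Proof.
move=> Ss Ss' /proj_eq [c tc e]; exists s, c; split=> //.
by rewrite -e.
Qed.

(** As d is locally injective on G, two sections above the same arrow at x0 stay above the same
    arrow nearby. There s2 s1^-1 is a continuous map into the circle bundle, whose embedding makes
    the ratio c continuous. *)
Lemma ratio_open S1 S2 V : local_homeomorphism (gdom G) ->
  compact_bisection S1 -> compact_bisection S2 -> open V ->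
  open (ratio_set S1 S2 V).
Proof.
move=> lh b1 b2 oV; have [_ i1 _ o1 _] := (cbisP _ (tw_hausdorff E)).1 b1.
have [_ i2 _ o2 _] := (cbisP _ (tw_hausdorff E)).1 b2.
apply/openP => x0 [s0 [c0 [Ss0 ds0 tc0 Vc0 Sc0]]].
have [Z [oZ Zs0 [injZ _ _] _]] := lh (p s0).
pose s1 := dsec S1; pose s2 := dsec S2.
have cs1 := dsec_continuous b1; have cs2 := dsec_continuous b2.
have s1x0 : s1 x0 = s0 by rewrite -ds0; exact: dsecE.
have s2x0 : s2 x0 = sc c0 s0 by rewrite -ds0 -(dom_scale s0 tc0); exact: dsecE.
have cp := @tw_proj_continuous _ _ E.
pose D := (d @` S1) `&` (d @` S2).
have oD : open D by exact: openI.
have D1 : D `<=` d @` S1 by move=> ? [].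
have D2 : D `<=` d @` S2 by move=> ? [].
have oU1 := within_preimage_open oD (within_compT (within_subset_continuous D1 cs1) cp) oZ.
have oU2 := within_preimage_open oD (within_compT (within_subset_continuous D2 cs2) cp) oZ.
set U1 := _ `&` _ in oU1; set U2 := _ `&` _ in oU2.
pose U := U1 `&` U2; have oU : open U by exact: openI.
have UD : U `<=` D by move=> ? [[]].
have same x : U x -> p (s1 x) = p (s2 x).
  move=> [[[D1x D2x] Z1] [_ Z2]]; apply: injZ; [exact: mem_set|exact: mem_set|].
  by rewrite !tw_dom_proj /s1 /s2 !dsec_dom.
have Ux0 : U x0.
  have D0 : D x0 by split; [exists s0|exists (sc c0 s0) => //; rewrite dom_scale].
  split; split=> //=; first by rewrite -/(s1 x0) s1x0.
  by rewrite -/(s2 x0) s2x0 proj_scale.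
pose q x := gmul Sigma (s2 x) (ginv Sigma (s1 x)).
have cq : {within U, continuous q}.
  have c1 := within_subset_continuous (subset_trans UD D1) cs1.
  have c2 := within_subset_continuous (subset_trans UD D2) cs2.
  have c3 := within_pair c2 (within_compT c1 (@ginv_continuous _ Sigma)).
  have := within_comp c3 (@gmul_continuous _ Sigma); apply => x Ux /=.
  by rewrite grng_inv /s1 /s2 !dsec_dom.
have [_ _ emb] := tw_iota_embedding E.
have oTV : open ([set: X] `*` V) by apply: open_setX => //; exact: openT.
have [W oW eW] := emb _ oTV.
have oUW := within_preimage_open oU cq oW.
have qE x c : U x -> T c -> s2 x = sc c (s1 x) -> q x = tw_iota E (r (s1 x), c).
  move=> Ux tc e; rewrite /q e scaleMl ?grng_inv// gmulgV /tw_scale grng_unit.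
  by rewrite -{2}(tw_dom_iota E (r (s1 x)) tc) gmulg1.
exists (U `&` q @^-1` W); split=> //.
  split=> //=; rewrite (qE x0 c0)// ?s1x0 ?s2x0//.
  suff : (tw_iota E @` (setT `*` T) `&` W) (tw_iota E (r s0, c0)) by case.
  by rewrite -eW; exists (r s0, c0).
move=> x [Ux /= Wq]; have [c tc e] := proj_eq (same x Ux).
have [D1x D2x] := UD x Ux.
have [S1x d1x] := dsecP D1x; have [S2x d2x] := dsecP D2x.
exists (s1 x), c; split=> //; last by rewrite -e.
rewrite (qE x c Ux tc e) in Wq.
have : (tw_iota E @` (setT `*` T) `&` W) (tw_iota E (r (s1 x), c)).
  by split=> //; exists (r (s1 x), c).
by rewrite -eW => -[[x' c'] [[_ tc'] [_ Vc']] /iota_inj -[]// _ <-].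
Qed.

End Ratio.

Definition cplx_base (R : realType) : nat -> set (cplx R) :=
  sval (cid (cplx_countable_base R)).

Arguments cplx_base : clear implicits.

Lemma cplx_base_open (R : realType) n : open (cplx_base R n).
Proof. by rewrite /cplx_base; case: cid => V []. Qed.

Lemma cplx_baseP (R : realType) (z : cplx R) U : open U -> U z ->
  exists n, cplx_base R n z /\ closure (cplx_base R n) `<=` U.
Proof. by move=> oU Uz; rewrite /cplx_base; case: cid => V [? h] /=; exact: h. Qed.

(* A countable family of bisections that is large enough for its slices over the
   Stone space of the clopen sets d(S_i) to form a twisted groupoid. *)
Record reduction (R : realType) (X : topologicalType) (E : twisted_groupoid R X) :=
  Reduction {
  rd_S : nat -> set (tw_ext E);
  rd_cbis : forall i, compact_bisection (rd_S i);
  rd_one : exists i, rd_S i = range (gunit (tw_ext E));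
  rd_inv : forall i, exists j, rd_S j = ginv _ @` rd_S i;
  rd_mul : forall i j, exists k, rd_S k = bmul (rd_S i) (rd_S j);
  rd_compl : forall i, exists j,
    rd_S j = gunit (tw_ext E) @` (~` (gdom (tw_ext E) @` rd_S i));
  rd_dense : forall i j, exists e : nat -> set X, [/\
    forall k, exists m, rd_S m = gunit (tw_ext E) @` e k,
    forall k, e k `<=` ratio_set (rd_S i) (rd_S j) setT &
    ratio_set (rd_S i) (rd_S j) setT `<=` closure (\bigcup_k e k)];
  rd_level : forall i j k, exists m, rd_S m =
    gunit (tw_ext E) @` closure (ratio_set (rd_S i) (rd_S j) (cplx_base R k))
}.

Section Reduction.
Variables (R : realType) (X : ptopologicalType) (E : twisted_groupoid R X).
Variable A : reduction E.
Hypothesis cX : compact [set: X].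
Hypothesis etE : local_homeomorphism (gdom (tw_base E)).
Local Notation C := (cplx R).
Local Notation T := (circle R).
Local Notation Sigma := (tw_ext E).
Local Notation G := (tw_base E).
Local Notation r := (grng Sigma).
Local Notation d := (gdom Sigma).
Local Notation sc := (tw_scale E).
Local Notation p := (tw_proj E).
Local Notation S := (rd_S A).

Definition rd_e n : set X := d @` S n.
Local Notation e := rd_e.
Definition rd_Y : ptopologicalType := quot e.
Local Notation Y := rd_Y.
Definition rd_pi : X -> Y := @qpi X e.
Local Notation pi := rd_pi.

Lemma S_dinj i : dinj (S i). Proof. exact: cbis_dinj (rd_cbis A i). Qed.
Lemma S_rinj i : rinj (S i). Proof. exact: cbis_rinj (rd_cbis A i). Qed.

Lemma e_clopen n : clopen (e n).
Proof. exact: clopen_dom_image (rd_cbis A n). Qed.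

Lemma e_unit n : exists m, S m = gunit Sigma @` e n.
Proof.
have [j ej] := rd_compl A n; have [m em] := rd_compl A j.
by exists m; rewrite em ej dom_image_unit setCK.
Qed.

Lemma unit_e (B : set X) m : S m = gunit Sigma @` B -> e m = B.
Proof. by move=> h; rewrite /rd_e h dom_image_unit. Qed.

Lemma e_complement n : exists m, e m = ~` e n.
Proof. by have [m em] := rd_compl A n; exists m; exact: unit_e. Qed.

Lemma rd_restrict i n : exists j, S j = S i `&` d @^-1` e n.
Proof.
have [m em] := e_unit n; have [j ej] := rd_mul A i m.
by exists j; rewrite ej em bmul_unitE.
Qed.

Lemma e_pullback i n : exists j, S j = S i `&` r @^-1` e n.
Proof.
have [m em] := e_unit n; have [j ej] := rd_mul A m i.
by exists j; rewrite ej em bmul_unitEl.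
Qed.

Lemma e_intersection n m : exists k, e k = e n `&` e m.
Proof.
have [u eu] := e_unit n; have [k ek] := rd_restrict u m.
exists k; rewrite /rd_e ek eu; apply/seteqP; split.
  by move=> _ [_ [[x ex <-] /= mx] <-]; move: mx; rewrite gdom_unit.
move=> x [nx mx]; exists (gunit Sigma x); rewrite ?gdom_unit//.
by split; [exists x|rewrite /= gdom_unit].
Qed.

Lemma pi_nbhd (U : set X) x : open U -> (forall z, pi z = pi x -> U z) ->
  exists n, e n x /\ e n `<=` U.
Proof. exact: (qpi_nbhd cX e_clopen e_complement e_intersection). Qed.

Lemma rd_pi_continuous : continuous pi. Proof. exact: qpi_continuous. Qed.

(** The part of S_i with range in [e n] is again a member of the family, so that whether r(g) lies
    in [e n] is decided by whether d(g) lies in the domain of that member. *)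
Lemma rd_fibre i g h : S i g -> S i h -> pi (d g) = pi (d h) -> pi (r g) = pi (r h).
Proof.
move=> Sg Sh egh; apply/qpiE => n; have [j ej] := e_pullback i n.
have aux u v : S i u -> S i v -> pi (d u) = pi (d v) -> e n (r u) -> e n (r v).
  move=> Su Sv euv nu; have ju : e j (d u) by exists u => //; rewrite ej.
  have := qpi_sat euv ju; rewrite /e ej => -[w [Sw /= nw] dw].
  by rewrite -(S_dinj Sw Sv dw).
by split; exact: aux.
Qed.

Lemma rd_continuous i g (V : set Y) : S i g -> open V -> V (pi (r g)) ->
  exists W, [/\ open W, W (pi (d g)) &
    forall h, S i h -> W (pi (d h)) -> V (pi (r h))].
Proof.
move=> Sg oV Vg.
have [n [ny nV]] := quot_base cX e_clopen e_complement e_intersection oV Vg.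
have [j ej] := e_pullback i n; exists (pi @` e j); split.
- exact: qopen_e e_clopen _.
- exists (d g) => //; exists g => //; rewrite ej; split=> //=.
  by rewrite -[e n]qpi_preimage.
move=> h Sh [x [u]]; rewrite ej => -[Su nu] <- euh; apply: nV.
by exists (r u) => //; exact: (rd_fibre Su Sh).
Qed.

(* The closures of the level sets of the ratio are of the form e_m, hence unions
   of fibres of pi. *)
Lemma ratio_const_e i j n x x' c s s' : e n `<=` ratio_set (S i) (S j) setT ->
  e n x -> pi x = pi x' -> S i s -> S i s' -> d s = x -> d s' = x' ->
  T c -> S j (sc c s) -> S j (sc c s').
Proof.
move=> nij nx xx' Ss Ss' ds ds' tc Sc; have nx' := qpi_sat xx' nx.
have [s'' [c' [Ss'' ds'' tc' _ Sc']]] := nij _ nx'.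
have es : s'' = s' by apply: (S_dinj Ss'' Ss'); rewrite ds'' ds'.
subst s''; have [-> //|ne] := pselect (c = c').
have oN : open (~` [set c'] : set C).
  apply: closed_openC.
  exact: (accessible_closed_set1 (hausdorff_accessible (@norm_hausdorff C C))).
have [k [Vc clV]] := @cplx_baseP R c _ oN ne.
have [a ea] := rd_restrict i n; have [b eb] := rd_restrict j n.
have [m em] := rd_level A a b k.
have mx : e m x.
  rewrite (unit_e em); apply: subset_closure; exists s, c; split=> //.
    by rewrite ea; split=> //=; rewrite ds.
  by rewrite eb; split=> //=; rewrite dom_scale// ds.
have := qpi_sat xx' mx; rewrite (unit_e em) => clx'.
(* The closed level set of the disc contains x, hence x' by saturation. But x' also lies in the open
   level set of the complement of the closed disc. These sets would therefore meet at a point z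
   whose ratio is both in the disc and outside its closure. *)
have oC : open (~` closure (cplx_base R k)) by apply: closed_openC; exact: closed_closure.
have oR := ratio_open etE (rd_cbis A a) (rd_cbis A b) oC.
have Rx' : ratio_set (S a) (S b) (~` closure (cplx_base R k)) x'.
  exists s', c'; split=> //.
  - by rewrite ea; split=> //=; rewrite ds'.
  - by move=> /clV; exact.
  - by rewrite eb; split=> //=; rewrite dom_scale// ds'.
have [z [Vz Cz]] := clx' _ (open_nbhs_nbhs (conj oR Rx')).
have [u [v [Su du tv Vv Sv]]] := Vz.
have := ratio_uniq (@S_dinj a) (@S_dinj b) Su du tv Sv Cz.
by case; exact: subset_closure.
Qed.

(** By [pi_nbhd], agreement over the fibre of y extends to some [e n], on which [ratio_const_e]
    applies. *)
Lemma ratio_const i j y : (forall x, pi x = y -> ratio_set (S i) (S j) setT x) ->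
  exists c, T c /\ forall s, S i s -> pi (d s) = y -> S j (sc c s).
Proof.
move=> h; have [x ex] := qpi_surj y.
have oR := ratio_open etE (rd_cbis A i) (rd_cbis A j) (@openT C).
have [n [nx nR]] := @pi_nbhd _ x oR (fun z ez => h z (etrans ez ex)).
have [s0 [c [Ss0 ds0 tc _ Sc]]] := h x ex.
exists c; split=> // s Ss dy.
by apply: (ratio_const_e nR nx _ Ss0 Ss ds0 erefl tc Sc); rewrite dy.
Qed.

Definition rd_D n : set Y := pi @` e n.

Lemma rd_dom i : d @` S i = pi @^-1` rd_D i.
Proof. by rewrite /rd_D /rd_pi qpi_preimage. Qed.

Lemma rd_D_open i : open (rd_D i).
Proof. exact: qopen_e e_clopen _. Qed.

Lemma rd_D_compact i : compact (rd_D i).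
Proof.
apply: continuous_compact; first exact: continuous_within rd_pi_continuous.
by apply: (subclosed_compact _ cX) => //; case: (e_clopen i).
Qed.

Lemma rd_D_full i y x : rd_D i y -> pi x = y -> exists s, S i s /\ d s = x.
Proof.
move=> Dy ex; have : (pi @^-1` rd_D i) x by rewrite /= ex.
by rewrite -rd_dom => -[s Ss <-]; exists s.
Qed.

Definition ext_slice i (t : C) y : set Sigma :=
  [set g | exists s, [/\ S i s, pi (d s) = y & g = sc t s]].

Lemma ext_compat i j s t y (N : set C) : T s -> T t -> rd_D i y -> rd_D j y ->
  ext_slice j s y = ext_slice i t y -> open N -> N t ->
  exists W M, [/\ open W, open M, W y, M s & forall z u, W z -> M u ->
    T u -> rd_D j z -> rd_D i z /\
    exists v, [/\ N v, T v & ext_slice j u z = ext_slice i v z]].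
Proof.
(* Over y, the equality s S_j = t S_i says S_j = c0 S_i with c0 = s^-1 t. Nearby S_j = c S_i with c
   close to c0, so u S_j = v S_i with v = u c, which stays in N. *)
move=> ts tt Diy Djy eij oN Nt; have ts' := circle_conj ts.
have [x0 ex0] := qpi_surj y; pose c0 := Num.conj s * t.
have tc0 : T c0 by exact: circleM.
have [P [Q [oP oQ Ps Qc0 PQ]]] : exists P Q, [/\ open P, open Q, P s, Q c0 &
    forall a b, P a -> Q b -> N (a * b)].
  by apply: cplx_mul_open => //; rewrite /c0 mulrA circle_mulC// mul1r.
have oR := ratio_open etE (rd_cbis A i) (rd_cbis A j) oQ.
have fib z : pi z = pi x0 -> ratio_set (S i) (S j) Q z.
  move=> ez; have [u [Su du]] := rd_D_full Djy (etrans ez ex0).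
  have : ext_slice j s y (sc s u) by exists u; split=> //; rewrite du ez.
  rewrite eij => -[v [Sv dv euv]]; exists v, c0; split=> //.
    by rewrite -du -(dom_scale u ts) euv dom_scale.
  by rewrite /c0 -scaleA// -euv scaleA// circle_conjM// scale1.
have [n [nx nR]] := pi_nbhd oR fib.
exists (rd_D n), P; split=> //; [exact: rd_D_open|by exists x0|].
move=> z u [x xn xz] Pu tu Djz.
have nR' := subset_trans nR (@ratioS _ _ _ (S i) (S j) Q setT (fun _ _ => I)).
have [s0 [c [Ss0 ds0 tc Qc Sc]]] := nR x xn.
split; first by exists x => //; exists s0.
exists (u * c); split; [exact: PQ|exact: circleM|].
have const v : S i v -> pi (d v) = z -> S j (sc c v).
  move=> Sv dv.
  by apply: (ratio_const_e nR' xn _ Ss0 Sv ds0 erefl tc Sc); rewrite dv.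
apply/seteqP; split=> [_ [w [Sw dw ->]]|_ [v [Sv dv ->]]].
  have : e n (d w) by apply: (qpi_sat _ xn); rewrite -/pi xz dw.
  move=> /nR' [v [_ [Sv dv _ _ _]]].
  have dvz : pi (d v) = z by rewrite dv.
  exists v; split=> //; rewrite -scaleA//; congr (sc u _).
  apply: (@S_dinj j) => //; first exact: const.
  by rewrite dom_scale.
exists (sc c v); split; [exact: const|by rewrite dom_scale|by rewrite scaleA].
Qed.

Definition ext_system : slice_system R Y Sigma.
Proof.
apply: (@SliceSystem R X Y Sigma pi sc S rd_D).
- exact: quot_hausdorff e_clopen e_complement.
- exact: qpi_surj.
- by move=> t g; exact: rng_scale.
- by move=> t g; exact: dom_scale.
- exact: scale1.
- move=> s t g h ts tt gh; rewrite scaleMl ?rng_scale// scaleMr// scaleA//.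
- by move=> t g; exact: scaleV.
- exact: S_dinj.
- exact: S_rinj.
- exact: rd_dom.
- exact: rd_D_open.
- exact: rd_D_compact.
- exact: rd_fibre.
- exact: rd_continuous.
- exact: rd_one.
- exact: rd_inv.
- exact: rd_mul.
- exact: ext_compat.
Defined.

Definition base_S i : set G := p @` S i.

Lemma base_dom_image i : gdom G @` base_S i = d @` S i.
Proof.
by rewrite image_comp; apply: eq_imagel => s _; exact: tw_dom_proj.
Qed.

Definition base_slice i (t : C) y : set G :=
  [set g | exists s, [/\ base_S i s, pi (gdom G s) = y & g = s]].

Lemma base_slice_ratio i j t u y : base_slice j t y = base_slice i u y ->
  rd_D j y -> forall x, pi x = y -> ratio_set (S i) (S j) setT x.
Proof.
move=> eij Djy x ex; have [s [Ss ds]] := rd_D_full Djy ex.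
have : base_slice j t y (p s) by exists (p s); rewrite tw_dom_proj ds; split=> //; exists s.
rewrite eij => -[_ [[v Sv <-] dv evs]]; rewrite -ds -tw_dom_proj evs tw_dom_proj.
exact: ratio_proj Sv Ss (esym evs).
Qed.

Lemma base_compat i j s t y (N : set C) : T s -> T t -> rd_D i y -> rd_D j y ->
  base_slice j s y = base_slice i t y -> open N -> N t ->
  exists W M, [/\ open W, open M, W y, M s & forall z u, W z -> M u ->
    T u -> rd_D j z -> rd_D i z /\
    exists v, [/\ N v, T v & base_slice j u z = base_slice i v z]].
Proof.
move=> ts tt Diy Djy eij oN Nt; have [x0 ex0] := qpi_surj y.
have oR := ratio_open etE (rd_cbis A i) (rd_cbis A j) (@openT C).
have [n [nx nR]] := @pi_nbhd _ x0 oR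
  (fun z ez => base_slice_ratio eij Djy (etrans ez ex0)).
exists (rd_D n), setT; split=> //; [exact: rd_D_open|exact: openT|by exists x0|].
move=> z u [x xn xz] _ tu Djz.
split; first by exists x => //; have [s0 [? [? ? _ _ _]]] := nR x xn; exists s0.
(* Slices in G do not depend on the scalar, so the given t can be kept. *)
exists t; split=> //.
have nfib w : pi w = z -> ratio_set (S i) (S j) setT w.
  by move=> ew; apply/nR/(qpi_sat _ xn); rewrite -/pi xz ew.
apply/seteqP; split=> [_ [_ [[w Sw <-] dw ->]]|_ [_ [[v Sv <-] dv ->]]].
  rewrite tw_dom_proj in dw; have [v [c [Sv dv tc _ Sc]]] := nfib _ dw.
  exists (p w); split=> //; last by rewrite tw_dom_proj.
  exists v => //; rewrite -(proj_scale v tc); congr p.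
  by apply: (S_dinj Sc Sw); rewrite dom_scale.
rewrite tw_dom_proj in dv; have [v' [c [Sv' dv' tc _ Sc]]] := nfib _ dv.
have ev : v' = v by exact: (S_dinj Sv' Sv).
subst v'; exists (p v); split=> //; last by rewrite tw_dom_proj.
by exists (sc c v) => //; rewrite proj_scale.
Qed.

Definition base_system : slice_system R Y G.
Proof.
apply: (@SliceSystem R X Y G pi (fun _ g => g) base_S rd_D).
- exact: quot_hausdorff e_clopen e_complement.
- exact: qpi_surj.
- by [].
- by [].
- by [].
- by [].
- by [].
- move=> i _ _ [s Ss <-] [t St <-]; rewrite !tw_dom_proj => est.
  by rewrite (S_dinj Ss St est).
- move=> i _ _ [s Ss <-] [t St <-]; rewrite !tw_rng_proj => est.
  by rewrite (S_rinj Ss St est).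
- by move=> i; rewrite base_dom_image rd_dom.
- exact: rd_D_open.
- exact: rd_D_compact.
- move=> i _ _ [s Ss <-] [t St <-]; rewrite !tw_dom_proj !tw_rng_proj.
  exact: rd_fibre Ss St.
- move=> i _ V [s Ss <-] oV; rewrite tw_rng_proj => Vs.
  have [W [oW Ws WV]] := rd_continuous Ss oV Vs.
  exists W; split=> //; first by rewrite tw_dom_proj.
  by move=> _ [t St <-]; rewrite tw_dom_proj tw_rng_proj; exact: WV.
- have [i ei] := rd_one A; exists i; rewrite /base_S ei; apply/seteqP; split.
    by move=> _ [_ [x _ <-] <-]; exists x; rewrite // proj_unit.
  by move=> _ [x _ <-]; exists (gunit _ x); [exists x|exact: proj_unit].
- move=> i; have [j ej] := rd_inv A i; exists j.
  rewrite /base_S ej !image_comp; apply: eq_imagel => s _; exact: proj_inv.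
- move=> i j; have [k ek] := rd_mul A i j; exists k.
  rewrite /base_S ek; apply/seteqP; split.
    move=> _ [_ [g [h [Sg Sh gh ->]]] <-]; exists (p g), (p h); split.
    + by exists g.
    + by exists h.
    + by rewrite tw_dom_proj tw_rng_proj.
    + exact: tw_projM.
  move=> k0 [g0 [h0 [[g Sg <-] [h Sh <-]]]]; rewrite tw_dom_proj tw_rng_proj => gh ->.
  by exists (gmul _ g h); [exists g, h|exact: tw_projM].
- exact: base_compat.
Defined.

Local Notation AL := ext_system.
Local Notation AH := base_system.
Local Notation Lam := (slice_groupoid AL).
Local Notation H := (slice_groupoid AH).

Lemma ext_free : slice_free AL.
Proof.
move=> i s t y ts tt Dy est; have [x ex] := qpi_surj y.
have [g [Sg dg]] := rd_D_full Dy ex.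
have : ext_slice i s y (sc s g) by exists g; rewrite dg.
rewrite [ext_slice i s y]est => -[h [Sh dh egh]].
have ? : g = h.
  apply: (S_dinj Sg Sh); rewrite -(dom_scale g ts) egh dom_scale//.
by subst h; exact: (scale_inj ts tt egh).
Qed.

Lemma base_sliceE i s t y : ss_slice AH i s y = ss_slice AH i t y.
Proof. by []. Qed.

Lemma base_trivial : slice_trivial AH.
Proof. by move=> i s t y _ _; exact: base_sliceE. Qed.

Lemma ext_sliceE i t y : ss_slice AL i t y = ext_slice i t y.
Proof. by []. Qed.

Lemma ext_rngE (l : Lam) g : aset l g -> pi (r g) = grng Lam l.
Proof. exact: (@arngE _ _ _ _ AL). Qed.

Lemma proj_chart i t y (l : Lam) : chart AL i t y l ->
  p @` aset l = base_slice i t y.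
Proof.
move=> [tt Dy ->]; apply/seteqP; split.
  move=> _ [_ [s [Ss ds ->]] <-]; exists (p s); rewrite tw_dom_proj proj_scale//.
  by split=> //; exists s.
move=> g0 [g1 [[s Ss <-]]]; rewrite tw_dom_proj => ds ->; exists (sc t s).
  by exists s.
exact: proj_scale.
Qed.

Lemma proj_is_slice (l : Lam) : is_slice AH (p @` aset l).
Proof.
have [i [t [y cl]]] := chart_ex l; rewrite (proj_chart cl).
by have [tt Dy _] := cl; exists i, t, y.
Qed.

Definition rd_proj (l : Lam) : H := SliceArrow (proj_is_slice l).

Lemma chart_proj i t y l : chart AL i t y l -> chart AH i t y (rd_proj l).
Proof. by move=> cl; split; [case: cl|case: cl|exact: proj_chart cl]. Qed.

(** If l comes from S_j, then S_i and S_j agree in G over the whole fibre of y, and [ratio_const]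
    gives one scalar that turns a multiple of S_j into a multiple of S_i. Openness of the projection
    and exactness of the extension rest on this. *)
Lemma chart_change i t y l : chart AH i t y (rd_proj l) ->
  exists u, chart AL i u y l.
Proof.
have [j [s [y' cl]]] := chart_ex l => ch.
have ey : y' = y by rewrite -(chart_adom ch) (chart_adom (chart_proj cl)).
subst y'; have [_ Djy el] := cl; have [_ Diy eh] := ch.
have eij : base_slice j s y = base_slice i t y.
  by rewrite -(proj_chart cl); exact: eh.
have [c [tc const]] := ratio_const (base_slice_ratio eij Djy).
have ts : T s by case: cl.
exists (s * c); split=> //; first exact: circleM.
rewrite el !ext_sliceE; apply/seteqP.
split=> [_ [w [Sw dw ->]]|_ [v [Sv dv ->]]].
  have [v [Sv dv]] := rd_D_full Diy dw.
  exists v; rewrite dv -scaleA//; split=> //; congr (sc s _).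
  apply: (S_dinj Sw); rewrite ?dom_scale//; apply: const => //.
  by rewrite dv.
by exists (sc c v); split; [exact: const|rewrite dom_scale|rewrite scaleA].
Qed.

Definition rd_i1 : nat := sval (cid (rd_one A)).

Lemma rd_i1E : S rd_i1 = range (gunit Sigma).
Proof. by rewrite /rd_i1; case: cid. Qed.

Lemma base_i1E : base_S rd_i1 = range (gunit G).
Proof.
rewrite /base_S rd_i1E; apply/seteqP; split.
  by move=> _ [_ [x _ <-] <-]; exists x; rewrite // proj_unit.
by move=> _ [x _ <-]; exists (gunit _ x); [exists x|exact: proj_unit].
Qed.

Lemma ext_one y : chart AL rd_i1 1 y (aone AL y).
Proof. exact: (@chart_one _ _ _ _ AL _ _ rd_i1E). Qed.

Lemma base_one y : chart AH rd_i1 1 y (aone AH y).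
Proof. exact: (@chart_one _ _ _ _ AH _ _ base_i1E). Qed.

Definition rd_iota (yt : Y * C) : Lam :=
  xget (aone AL yt.1) [set l | chart AL rd_i1 yt.2 yt.1 l].

Lemma chart_iota y t : T t -> chart AL rd_i1 t y (rd_iota (y, t)).
Proof.
move=> tt; rewrite /rd_iota; case: xgetP => [l _ //|] /=.
have [_ Dy _] := ext_one y.
by have [l cl] := chart_mk tt Dy => /(_ l).
Qed.

Lemma scale_unit x t : T t -> sc t (gunit Sigma x) = tw_iota E (x, t).
Proof.
move=> tt; rewrite /tw_scale grng_unit.
by have := gmulg1 (tw_iota E (x, t)); rewrite tw_dom_iota.
Qed.

Lemma mem_iota y t g : T t ->
  aset (rd_iota (y, t)) g <-> exists x, pi x = y /\ g = tw_iota E (x, t).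
Proof.
move=> tt; have [_ _ ->] := chart_iota y tt; split.
  move=> [s [Ss ds ->]]; have := Ss; rewrite [ss_S _ _]rd_i1E => -[x _ ex].
  exists x; split; first by rewrite -ds -ex gdom_unit.
  by rewrite -scale_unit// ex.
move=> [x [ex ->]]; exists (gunit Sigma x); rewrite gdom_unit -scale_unit//.
by split=> //; rewrite [ss_S _ _]rd_i1E; exists x.
Qed.

Lemma dom_iota y t : T t -> adom (rd_iota (y, t)) = y.
Proof. by move=> /(chart_iota y)/chart_adom. Qed.

Lemma rng_iota y t : T t -> arng (rd_iota (y, t)) = y.
Proof.
move=> tt; have [x ex] := qpi_surj y.
rewrite -(@arngE _ _ _ _ AL _ (tw_iota E (x, t))) ?tw_rng_iota//.
by apply/mem_iota => //; exists x.
Qed.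

Lemma iotaM y s t : T s -> T t ->
  amul (rd_iota (y, s)) (rd_iota (y, t)) = rd_iota (y, s * t).
Proof.
move=> ts tt; have tst := circleM ts tt; apply: aset_inj.
rewrite aset_mul ?dom_iota ?rng_iota//; apply/seteqP; split.
  move=> k0 [g [h [/(mem_iota _ _ ts) [x [ex ->]] /(mem_iota _ _ tt) [z [ez ->]]]]].
  rewrite tw_dom_iota// tw_rng_iota// => xz ->; subst z.
  by apply/mem_iota => //; exists x; rewrite tw_iotaM.
move=> g /(mem_iota _ _ tst) [x [ex ->]].
exists (tw_iota E (x, s)), (tw_iota E (x, t)); split.
- by apply/mem_iota => //; exists x.
- by apply/mem_iota => //; exists x.
- by rewrite tw_dom_iota// tw_rng_iota.
- by rewrite tw_iotaM.
Qed.

Lemma iota1 y : rd_iota (y, 1) = aone AL y.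
Proof.
apply: (@chart_uniq _ _ _ _ AL rd_i1 1 y); first exact: chart_iota (circle1 R).
exact: ext_one.
Qed.

Lemma iota_image : rd_iota @` (setT `*` T) = chart_set AL rd_i1.
Proof.
apply/seteqP; split=> [_ [[y t] [_ tt] <-]|l [t [y cl]]].
  by exists t, y; exact: chart_iota.
have tt : T t by case: cl.
by exists (y, t) => //; exact: chart_uniq (chart_iota y tt) cl.
Qed.

Lemma iota_embedding : embedding_on (setT `*` T) rd_iota.
Proof.
split.
- move=> [y s] [z t] /set_mem [_ /= ts] /set_mem [_ /= tt] est.
  have eyz : y = z by rewrite -(dom_iota y ts) est dom_iota.
  subst z; congr (_, _); apply: (ext_free ts tt (i := rd_i1) (y := y)).
    by case: (chart_iota y ts).
  by have [_ _ <-] := chart_iota y ts; rewrite est; have [_ _ <-] := chart_iota y tt.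
- apply/withinP => -[y t] V [_ /= tt] oV Vt.
  have [W [N [oW oN Wy Nt h]]] := oV _ _ _ _ (chart_iota y tt) Vt.
  exists (W `*` N); split=> //; first exact: open_setX.
  by move=> [z u] [/= Wz Nu] [_ tu]; apply: (h z u) => //; exact: chart_iota.
move=> V oV; exists (rd_iota @` (setT `*` T `&` V)); last first.
  by apply/seteqP; split=> [_ [yt [Tyt Vyt] <-]|_ [_ ?]] //; split; exists yt.
apply/openP => _ [[y t] [[_ /= tt] Vyt] <-].
have [P [Q [oP oQ Py Qt PQ]]] := open_prodP oV Vyt.
exists [set l | exists t y, [/\ P y, Q t & chart AL rd_i1 t y l]]; split.
- exact: chart_image_open.
- by exists t, y; split=> //; exact: chart_iota.
move=> l [u [z [Pz Qu cl]]]; have tu : T u by case: cl.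
exists (z, u); first by split=> //; exact: PQ.
exact: chart_uniq (chart_iota z tu) cl.
Qed.

Lemma proj_continuous : continuous rd_proj.
Proof.
apply/contP => l V oV Vl; exists (rd_proj @^-1` V); split=> //.
rewrite slice_openE => i t y m cm Vm.
have [W [N [oW oN Wy Nt h]]] := oV _ _ _ _ (chart_proj cm) Vm.
exists W, N; split=> // z u n Wz Nu cn; apply: (h z u) => //; exact: chart_proj.
Qed.

Lemma proj_open (U : set Lam) : open U -> open (rd_proj @` U).
Proof.
move=> oU; rewrite slice_openE => i t y h0 + [l Ul el]; rewrite -{}el => ch.
have [u cl] := chart_change ch.
have [W [N [oW oN Wy Nu h]]] := oU _ _ _ _ cl Ul.
exists W, setT; split=> //; first exact: openT.
move=> z v m Wz _ cm; have tu : T u by case: cl.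
have [|n cn] := @chart_mk _ _ _ _ AL i u z tu; first by case: cm.
exists n; first exact: (h z u).
apply: aset_inj; have [_ _ ->] := chart_proj cn; have [_ _ ->] := cm.
exact: base_sliceE.
Qed.

Lemma proj_surj (h : H) : exists l, rd_proj l = h.
Proof.
have [i [t [y ch]]] := chart_ex h; have [tt Dy _] := ch.
have [l cl] := @chart_mk _ _ _ _ AL i t y tt Dy.
by exists l; exact: chart_uniq (chart_proj cl) ch.
Qed.

Lemma proj_exact : rd_proj @^-1` range (aone AH) = rd_iota @` (setT `*` T).
Proof.
rewrite iota_image; apply/seteqP; split=> [l [y _ ey]|l [t [y cl]]].
  have ch : chart AH rd_i1 1 y (rd_proj l) by rewrite -ey; exact: base_one.
  by have [u cl] := chart_change ch; exists u, y.
exists y => //; apply: aset_inj; have [_ _ ->] := chart_proj cl.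
have [_ _ ->] := base_one y.
exact: base_sliceE.
Qed.

Lemma rng_proj l : arng (rd_proj l) = arng l.
Proof.
have [g lg] := arrow_ne l; rewrite -(arngE lg).
by rewrite -(@arngE _ _ _ _ AH _ (p g)) ?tw_rng_proj//; exists g.
Qed.

Lemma dom_proj l : adom (rd_proj l) = adom l.
Proof.
have [g lg] := arrow_ne l; rewrite -(adomE lg).
by rewrite -(@adomE _ _ _ _ AH _ (p g)) ?tw_dom_proj//; exists g.
Qed.

Lemma projM l m : adom l = arng m ->
  rd_proj (amul l m) = amul (rd_proj l) (rd_proj m).
Proof.
move=> lm; apply: aset_inj; rewrite aset_mul ?dom_proj ?rng_proj//.
rewrite [LHS]/= aset_mul//; apply/seteqP; split.
  move=> _ [_ [g [h [lg mh gh ->]]] <-]; exists (p g), (p h); split.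
  - by exists g.
  - by exists h.
  - by rewrite tw_dom_proj tw_rng_proj.
  - exact: tw_projM.
move=> k0 [g0 [h0 [[g lg <-] [h mh <-]]]]; rewrite tw_dom_proj tw_rng_proj => gh ->.
by exists (gmul _ g h); [exists g, h|exact: tw_projM].
Qed.

Lemma mul_iota_l l t : T t -> aset (amul (rd_iota (arng l, t)) l) = sc t @` aset l.
Proof.
move=> tt; rewrite aset_mul ?dom_iota//; apply/seteqP; split.
  move=> k0 [g0 [g [/(mem_iota _ _ tt) [x [ex ->]] lg]]].
  by rewrite tw_dom_iota// => exg ->; exists g; rewrite // /tw_scale exg.
move=> _ [g lg <-]; exists (tw_iota E (r g, t)), g; split=> //.
  by apply/mem_iota => //; exists (r g); rewrite -(arngE lg).
by rewrite tw_dom_iota.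
Qed.

Lemma iota_central l t : T t ->
  amul (rd_iota (arng l, t)) l = amul l (rd_iota (adom l, t)).
Proof.
move=> tt; apply: aset_inj; rewrite mul_iota_l// aset_mul ?rng_iota//.
apply/seteqP; split.
  move=> _ [g lg <-]; exists g, (tw_iota E (d g, t)); split=> //.
  - by apply/mem_iota => //; exists (d g); rewrite -(adomE lg).
  - by rewrite tw_rng_iota.
  - by rewrite /tw_scale tw_central.
move=> k0 [g [g0 [lg /(mem_iota _ _ tt) [x [ex ->]]]]].
rewrite tw_rng_iota// => exg ->; exists g => //.
by rewrite /tw_scale tw_central// exg.
Qed.

Definition rd_twist : twisted_groupoid R Y.
Proof.
apply: (@TwistedGroupoid R Y H Lam rd_proj rd_iota).
- by apply: slice_locally_compact; left; exact: ext_free.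
- exact: rng_iota.
- exact: dom_iota.
- exact: iotaM.
- exact: iota1.
- exact: iota_embedding.
(* The circle bundle is even open in Lambda, being the domain of the chart of the units. *)
- exists (chart_set AL rd_i1), setT; split; [exact: chart_set_open|exact: closedT|].
  by rewrite iota_image setIT.
- exact: rng_proj.
- exact: dom_proj.
- exact: projM.
- exact: proj_continuous.
- exact: proj_open.
- exact: proj_surj.
- exact: proj_exact.
- exact: iota_central.
Defined.

Lemma rd_twisted_boolean : twisted_boolean rd_twist.
Proof.
split; first by apply: slice_etale; exact: base_trivial.
exact: quot_boolean cX e_clopen e_complement e_intersection.
Qed.

Lemma rd_second_countable : twisted_second_countable rd_twist.
Proof.
have ob n : open (pi @` e n) by exact: qopen_e e_clopen _.
have hb (y : Y) U : open U -> U y -> exists n, (pi @` e n) y /\ pi @` e n `<=` U.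
  exact: quot_base cX e_clopen e_complement e_intersection y U.
split; exact: slice_second_countable ob hb.
Qed.

Lemma scale_rd t (l : Lam) : T t -> aset (tw_scale rd_twist t l) = sc t @` aset l.
Proof. exact: mul_iota_l. Qed.

Lemma arrow_dom_ex (l : Lam) x : adom l = pi x -> exists g, aset l g /\ d g = x.
Proof. by move=> /esym; exact: (@arrow_dfull _ _ _ _ AL). Qed.

(** The set l contains exactly one g with d(g) = r(s) when (l, s) is composable, and the value is g
    s. The default s fills the other pairs. *)
Definition rd_act (l : Lam) (s : Sigma) : Sigma :=
  xget s [set u | exists g, [/\ aset l g, d g = r s & u = gmul Sigma g s]].

Lemma rd_actE l s g : aset l g -> d g = r s -> rd_act l s = gmul Sigma g s.
Proof.
move=> lg gs; rewrite /rd_act; case: xgetP; last first.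
  by move=> /(_ (gmul Sigma g s)) []; exists g.
by move=> _ _ [h [lh hs ->]]; rewrite (arrow_dinj lh lg)// gs hs.
Qed.

(** In the chart i the action is (t, s) |-> (t S_i(r s)) s, where S_i(r s) is a value of the
    continuous section [dsec]; the arrow enters only through its scalar t. *)
Lemma rd_act_continuous :
  {within [set ls : Lam * Sigma | adom ls.1 = pi (r ls.2)],
    continuous (fun ls => rd_act ls.1 ls.2)}.
Proof.
apply/withinP => -[l s] V /= els oV Vls.
have [i [t [y cl]]] := chart_ex l; have [tt Dy el] := cl.
have ey : y = pi (r s) by rewrite -(chart_adom cl).
pose D := [set ts : C * Sigma | T ts.1 /\ (d @` S i) (r ts.2)].
pose f (ts : C * Sigma) := gmul Sigma (sc ts.1 (dsec (S i) (r ts.2))) ts.2.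
have fE l' u z w : chart AL i u z l' -> adom l' = pi (r w) -> rd_act l' w = f (u, w).
  move=> cl' ew; have [tu Dz el'] := cl'.
  have : (d @` S i) (r w) by rewrite rd_dom /= -ew (chart_adom cl').
  move=> /dsecP [Sw dw]; rewrite (@rd_actE _ _ (sc u (dsec (S i) (r w)))) ?dom_scale//.
  rewrite el' ext_sliceE; exists (dsec (S i) (r w)).
  by rewrite dw -/pi -[pi _]ew (chart_adom cl').
have cf : {within D, continuous f}.
  have c1 : {within D, continuous (fun ts : C * Sigma => dsec (S i) (r ts.2))}.
    have c0 := continuous_within (A := D) (@snd_continuous C Sigma).
    have c0' := within_compT c0 (@grng_continuous _ Sigma).
    by apply: (within_comp c0' (dsec_continuous (rd_cbis A i))) => -[? ?] [].
  have c2 : {within D, continuous (fun ts : C * Sigma => tw_iota E (r (dsec (S i) (r ts.2)), ts.1))}.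
    have [_ ci _] := tw_iota_embedding E.
    have c3 := within_pair (within_compT c1 (@grng_continuous _ Sigma))
      (continuous_within (A := D) (@fst_continuous C Sigma)).
    by apply: (within_comp c3 ci) => -[? ?] [].
  have c4 : {within D, continuous (fun ts : C * Sigma => sc ts.1 (dsec (S i) (r ts.2)))}.
    have := within_comp (within_pair c2 c1) (@gmul_continuous _ Sigma).
    by apply => -[? ?] [/= ? _]; rewrite tw_dom_iota.
  have c5 := within_pair c4 (continuous_within (A := D) (@snd_continuous C Sigma)).
  have := within_comp c5 (@gmul_continuous _ Sigma).
  by apply => -[? ?] [/= ? _]; rewrite dom_scale// dsec_dom.
have Drs : (d @` S i) (r s) by rewrite rd_dom /= -ey.
have Ds : D (t, s) by split.
have Vf : V (f (t, s)) by rewrite -(fE l t y).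
have [Z [oZ Zts ZV]] := (withinP _ _).1 cf (t, s) V Ds oV Vf.
have [P [Q [oP oQ Pt Qs PQ]]] := open_prodP oZ Zts.
exists ([set l | exists t y, [/\ setT y, P t & chart AL i t y l]] `*` Q); split.
- by apply: open_setX => //; apply: chart_image_open => //; exact: openT.
- by split=> //; exists t, y.
move=> [l' w] [/= [u [z [_ Pu cl']]] Qw] ew.
rewrite (fE l' u z w cl' ew); apply: ZV; first exact: PQ.
have ez : z = pi (r w) by rewrite -(chart_adom cl'); exact: ew.
have Drw : (d @` S i) (r w) by rewrite rd_dom /= -ez; case: cl'.
by split=> //; case: cl'.
Qed.

Definition rd_action : multiplier_action rd_twist E.
Proof.
apply: (@MultiplierAction R Y X rd_twist E (fun s => pi (r s)) rd_act).
- move=> s; apply: continuous_comp; [exact: grng_continuous|exact: rd_pi_continuous].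
- exact: rd_act_continuous.
- move=> l s els; have [g [lg dg]] := arrow_dom_ex els.
  by rewrite (rd_actE lg dg) grng_mul//; exact: ext_rngE.
- move=> s; rewrite (@rd_actE _ _ (gunit Sigma (r s))) ?gdom_unit ?gmul1g//.
  by exists (r s).
- move=> l m s elm ems; have [g [mg dg]] := arrow_dom_ex ems.
  have [|h [lh dh]] := @arrow_dom_ex l (r g).
    by rewrite [LHS]elm; apply/esym/ext_rngE.
  rewrite (rd_actE mg dg) (@rd_actE l _ h) ?grng_mul//.
  rewrite (@rd_actE _ s (gmul Sigma h g)) ?gdom_mul// ?gmulA//.
  by rewrite [aset _]aset_mul//; exists h, g.
- by move=> s t st; rewrite grng_mul.
- move=> l s els; have [g [lg dg]] := arrow_dom_ex els.
  by rewrite (rd_actE lg dg) gdom_mul.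
- move=> l s t els st; have [g [lg dg]] := arrow_dom_ex els.
  by rewrite (rd_actE lg dg) (@rd_actE l _ g) ?grng_mul// gmulA.
- move=> c l s tc els; have [g [lg dg]] := arrow_dom_ex els.
  rewrite (@rd_actE _ _ (sc c g)) ?dom_scale//; last by rewrite scale_rd//; exists g.
  by rewrite (@rd_actE l _ g) ?rng_scale// scaleMl// scaleMr.
Defined.

Lemma anchor_rd x : anchor rd_action x = pi x.
Proof. by rewrite /anchor [LHS]/= grng_unit. Qed.

End Reduction.

(** * Existence of a reduction *)

Section BorelMeasure.
Variables (R : realType) (X : ptopologicalType) (mu : probability (borelType X) R).

Lemma open_borel (U : set X) : open U -> measurable (U : set (borelType X)).
Proof. by move=> oU; exact: sub_sigma_algebra. Qed.

Lemma closed_borel (U : set X) : closed U -> measurable (U : set (borelType X)).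
Proof.
move=> cU; rewrite -(setCK U); apply: measurableC; apply: open_borel.
exact: closed_openC.
Qed.

Lemma clopen_borel (U : set X) : clopen U -> measurable (U : set (borelType X)).
Proof. by move=> [oU _]; exact: open_borel. Qed.

(** Take clopen subsets of U whose measures tend to the supremum. A point of U outside the closure
    of their union would have a clopen neighbourhood in U, disjoint from all of them and of positive
    measure; adding it to one of them would exceed the supremum. *)
Lemma stonian_exhaust (U : set X) : stonian_space X ->
  (forall V : set X, open V -> V !=set0 -> (0 < mu V)%E) -> open U ->
  exists e : nat -> set X, [/\ forall k, clopen (e k), forall k, e k `<=` U &
    U `<=` closure (\bigcup_k e k)].
Proof.
move=> stX pos oU.
pose m (A : set X) : R := fine (mu A).
have mE (A : set X) : clopen A -> mu A = (m A)%:E.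
  by move=> cA; rewrite /m fineK//; exact: fin_num_measure (clopen_borel cA).
pose Q := [set m e | e in [set e : set X | clopen e /\ e `<=` U]].
have hQ : has_sup Q.
  split; first by exists (m set0), set0 => //; split; [exact: clopen0|exact: sub0set].
  exists 1 => _ [e [ce _] <-]; rewrite -lee_fin -mE//.
  by apply: probability_le1; exact: clopen_borel.
have hk k : exists e : set X, [/\ clopen e, e `<=` U & sup Q - k.+1%:R^-1 < m e].
  have k0 : 0 < k.+1%:R^-1 :> R by rewrite invr_gt0.
  by have [_ [e [ce eU] <-] lt] := sup_adherent k0 hQ; exists e.
have [e he] := choice hk.
exists e; split=> [k|k|x Ux]; [by case: (he k)|by case: (he k)|].
apply: contrapT => ncl.
have [e0 [ce0 e0x e0U]] := @stonian_clopen X (U `&` ~` closure (\bigcup_k e k)) x stX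
  (openI oU (closed_openC (@closed_closure _ _))) (conj Ux ncl).
have m0 : 0 < m e0.
  by rewrite -lte_fin -mE//; apply: pos; [case: ce0|exists x].
have bnd k : m e0 < k.+1%:R^-1.
  have [cek ekU lt] := he k.
  have mU : m (e0 `|` e k) = m e0 + m (e k).
    apply: EFin_inj; rewrite EFinD -!mE//; last exact: clopenU.
    rewrite measureU//; [exact: clopen_borel|exact: clopen_borel|].
    apply/seteqP; split=> // z [/e0U [_ nz] kz]; apply: nz.
    by apply: subset_closure; exists k.
  have : m (e0 `|` e k) <= sup Q.
    apply: sup_upper_bound => //; exists (e0 `|` e k) => //; split.
      exact: clopenU.
    by move=> z [/e0U []//|]; exact: ekU.
  by rewrite mU; move: (k.+1%:R^-1) lt => q; lra.
have [k mk] := ltr_add_invr m0; rewrite add0r in mk.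
by have := lt_trans mk (bnd k); rewrite ltxx.
Qed.

End BorelMeasure.

Section ReductionExists.
Variables (R : realType) (X : ptopologicalType) (E : twisted_groupoid R X).
Variable mu : probability (borelType X) R.
Hypothesis stX : stonian_space X.
Hypothesis pos : forall V : set X, open V -> V !=set0 -> (0 < mu V)%E.
Hypothesis etE : local_homeomorphism (gdom (tw_base E)).
Local Notation Sigma := (tw_ext E).
Local Notation d := (gdom Sigma).

Lemma reduction_exists (S0 : nat -> set Sigma) :
  (forall n, compact_bisection (S0 n)) ->
  exists A : reduction E, forall n, exists m, rd_S A m = S0 n.
Proof.
move=> bS0; have cX : compact [set: X] by case: stX.
have hX := tw_hausdorff E.
(* A sequence is chosen for every set, constantly empty if U is not open, so that the operations
   below can be total and still use clopen sets. *)
have hD0 (U : set X) : exists e : nat -> set X, (forall k, clopen (e k)) /\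
    (open U -> (forall k, e k `<=` U) /\ U `<=` closure (\bigcup_k e k)).
  have [oU|noU] := pselect (open U).
    by have [e [? ? ?]] := stonian_exhaust stX pos oU; exists e.
  by exists (fun=> set0); split=> // _; exact: clopen0.
have [D hD] := choice hD0.
(* One numbered binary operation encodes all closure conditions: product, inverse, complement of the
   domain and then, alternately, the clopen sets that exhaust the agreement set (even k) and the
   closed level sets of the ratio (odd k). *)
pose op (S S' : set Sigma) n := match n with
  | 0 => bmul S S'
  | 1 => ginv Sigma @` S
  | 2 => gunit Sigma @` (~` (d @` S))
  | k.+3 => if odd k then gunit Sigma @` closure (ratio_set S S' (cplx_base R k./2))
            else gunit Sigma @` (D (ratio_set S S' setT) k./2)
  end.
have bop S S' n : compact_bisection S -> compact_bisection S' ->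
    compact_bisection (op S S' n).
  move=> bS bS'; case: n => [|[|[|k]]] /=.
  - exact: cbis_bmul.
  - exact: cbis_binv.
  - apply: cbis_unit => //; have [? ?] := clopen_dom_image bS.
    by split; [exact: closed_openC|exact: open_closedC].
  - case: ifP => _; apply: cbis_unit => //; last by case: (hD (ratio_set S S' setT)).
    split; last exact: closed_closure.
    have [_ _] := stX; apply; apply: ratio_open => //; exact: cplx_base_open.
pose S1 n := if n is n'.+1 then S0 n' else range (gunit Sigma).
have bS1 n : compact_bisection (S1 n).
  case: n => [|n] /=; last exact: bS0.
  by apply: cbis_unit => //; exact: clopenT.
have [a [ba a1 aop]] := countable_closure bS1 bop.
unshelve eexists (@Reduction R X E a ba _ _ _ _ _ _).
- by have [m em] := a1 0%N; exists m.
- by move=> i; have [m em] := aop i i 1%N; exists m.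
- by move=> i j; have [m em] := aop i j 0%N; exists m.
- by move=> i; have [m em] := aop i i 2%N; exists m.
- move=> i j; exists (D (ratio_set (a i) (a j) setT)).
  have [_ h] := hD (ratio_set (a i) (a j) setT).
  have [|h1 h2] := h; first by apply: ratio_open => //; exact: openT.
  split=> // k; have [m em] := aop i j (k.*2).+3; exists m.
  by rewrite em /op odd_double doubleK.
- move=> i j k; have [m em] := aop i j (k.*2.+1).+3; exists m.
  by rewrite em /op /= odd_double /= uphalf_double.
- by move=> n; have [m em] := a1 n.+1; exists m.
Qed.

End ReductionExists.

(** * Complex integrals and fibre sums *)

Section BoundedBorel.
Variables (R : realType) (X : ptopologicalType).
Local Notation C := (cplx R).
Local Notation ReC := (@complex.Re R).
Local Notation ImC := (@complex.Im R).
Implicit Types (b c F G : X -> C).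

Lemma measurable_open_preimage (D : set X) (f : X -> R) : measurable (D : set (borelType X)) ->
  (forall V : set R, open V -> measurable (D `&` f @^-1` V : set (borelType X))) ->
  measurable_fun (D : set (borelType X)) (f : borelType X -> R).
Proof.
move=> mD h; apply: (measurability _ (RGenOInfty.measurableE R)).
by move=> _ [_ [r ->] <-]; apply: h; exact: interval_open.
Qed.

Lemma measurable_borel_map (Y : ptopologicalType) (D : set X) (f : X -> Y) :
  measurable (D : set (borelType X)) ->
  (forall V : set Y, open V -> measurable (D `&` f @^-1` V : set (borelType X))) ->
  measurable_fun (D : set (borelType X)) (f : borelType X -> borelType Y).
Proof.
move=> mD h.
apply: (@measurability _ _ (borelType X) (borelType Y) D f (@open Y) erefl).
by move=> _ [V oV <-]; exact: h.
Qed.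

Lemma continuous_borel (Y : ptopologicalType) (f : X -> Y) : continuous f ->
  measurable_fun [set: borelType X] (f : borelType X -> borelType Y).
Proof.
move=> cf; apply: measurable_borel_map => // V oV; rewrite setTI.
by apply: open_borel; apply: open_comp => // ? _; exact: cf.
Qed.

Lemma bounded_borel_intro b (M : C) : (forall x, `|b x| <= M) ->
  (forall V : set C, open V -> measurable (b @^-1` V : set (borelType X))) ->
  bounded_borel b.
Proof.
move=> bM h; split; first by exists M.
- apply: (measurable_open_preimage (D := setT)) => // V oV; rewrite setTI.
  apply: (h ((fun z : C => complex.Re z) @^-1` V)).
  by apply: open_comp => // ? _; exact: Re_cplx_continuous.
- apply: (measurable_open_preimage (D := setT)) => // V oV; rewrite setTI.
  apply: (h ((fun z : C => complex.Im z) @^-1` V)).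
  by apply: open_comp => // ? _; exact: Im_cplx_continuous.
Qed.

Lemma continuous_bounded b : compact [set: X] -> continuous b ->
  exists M : C, forall x, `|b x| <= M.
Proof.
move=> cX cb.
have bnd (f : X -> R) : continuous f -> exists M : R, forall x, `|f x| <= M.
  move=> cf; have cfX : compact (f @` setT).
    by apply: continuous_compact => //; exact: continuous_within cf.
  have [M [_ hM]] := compact_bounded cfX; exists (M + 1) => x.
  by apply: (hM (M + 1)); [rewrite ltrDl|exists x].
have [|M hM] := bnd (ReC \o b).
  by move=> x; apply: continuous_comp; [exact: cb|exact: Re_cplx_continuous].
have [|N hN] := bnd (ImC \o b).
  by move=> x; apply: continuous_comp; [exact: cb|exact: Im_cplx_continuous].
exists (M + N)%:C%C => x; apply: le_trans (normc_le_ReIm _) _.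
by rewrite lecR; apply: lerD; [exact: hM|exact: hN].
Qed.

Lemma continuous_bounded_borel b : compact [set: X] -> continuous b -> bounded_borel b.
Proof.
move=> cX cb; have [M hM] := continuous_bounded cX cb.
apply: (bounded_borel_intro hM) => V oV; apply: open_borel.
by apply: open_comp => // ? _; exact: cb.
Qed.

Lemma bounded_borel_cst (k : C) : bounded_borel (fun _ : X => k).
Proof.
apply: (@bounded_borel_intro _ `|k|) => // V oV.
have [Vc|nVc] := pselect (V k).
  rewrite (_ : _ @^-1` _ = setT); first exact: measurableT.
  by apply/seteqP; split.
rewrite (_ : _ @^-1` _ = set0); first exact: measurable0.
by apply/seteqP; split.
Qed.

Lemma bounded_borelD b c : bounded_borel b -> bounded_borel c ->
  bounded_borel (fun x => b x + c x).
Proof.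
move=> [[M bM] mRb mIb] [[N cN] mRc mIc]; split.
- by exists (M + N) => x; apply: le_trans (ler_normD _ _) _; exact: lerD.
- rewrite (_ : (fun x => _) = (fun x => ReC (b x) + ReC (c x))); first exact: measurable_funD.
  by apply/funext => x; case: (b x) (c x) => ? ? [].
- rewrite (_ : (fun x => _) = (fun x => ImC (b x) + ImC (c x))); first exact: measurable_funD.
  by apply/funext => x; case: (b x) (c x) => ? ? [].
Qed.

Lemma bounded_borelM b c : bounded_borel b -> bounded_borel c ->
  bounded_borel (fun x => b x * c x).
Proof.
move=> [[M bM] mRb mIb] [[N cN] mRc mIc]; split.
- by exists (M * N) => x; rewrite normrM; exact: ler_pM.
- rewrite (_ : (fun x => _) = (fun x => ReC (b x) * ReC (c x) - ImC (b x) * ImC (c x))).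
    by apply: measurable_funB; exact: measurable_funM.
  by apply/funext => x; case: (b x) (c x) => ? ? [].
- rewrite (_ : (fun x => _) = (fun x => ReC (b x) * ImC (c x) + ImC (b x) * ReC (c x))).
    by apply: measurable_funD; exact: measurable_funM.
  by apply/funext => x; case: (b x) (c x) => ? ? [].
Qed.

Lemma bounded_borel_conj b : bounded_borel b -> bounded_borel (fun x => Num.conj (b x)).
Proof.
move=> [[M bM] mRb mIb]; split.
- by exists M => x; rewrite norm_conjC.
- rewrite (_ : (fun x => _) = (fun x => ReC (b x)))//.
  by apply/funext => x; case: (b x).
- rewrite (_ : (fun x => _) = (fun x => - ImC (b x))); first exact: measurable_funN.
  by apply/funext => x; case: (b x).
Qed.

Lemma bounded_borel_extend (D : set X) b (M : C) : open D ->
  (forall x, D x -> `|b x| <= M) ->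
  measurable_fun (D : set (borelType X)) (fun x : borelType X => ReC (b x)) ->
  measurable_fun (D : set (borelType X)) (fun x : borelType X => ImC (b x)) ->
  bounded_borel (fun x => if `[< D x >] then b x else 0).
Proof.
move=> oD bM mR mI; have mD := open_borel oD; split.
- exists `|M| => x; case: asboolP => [Dx|_]; last by rewrite normr0.
  by apply: le_trans (bM x Dx) _; exact: real_ler_norm (ger0_real (le_trans (normr_ge0 _) (bM x Dx))).
- rewrite (_ : (fun x => _) = (fun x : borelType X => ReC (b x)) \_ (D : set (borelType X))).
    by apply/(measurable_restrict _ mD) => //; rewrite setTI.
  by apply/funext => x; rewrite patchE; case: asboolP => Dx; [rewrite mem_set|rewrite memNset].
- rewrite (_ : (fun x => _) = (fun x : borelType X => ImC (b x)) \_ (D : set (borelType X))).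
    by apply/(measurable_restrict _ mD) => //; rewrite setTI.
  by apply/funext => x; rewrite patchE; case: asboolP => Dx; [rewrite mem_set|rewrite memNset].
Qed.

End BoundedBorel.

Section ComplexIntegral.
Variables (R : realType) (X : ptopologicalType) (mu : probability (borelType X) R).
Local Notation C := (cplx R).
Local Notation ReC := (@complex.Re R).
Local Notation ImC := (@complex.Im R).
Implicit Types (b F G H : X -> C).
Local Notation int F := (cintegral mu F).
Local Notation rint f := (Rintegral mu [set: borelType X] f).
Local Notation integ f := (integrable mu [set: borelType X] (EFin \o (f : borelType X -> R))).

Lemma le_cplx (x y : C) : (x <= y) = (ImC y == ImC x) && (ReC x <= ReC y).
Proof. by case: x y => a b [c d]. Qed.

Lemma bounded_integrable (f : X -> R) (M : R) :
  measurable_fun [set: borelType X] (f : borelType X -> R) ->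
  (forall x, `|f x| <= M) -> integ f.
Proof.
move=> mf fM; apply: measurable_bounded_integrable => //.
  exact: (le_lt_trans (probability_le1 mu measurableT) (ltry _)).
exists M; split; first exact: num_real.
by move=> K MK x _; apply: le_trans (fM x) (ltW MK).
Qed.

Lemma bounded_borelP F : bounded_borel F -> exists M : R, forall x,
  `|ReC (F x)| <= M /\ `|ImC (F x)| <= M.
Proof.
move=> [[M FM] _ _]; exists (ReC M) => x; have := FM x.
have := normc_ge_Re (F x); have := normc_ge_Im (F x) => h1 h2 h3.
have := le_trans h1 h3; have := le_trans h2 h3.
by rewrite !le_cplx /= => /andP [_ ?] /andP [_ ?].
Qed.

Lemma Re_integrable F : bounded_borel F -> integ (fun x => ReC (F x)).
Proof.
move=> bF; have [M hM] := bounded_borelP bF; have [_ mR mI] := bF.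
by apply: (@bounded_integrable _ M) => // x; have [] := hM x.
Qed.

Lemma Im_integrable F : bounded_borel F -> integ (fun x => ImC (F x)).
Proof.
move=> bF; have [M hM] := bounded_borelP bF; have [_ mR mI] := bF.
by apply: (@bounded_integrable _ M) => // x; have [] := hM x.
Qed.

Lemma Re_cintegral F : ReC (int F) = rint (fun x => ReC (F x)).
Proof. by []. Qed.

Lemma Im_cintegral F : ImC (int F) = rint (fun x => ImC (F x)).
Proof. by []. Qed.

Lemma cplx_eq (x y : C) : ReC x = ReC y -> ImC x = ImC y -> x = y.
Proof. by case: x y => a b [c d] /= -> ->. Qed.

Lemma cintegral_linear (a : C) F G : bounded_borel F -> bounded_borel G ->
  int (fun x => a * F x + G x) = a * int F + int G.
Proof.
move=> bF bG; have bcst := bounded_borel_cst X.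
have iR := Re_integrable bF; have iI := Im_integrable bF.
have mT : measurable [set: borelType X] by exact: measurableT.
have iZ (k : R) (f : X -> R) : integ f -> integ (fun x => k * f x).
  by move=> i; exact: (integrableZl mT k i).
have iB (f g : X -> R) : integ f -> integ g -> integ (fun x => f x - g x).
  by move=> i j; exact: (integrableB mT i j).
have iD (f g : X -> R) : integ f -> integ g -> integ (fun x => f x + g x).
  by move=> i j; exact: (integrableD mT i j).
apply: cplx_eq.
- rewrite Re_cintegral.
  rewrite (_ : (fun x => _) = (fun x =>
      (ReC a * ReC (F x) - ImC a * ImC (F x)) + ReC (G x))); last first.
    by apply/funext => x; case: (a) (F x) (G x) => ? ? [? ?] [].
  rewrite RintegralD//; [|exact: iB (iZ _ _ iR) (iZ _ _ iI)|exact: Re_integrable].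
  rewrite RintegralB//; [|exact: iZ|exact: iZ].
  rewrite !RintegralZl// -Re_cintegral -Im_cintegral -Re_cintegral.
  by case: (a) (int F) (int G) => ? ? [? ?] [].
- rewrite Im_cintegral.
  rewrite (_ : (fun x => _) = (fun x =>
      (ReC a * ImC (F x) + ImC a * ReC (F x)) + ImC (G x))); last first.
    by apply/funext => x; case: (a) (F x) (G x) => ? ? [? ?] [].
  rewrite RintegralD//; [|exact: iD (iZ _ _ iI) (iZ _ _ iR)|exact: Im_integrable].
  rewrite RintegralD//; [|exact: iZ|exact: iZ].
  rewrite !RintegralZl// -Re_cintegral -Im_cintegral -Im_cintegral.
  by case: (a) (int F) (int G) => ? ? [? ?] [].
Qed.

Lemma cintegralZ (a : C) F : bounded_borel F -> int (fun x => a * F x) = a * int F.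
Proof.
move=> bF; have b0 := bounded_borel_cst X (0 : C).
have := cintegral_linear (a - 1) bF bF.
rewrite (_ : (fun x => _) = (fun x => a * F x)).
  by move=> ->; ring.
by apply/funext => x; ring.
Qed.

Lemma cintegralD F G : bounded_borel F -> bounded_borel G ->
  int (fun x => F x + G x) = int F + int G.
Proof.
move=> bF bG; have := cintegral_linear 1 bF bG.
by under eq_fun do rewrite mul1r; rewrite mul1r.
Qed.

Lemma cintegral_le F G : bounded_borel F -> bounded_borel G ->
  (forall x, F x <= G x) -> int F <= int G.
Proof.
move=> bF bG FG; rewrite le_cplx; apply/andP; split.
  rewrite !Im_cintegral; apply/eqP; congr (Rintegral mu _ _); apply/funext => x.
  by have := FG x; rewrite le_cplx => /andP [/eqP].
rewrite !Re_cintegral; apply: le_Rintegral => //; try exact: Re_integrable.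
by move=> x _; have := FG x; rewrite le_cplx => /andP [].
Qed.

(** Real and imaginary parts are bounded separately, which costs the factor 2. *)
Lemma cintegral_norm_le F H : bounded_borel F -> bounded_borel H ->
  (forall x, `|F x| <= H x) -> `|int F| <= 2 * int H.
Proof.
move=> bF bH FH.
have FH' x : `|ReC (F x)| <= ReC (H x) /\ `|ImC (F x)| <= ReC (H x).
  have h1 := le_trans (normc_ge_Re (F x)) (FH x).
  have h2 := le_trans (normc_ge_Im (F x)) (FH x).
  by move: h1 h2; rewrite !le_cplx /= => /andP [_ ?] /andP [_ ?].
have ImH : ImC (int H) = 0.
  rewrite Im_cintegral (_ : (fun x => _) = (fun=> 0)).
    by rewrite Rintegral_cst ?mul0r//; exact: measurableT.
  apply/funext => x; have := le_trans (normr_ge0 _) (FH x).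
  by rewrite le_cplx => /andP [/eqP].
have aux (f : X -> R) : integ f -> (forall x, `|f x| <= ReC (H x)) ->
    `|rint f| <= ReC (int H).
  move=> i fH; apply: le_trans (le_normr_Rintegral _ i) _ => //.
  rewrite Re_cintegral; apply: le_Rintegral => //; last exact: Re_integrable.
  exact: (integrable_abse i).
apply: le_trans (normc_le_ReIm _) _; rewrite le_cplx; apply/andP; split.
  by rewrite mulr_natl mulr2n; case: (int H) ImH => a b /= ->; rewrite addr0.
have h1 := aux _ (Re_integrable bF) (fun x => (FH' x).1).
have h2 := aux _ (Im_integrable bF) (fun x => (FH' x).2).
have -> : ReC (2 * int H) = ReC (int H) + ReC (int H).
  by rewrite mulr_natl mulr2n; case: (int H).
exact: lerD.
Qed.

Lemma cintegral_ae F G : bounded_borel F -> bounded_borel G ->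
  mu.-negligible [set x : borelType X | F x <> G x] -> int F = int G.
Proof.
move=> [_ mRF mIF] [_ mRG mIG] neg.
have aux (f : C -> R) : measurable_fun [set: borelType X] (fun x : borelType X => f (F x)) ->
   measurable_fun [set: borelType X] (fun x : borelType X => f (G x)) ->
   rint (fun x => f (F x)) = rint (fun x => f (G x)).
  move=> mF mG; rewrite /Rintegral; congr fine; apply: ae_eq_integral => //.
  - by apply/measurable_EFinP.
  - by apply/measurable_EFinP.
  apply: negligibleS neg => x /= nfg FG; apply: nfg => _.
  by rewrite FG.
by apply: cplx_eq; [exact: aux|exact: aux].
Qed.

Lemma cintegral_pushforward (Y : ptopologicalType) (phi : X -> Y) (F : Y -> C) :
  continuous phi -> bounded_borel F ->
  cintegral (pushforward mu (phi : borelType X -> borelType Y)) F =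
  int (fun x => F (phi x)).
Proof.
move=> cphi [[M bM] mR mI]; have mphi := continuous_borel cphi.
have bphi : bounded_borel (fun x => F (phi x)).
  split; first by exists M => x.
  - exact: (measurableT_comp mR mphi).
  - exact: (measurableT_comp mI mphi).
rewrite /cintegral; congr (fine _ +i* fine _)%C.
- rewrite (integral_pushforward mphi)//.
  + by apply/measurable_EFinP.
  + exact: Re_integrable bphi.
- rewrite (integral_pushforward mphi)//.
  + by apply/measurable_EFinP.
  + exact: Im_integrable bphi.
Qed.

End ComplexIntegral.

Section FiniteSumInequalities.
Variables (K : numFieldType) (I : choiceType).
Implicit Types (A B : set I) (f g : I -> K).

Lemma fsbig_norm_le A f g :
  finite_set (A `&` [set i | f i != 0]) -> finite_set (A `&` [set i | g i != 0]) ->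
  (forall i, A i -> `|f i| <= g i) ->
  `|\sum_(i \in A) f i| <= \sum_(i \in A) g i.
Proof.
move=> ff fg h.
set B := (A `&` [set i | f i != 0]) `|` (A `&` [set i | g i != 0]).
have fB : finite_set B by rewrite finite_setU.
have BA : B `<=` A by move=> i [[]|[]].
have out i : (A `\` B) i -> f i = 0 /\ g i = 0.
  move=> [Ai nB]; split; apply/eqP; apply: contrapT => /negP e; apply: nB.
    by left.
  by right.
rewrite -(@fsbig_widen _ _ _ _ B A f)//; last by move=> i /out [].
rewrite -(@fsbig_widen _ _ _ _ B A g)//; last by move=> i /out [].
rewrite !fsbig_finite//; apply: le_trans (ler_norm_sum _ _ _) _.
rewrite big_seq [leRHS]big_seq; apply: ler_sum => i.
by rewrite in_fset_set// => /set_mem /BA; exact: h.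
Qed.

Lemma fsbig_ge0 A f : (forall i, A i -> 0 <= f i) -> 0 <= \sum_(i \in A) f i.
Proof.
move=> h; have [fin|inf] := pselect (finite_set (A `&` [set i | f i != 0])).
  apply: le_trans (normr_ge0 _) (fsbig_norm_le fin fin _) => i Ai.
  by rewrite ger0_norm//; exact: h.
rewrite fsbig_dflt// => fin; apply: inf; apply: sub_finite_set fin => i [Ai /= fi].
by split=> //=; apply/eqP.
Qed.

Lemma fsbig_subset_le A B f : A `<=` B -> finite_set (B `&` [set i | f i != 0]) ->
  (forall i, B i -> 0 <= f i) -> \sum_(i \in A) f i <= \sum_(i \in B) f i.
Proof.
move=> AB fin h.
pose f' i := if i \in A then f i else 0.
have -> : \sum_(i \in A) f i = \sum_(i \in B) f' i.
  rewrite -(@fsbig_widen _ _ _ _ A B f')//.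
    by apply: eq_fsbigr => i iA; rewrite /f' iA.
  by move=> i [Bi nA] /=; rewrite /f' memNset.
have f0 i : B i -> 0 <= f' i by rewrite /f'; case: ifP => // _; exact: h.
rewrite -[leLHS]ger0_norm; last exact: fsbig_ge0.
apply: fsbig_norm_le => //; last first.
  by move=> i Bi; rewrite ger0_norm ?f0// /f'; case: ifP => // _; exact: h.
apply: sub_finite_set fin => i [Bi /=]; rewrite /f'; case: ifP => // _.
by rewrite eqxx.
Qed.

End FiniteSumInequalities.

Section FibreSums.
Variables (R : realType) (X : ptopologicalType) (E : twisted_groupoid R X).
Hypothesis cX : compact [set: X].
Hypothesis etE : local_homeomorphism (gdom (tw_base E)).
Local Notation C := (cplx R).
Local Notation ReC := (@complex.Re R).
Local Notation Sigma := (tw_ext E).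
Local Notation G := (tw_base E).
Local Notation r := (grng Sigma).
Local Notation d := (gdom Sigma).
Local Notation sc := (tw_scale E).
Local Notation T := (circle R).
Local Notation p := (tw_proj E).
Local Notation "g ** h" := (gmul Sigma g h) (at level 40, left associativity).
Implicit Types (f g h : Sigma -> C) (S : set Sigma) (b beta : X -> C) (x : X).

Definition rweight beta g : Sigma -> C := fun s => beta (r s) * g s.

Definition fibre_norm f x : C := fibre_sum f f x.

Lemma rweight1 g : rweight (fun=> 1) g = g.
Proof. by apply/funext => s; rewrite /rweight mul1r. Qed.

Lemma fibre_sum_supp f g x : fibre_finite f ->
  finite_set ((gdom G @^-1` [set x]) `&`
    [set k | Num.conj (f (tw_lift k)) * g (tw_lift k) != 0]).
Proof.
move=> ff; apply: sub_finite_set (ff x).1 => k [kx /= nz]; split=> //.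
by apply: contraNneq nz => ->; rewrite rmorph0 mul0r.
Qed.

Lemma fibre_sum_linear_r (a : C) f g1 g2 x : fibre_finite f ->
  fibre_sum f (fun s => a * g1 s + g2 s) x =
  a * fibre_sum f g1 x + fibre_sum f g2 x.
Proof.
move=> ff; rewrite /fibre_sum -fsbig_linear.
- by apply: eq_fsbigr => k _; ring.
- exact: fibre_sum_supp.
- exact: fibre_sum_supp.
Qed.

Lemma fibre_sum_linear_l (a : C) f1 f2 g x : fibre_finite f1 -> fibre_finite f2 ->
  fibre_sum (fun s => a * f1 s + f2 s) g x =
  Num.conj a * fibre_sum f1 g x + fibre_sum f2 g x.
Proof.
move=> ff1 ff2; rewrite /fibre_sum -fsbig_linear.
- by apply: eq_fsbigr => k _; rewrite rmorphD rmorphM; ring.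
- exact: fibre_sum_supp.
- exact: fibre_sum_supp.
Qed.

Lemma fibre_sum_term f beta S b x : compact_bisection S -> equivariant f ->
  fibre_sum f (rweight beta (Ccterm S b)) x =
  if `[< (d @` S) x >]
  then Num.conj (f (dsec S x)) * (beta (r (dsec S x)) * b x) else 0.
Proof.
move=> bS ef; have iS := cbis_dinj bS; case: asboolP => [Sx|nSx]; last first.
  rewrite /fibre_sum fsbig1// => k /= kx.
  rewrite /rweight /Ccterm; have [[c [t [cc St e _]]]|[_ ->]] := DeltaP (tw_lift k) iS.
    by case: nSx; exists t; rewrite // -(dom_scale t cc) -e dom_lift.
  by rewrite mul0r !mulr0.
have [St dt] := dsecP Sx; set t := dsec S x in St dt *.
rewrite /fibre_sum (@fsbig_single _ _ _ _ (p t)).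
- have [c cc e] := lift_proj t.
  rewrite e ef// /rweight rng_scale// /Ccterm DeltaE// dom_scale// dt.
  have -> : Num.conj (Num.conj c * f t) = c * Num.conj (f t) by rewrite [LHS](rmorphM (@Num.conj C)) /= conjCK.
  rewrite -[RHS](mul1r) -(circle_mulC cc); ring.
- by rewrite /= tw_dom_proj dt.
- move=> k /= kx kp; rewrite /rweight /Ccterm.
  have [->|nz] := eqVneq (Delta S (tw_lift k)) 0; first by rewrite mul0r !mulr0.
  case: kp; rewrite -(proj_lift k); apply: (Delta_proj iS nz St).
  by rewrite dom_lift kx dt.
Qed.

Lemma rweight_cons beta S b g :
  rweight beta (fun s => Ccterm S b s + g s) =
  (fun s => 1 * rweight beta (Ccterm S b) s + rweight beta g s).
Proof. by apply/funext => s; rewrite /rweight; ring. Qed.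

Lemma rweight0 beta : rweight beta (fun=> 0) = (fun=> 0).
Proof. by apply/funext => s; rewrite /rweight mulr0. Qed.

Lemma fibre_sum0r f x : fibre_sum f (fun=> 0) x = 0.
Proof. by rewrite /fibre_sum fsbig1// => k _; rewrite mulr0. Qed.

(** Continuity can fail, since the agreement set of S1 and S2 need not be closed. Preimages of open
    sets are open ratio sets, joined with the complement of the agreement set when 0 belongs to
    V. *)
Lemma Delta_dsec_borel S1 S2 : compact_bisection S1 -> compact_bisection S2 ->
  bounded_borel (fun x => if `[< (d @` S2) x >] then Delta S1 (dsec S2 x) else 0).
Proof.
move=> b1 b2; have i1 := cbis_dinj b1; have i2 := cbis_dinj b2.
apply: (@bounded_borel_intro _ _ _ 1) => [x|V oV].
  by case: asboolP => _; [exact: Delta_norm|rewrite normr0].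
have oV' : open (Num.conj @^-1` V) by apply: open_comp => // ? _; exact: conj_cplx_continuous.
have o1 := ratio_open etE b1 b2 oV'; have o2 := ratio_open etE b1 b2 (@openT C).
have dsecE' s c x : S1 s -> d s = x -> T c -> S2 (sc c s) ->
    Delta S1 (dsec S2 x) = Num.conj c /\ (d @` S2) x.
  move=> Ss ds cc Sc; have ds' : d (sc c s) = x by rewrite dom_scale.
  by rewrite -ds' dsecE// DeltaE//; split=> //; exact: imageP.
have out x : ~ ratio_set S1 S2 setT x ->
    (if `[< (d @` S2) x >] then Delta S1 (dsec S2 x) else 0) = 0.
  move=> nr; case: asboolP => // /dsecP [St dt].
  have [[c [t [cc Ss e _]]]|[_ ->//]] := DeltaP (dsec S2 x) i1.
  case: nr; exists t, c; split=> //; last by rewrite -e.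
  by rewrite -(dom_scale t cc) -e.
have [V0|nV0] := pselect (V 0).
  rewrite (_ : _ @^-1` _ = ratio_set S1 S2 (Num.conj @^-1` V) `|` ~` ratio_set S1 S2 setT).
    by apply: measurableU; [exact: open_borel|apply: measurableC; exact: open_borel].
  apply/seteqP; split=> x.
    have [[s [c [Ss ds cc _ Sc]]]|nr] := pselect (ratio_set S1 S2 setT x); last by right.
    have [e Sx] := dsecE' s c x Ss ds cc Sc.
    by rewrite /= asboolT// e => Vc; left; exists s, c.
  move=> [[s [c [Ss ds cc Vc Sc]]]|nr] /=; last by rewrite out.
  by have [e Sx] := dsecE' s c x Ss ds cc Sc; rewrite asboolT// e.
rewrite (_ : _ @^-1` _ = ratio_set S1 S2 (Num.conj @^-1` V)); first exact: open_borel.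
apply/seteqP; split=> x /=.
  have [[s [c [Ss ds cc _ Sc]]]|nr] := pselect (ratio_set S1 S2 setT x); last by rewrite out.
  have [e Sx] := dsecE' s c x Ss ds cc Sc.
  by rewrite asboolT// e => Vc; exists s, c.
move=> [s [c [Ss ds cc Vc Sc]]].
by have [e Sx] := dsecE' s c x Ss ds cc Sc; rewrite asboolT// e.
Qed.

(** The partial homeomorphism of X defined by the bisection; by the default of [dsec] it is the
    identity off d(S). *)
Definition bis_map S x : X := r (dsec S x).

Lemma bis_map_measurable S : compact_bisection S ->
  measurable_fun (d @` S : set (borelType X)) (bis_map S : borelType X -> borelType X).
Proof.
move=> bS; have [oS _] := clopen_dom_image bS.
apply: measurable_borel_map; first exact: open_borel.
move=> V oV; apply: open_borel; apply: within_preimage_open => //.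
exact: within_compT (dsec_continuous bS) (@grng_continuous _ Sigma).
Qed.

Lemma bis_map_borel S beta : compact_bisection S -> bounded_borel beta ->
  bounded_borel (fun x => if `[< (d @` S) x >] then beta (bis_map S x) else 0).
Proof.
move=> bS [[M bM] mR mI]; have [oS _] := clopen_dom_image bS.
have mS := bis_map_measurable bS.
apply: (@bounded_borel_extend _ _ _ _ M) => //.
- exact: (measurableT_comp mR mS).
- exact: (measurableT_comp mI mS).
Qed.

Lemma fibre_sum_borel f g beta : Cc E f -> Cc E g -> bounded_borel beta ->
  bounded_borel (fibre_sum f (rweight beta g)).
Proof.
move=> Cf Cg bb; move: g Cg; apply: (Cc_ind cX) => [|S b g bS cb Cg ih].
  rewrite rweight0 (_ : fibre_sum _ _ = fun=> 0); first exact: bounded_borel_cst.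
  by apply/funext => x; exact: fibre_sum0r.
rewrite rweight_cons (_ : fibre_sum _ _ = fun x =>
    fibre_sum f (rweight beta (Ccterm S b)) x + fibre_sum f (rweight beta g) x); last first.
  by apply/funext => x; rewrite fibre_sum_linear_r ?mul1r//; exact: Cc_fibre_finite.
apply: bounded_borelD => //; have ef := Cc_equivariant cX Cf.
rewrite (_ : fibre_sum _ _ = fun x =>
    Num.conj (if `[< (d @` S) x >] then f (dsec S x) else 0) *
    ((if `[< (d @` S) x >] then beta (bis_map S x) else 0) * b x)); last first.
  apply/funext => x; rewrite fibre_sum_term//; case: ifP => // _.
  by rewrite rmorph0 mul0r.
apply: bounded_borelM; last first.
  by apply: bounded_borelM; [exact: bis_map_borel|exact: continuous_bounded_borel].
apply: bounded_borel_conj => {ih ef}; move: f Cf.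
apply: (Cc_ind cX) => [|S' b' f bS' cb' Cf ih].
  rewrite (_ : (fun x => _) = fun=> 0); first exact: bounded_borel_cst.
  by apply/funext => x; case: ifP.
rewrite (_ : (fun x => _) = fun x =>
    (if `[< (d @` S) x >] then Delta S' (dsec S x) else 0) * b' x +
    (if `[< (d @` S) x >] then f (dsec S x) else 0)); last first.
  apply/funext => x; case: asboolP => [/dsecP [_ dx]|_]; last by rewrite mul0r addr0.
  by rewrite /Ccterm dx.
apply: bounded_borelD => //; apply: bounded_borelM; first exact: Delta_dsec_borel.
exact: continuous_bounded_borel.
Qed.

Lemma fibre_norm_borel f : Cc E f -> bounded_borel (fibre_norm f).
Proof.
move=> Cf; rewrite /fibre_norm (_ : (fun x => _) = fibre_sum f (rweight (fun=> 1) f)).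
  by apply: fibre_sum_borel => //; exact: bounded_borel_cst.
by rewrite rweight1.
Qed.

Lemma fibre_normE f x :
  fibre_norm f x = \sum_(k \in gdom G @^-1` [set x]) `|f (tw_lift k)| ^+ 2.
Proof.
by apply: eq_fsbigr => k _; rewrite normCK mulrC.
Qed.

Lemma fibre_norm_supp f x : fibre_finite f ->
  finite_set ((gdom G @^-1` [set x]) `&` [set k | `|f (tw_lift k)| ^+ 2 != 0]).
Proof.
move=> ff; apply: sub_finite_set (ff x).1 => k [kx /= nz]; split=> //.
by apply: contraNneq nz => ->; rewrite normr0 expr0n.
Qed.

Lemma fibre_norm_ge0 f x : 0 <= fibre_norm f x.
Proof. by rewrite fibre_normE; apply: fsbig_ge0 => k _; exact: exprn_ge0. Qed.

(** The factors 1/2 are given away. Once integrated, the inequality is optimised over t in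
    [AMGM_sup]; it takes the place of Cauchy-Schwarz for weighted functions that may lie outside
    Cc. *)
Lemma cplx_AMGM (a b : C) (t : R) : 0 < t ->
  `|a| * `|b| <= (t%:C)%C * `|a| ^+ 2 + (t^-1%:C)%C * `|b| ^+ 2.
Proof.
move=> t0.
have real (z : C) : `|z| = ((ReC `|z|)%:C)%C by apply/esym/RRe_real; exact: normr_real.
rewrite (real a) (real b); move: (ReC `|a|) (ReC `|b|) => u v.
rewrite -!rmorphXn -!rmorphM -rmorphD /= lecR.
have tt : t * t^-1 = 1 by rewrite divff// gt_eqF.
have ti : 0 < t^-1 by rewrite invr_gt0.
(* Completing the square leaves t times a sum of two squares as remainder. *)
have -> : t * u ^+ 2 + t^-1 * v ^+ 2 =
    u * v + t * ((u - t^-1 * v / 2) ^+ 2 + 3 / 4 * (t^-1 * v) ^+ 2).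
  have -> : t * ((u - t^-1 * v / 2) ^+ 2 + 3 / 4 * (t^-1 * v) ^+ 2) =
    t * u ^+ 2 - (t * t^-1) * (u * v) + (t * t^-1) * (t^-1 * v ^+ 2) by field; rewrite gt_eqF.
  by rewrite tt !mul1r; ring.
rewrite lerDl; apply: mulr_ge0; first exact: ltW.
by apply: addr_ge0; [exact: sqr_ge0|apply: mulr_ge0; [lra|exact: sqr_ge0]].
Qed.

Lemma fibre_sum_AMGM f g beta (M : C) (t : R) x : fibre_finite f -> fibre_finite g ->
  (forall y, `|beta y| <= M) -> 0 < t ->
  `|fibre_sum f (rweight beta g) x| <=
  M * ((t%:C)%C * fibre_norm f x + (t^-1%:C)%C * fibre_norm g x).
Proof.
move=> ff fg bM t0; have M0 : 0 <= M by apply: le_trans (bM x).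
have sf := fibre_norm_supp x ff; have sg := fibre_norm_supp x fg.
have sg' : finite_set ((gdom G @^-1` [set x]) `&`
    [set k | (t^-1%:C)%C * `|g (tw_lift k)| ^+ 2 != 0]).
  apply: sub_finite_set sg => k [kx /= nz]; split=> //.
  by apply: contraNneq nz => ->; rewrite mulr0.
rewrite !fibre_normE -(fsbig_scale _ sg) -fsbig_linear//.
have sfg : finite_set ((gdom G @^-1` [set x]) `&`
    [set k | (t%:C)%C * `|f (tw_lift k)| ^+ 2 + (t^-1%:C)%C * `|g (tw_lift k)| ^+ 2 != 0]).
  apply: (@sub_finite_set _ _ (((gdom G @^-1` [set x]) `&` [set k | `|f (tw_lift k)| ^+ 2 != 0])
     `|` ((gdom G @^-1` [set x]) `&` [set k | (t^-1%:C)%C * `|g (tw_lift k)| ^+ 2 != 0]))).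
    move=> k [kx /= nz]; have [e|ne] := eqVneq (`|f (tw_lift k)| ^+ 2) 0.
      by right; split=> //=; rewrite e mulr0 add0r in nz.
    by left.
  by rewrite finite_setU.
rewrite -fsbig_scale//; apply: fsbig_norm_le.
- exact: fibre_sum_supp.
- apply: sub_finite_set sfg => k [kx /= nz]; split=> //=.
  by apply: contraNneq nz => ->; rewrite mulr0.
- move=> k _; rewrite normrM norm_conjC /rweight normrM mulrCA.
  by apply: ler_pM => //; exact: cplx_AMGM.
Qed.

Lemma fibre_norm_eq f s : equivariant f -> `|f (tw_lift (p s))| = `|f s|.
Proof.
move=> ef; have [c cc [_ ->]] := equivariant_lift s ef.
by rewrite normrM norm_conjC cc mul1r.
Qed.

Lemma conv_term_r h S b s : compact_bisection S -> equivariant h ->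
  convolution h (Ccterm S b) s =
  if `[< (d @` S) (d s) >] then h (s ** ginv _ (dsec S (d s))) * b (d s) else 0.
Proof.
move=> bS eh; have iS := cbis_dinj bS; case: asboolP => [Sx|nSx]; last first.
  rewrite /convolution fsbig1// => k /= kx.
  rewrite /Ccterm gdom_mul ?gdom_inv ?rng_lift//.
  have [[c [t [cc St e _]]]|[_ ->]] := DeltaP (ginv _ (tw_lift k) ** s) iS.
    case: nSx; exists t => //; rewrite -(dom_scale t cc) -e gdom_mul//.
    by rewrite gdom_inv rng_lift.
  by rewrite mul0r mulr0.
have [St dt] := dsecP Sx; set t := dsec S (d s) in St dt *.
have st : d s = r (ginv _ t) by rewrite grng_inv dt.
rewrite /convolution (@fsbig_single _ _ _ _ (p (s ** ginv _ t))).
- have [c cc e] := lift_proj (s ** ginv _ t); have cc' := circle_conj cc.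
  rewrite e eh// scaleV// scaleMl ?gdom_inv ?grng_mul// ginvM// ginvK.
  rewrite -gmulA ?gdom_inv ?grng_inv// gmulVg -dt gmulg1.
  by rewrite /Ccterm DeltaE// dom_scale// conjCK -mulrA mulrCA (mulrA (Num.conj c)) circle_conjM// mul1r.
- by rewrite /= tw_rng_proj grng_mul.
- move=> k /= kx kp; rewrite /Ccterm.
  have lk : r (tw_lift k) = r s by rewrite rng_lift.
  have [[c [u [cc Su e _]]]|[_ ->]] := DeltaP (ginv _ (tw_lift k) ** s) iS; last first.
    by rewrite mul0r mulr0.
  have eu : u = t.
    by apply: iS => //; rewrite dt -(dom_scale u cc) -e gdom_mul// gdom_inv.
  subst u; case: kp; rewrite -(proj_lift k).
  have es : s = sc c (tw_lift k ** t).
    rewrite -scaleMr// -?e ?gmulVKg//.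
    by rewrite -(rng_scale t cc) -e grng_mul ?gdom_inv// grng_inv.
  have kt : d (tw_lift k) = r t.
    by rewrite -(rng_scale t cc) -e grng_mul ?gdom_inv// grng_inv.
  by rewrite es scaleMl ?grng_inv ?gdom_mul// proj_scale// gmulgK.
Qed.

(** Right multiplication by t^-1, where t is the element of S over x, maps the fibre of G over x
    bijectively onto the fibre over r(t). *)
Lemma fibre_norm_conv_r h S b x : compact_bisection S -> equivariant h ->
  fibre_finite h ->
  fibre_norm (convolution h (Ccterm S b)) x =
  if `[< (d @` S) x >] then `|b x| ^+ 2 * fibre_norm h (bis_map S x) else 0.
Proof.
move=> bS eh fh; rewrite !fibre_normE; case: asboolP => [Sx|nSx]; last first.
  rewrite fsbig1// => k /= kx; rewrite conv_term_r// asboolF ?normr0 ?expr0n//.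
  by rewrite dom_lift kx.
have [St dt] := dsecP Sx; rewrite /bis_map; set t := dsec S x in St dt *.
have sh := fibre_norm_supp (r t) fh.
rewrite -(fsbig_scale _ sh).
rewrite (@reindex_fsbig _ _ _ _ _ (fun k => gmul G k (ginv G (p t)))
  (gdom G @^-1` [set x]) (gdom G @^-1` [set r t])).
  apply: eq_fsbigr => k /set_mem /= kx.
  have lkx : d (tw_lift k) = x by rewrite dom_lift.
  rewrite conv_term_r// lkx asboolT// -/t normrM exprMn mulrC; congr (_ * _ ^+ 2).
  have -> : gmul G k (ginv G (p t)) = p (tw_lift k ** ginv _ t).
    by rewrite tw_projM ?grng_inv ?lkx// proj_lift proj_inv.
  by rewrite fibre_norm_eq.
have pt : gdom G (p t) = x by rewrite tw_dom_proj.
split.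
- by move=> k /= kx; rewrite gdom_mul ?grng_inv ?kx ?pt// gdom_inv tw_rng_proj.
- move=> k l /set_mem /= kx /set_mem /= lx e.
  have kt : gdom G k = gdom G (p t) by rewrite kx pt.
  have lt : gdom G l = gdom G (p t) by rewrite lx pt.
  by rewrite -(gmulgKV kt) e gmulgKV.
- move=> k /= kx; have kt : gdom G k = grng G (p t) by rewrite kx tw_rng_proj.
  exists (gmul G k (p t)); first by rewrite /= gdom_mul.
  exact: gmulgK.
Qed.

(** Left translation by a bisection is a partial permutation of the fibre over x: k |-> tau(k)^-1 k,
    with tau(k) the element of S that has the range of k, is injective where it is defined. *)
Lemma fibre_norm_conv_l S b g (M : C) x : compact_bisection S -> equivariant g ->
  fibre_finite g -> (forall y, `|b y| <= M) ->
  fibre_norm (convolution (Ccterm S b) g) x <= M ^+ 2 * fibre_norm g x.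
Proof.
move=> bS eg fg bM; rewrite !fibre_normE; have M0 : 0 <= M by apply: le_trans (bM x).
pose A := gdom G @^-1` [set x].
pose A' := A `&` [set k | exists2 t, S t & r t = grng G k].
have iS := cbis_dinj bS; have jS := cbis_rinj bS.
rewrite -(@fsbig_widen _ _ _ _ A' A)//; last 2 first.
- by move=> k [].
- move=> k [Ak nA'] /=; rewrite conv_term0 ?normr0 ?expr0n//.
  by move=> t St e; apply: nA'; split=> //; exists t; rewrite // e rng_lift.
have [tau htau] : exists tau : G -> Sigma, forall k, A' k -> S (tau k) /\ r (tau k) = grng G k.
  have h k : exists t, A' k -> S t /\ r t = grng G k.
    have [[_ [t St e]]|n] := pselect (A' k); first by exists t.
    by exists (gunit _ point) => /n.
  by have [tau ?] := choice h; exists tau.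
pose psi k := gmul G (ginv G (p (tau k))) k.
have psip k : A' k -> psi k = p (ginv _ (tau k) ** tw_lift k).
  by move=> /htau [_ e]; rewrite tw_projM ?proj_inv ?proj_lift// gdom_inv rng_lift.
have dpsi k : A' k -> gdom G (psi k) = x.
  move=> A'k; have [Sk ek] := htau k A'k.
  by rewrite gdom_mul ?gdom_inv ?tw_rng_proj//; case: A'k.
have sg := fibre_norm_supp x fg.
have -> : \sum_(k \in A') `|convolution (Ccterm S b) g (tw_lift k)| ^+ 2 =
    \sum_(k \in A') `|b (d (tau k))| ^+ 2 * `|g (tw_lift (psi k))| ^+ 2.
  apply: eq_fsbigr => k /set_mem A'k; have [Sk ek] := htau k A'k.
  rewrite (conv_term _ bS eg Sk) ?ek ?rng_lift// normrM exprMn; congr (_ * _ ^+ 2).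
  by rewrite psip// fibre_norm_eq.
have psi_inj k l : A' k -> A' l -> psi k = psi l -> k = l.
  move=> A'k A'l e; have [Sk ek] := htau k A'k; have [Sl el] := htau l A'l.
  have kk : grng G (p (tau k)) = grng G k by rewrite tw_rng_proj.
  have ll : grng G (p (tau l)) = grng G l by rewrite tw_rng_proj.
  have tt : tau k = tau l.
    apply: iS => //; have := congr1 (grng G) e.
    by rewrite !grng_mul ?gdom_inv// !grng_inv !tw_dom_proj.
  by rewrite -(gmulVKg kk) -(gmulVKg ll) -/(psi k) -/(psi l) e tt.
have fin1 : finite_set (A' `&` [set k | `|g (tw_lift (psi k))| ^+ 2 != 0]).
  apply: (@finite_set_inj_image _ _ _ _ psi _ sg).
    by move=> k l [A'k _] [A'l _]; exact: psi_inj.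
  by move=> _ [k [A'k /= nz] <-]; split=> //; exact: dpsi.
apply: (@le_trans _ _ (M ^+ 2 * \sum_(k \in A') `|g (tw_lift (psi k))| ^+ 2)).
  rewrite -fsbig_scale//; rewrite -[leLHS]ger0_norm; last first.
    by apply: fsbig_ge0 => k _; apply: mulr_ge0; exact: exprn_ge0.
  apply: fsbig_norm_le.
  - by apply: sub_finite_set fin1 => k [? /= nz]; split=> //=;
      apply: contraNneq nz => ->; rewrite mulr0.
  - by apply: sub_finite_set fin1 => k [? /= nz]; split=> //=;
      apply: contraNneq nz => ->; rewrite mulr0.
  - move=> k _; rewrite ger0_norm; last by apply: mulr_ge0; exact: exprn_ge0.
    by apply: ler_wpM2r; [exact: exprn_ge0|apply: lerXn2r; rewrite ?nnegrE].
apply: ler_wpM2l; first exact: exprn_ge0.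
rewrite -(@fsbig_image _ _ _ _ _ A' psi (fun k => `|g (tw_lift k)| ^+ 2)); last first.
  by move=> k l /set_mem ? /set_mem ?; exact: psi_inj.
by apply: fsbig_subset_le => // _ [k A'k <-]; exact: dpsi.
Qed.

End FibreSums.

(** * Measures on the reduction *)

Section Boundaries.
Variables (R : realType) (X : ptopologicalType) (mu : probability (borelType X) R).
Hypothesis nwd : forall N : set X, closed N -> nowhere_dense N -> mu N = 0%E.

Lemma boundary_negligible (U : set X) : open U ->
  mu.-negligible (closure U `\` U : set (borelType X)).
Proof.
move=> oU; have cN : closed (closure U `\` U).
  by rewrite setDE; apply: closedI; [exact: closed_closure|exact: open_closedC].
exists (closure U `\` U); split=> //; first exact: closed_borel.
apply: nwd => //; rewrite /nowhere_dense -(closure_id _).1//.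
apply/seteqP; split=> // x; rewrite /interior => /nbhs_openP [W [oW Wx] WN].
have [cl _] := WN x Wx; have [z [Uz Wz]] := cl W (open_nbhs_nbhs (conj oW Wx)).
by have [_] := WN z Wz.
Qed.

End Boundaries.

Section BorelSets.
Implicit Types T U : topologicalType.

Lemma borel_preimage T U (f : T -> U) (N : set U) : continuous f ->
  <<s @open U >> N -> <<s @open T >> (f @^-1` N).
Proof.
move=> cf; apply: (@smallest_sub _ _ _ (fun N => <<s @open T >> (f @^-1` N))).
  have [h0 hC hU] := smallest_sigma_algebra (@setT T) (@open T); split.
  - by rewrite preimage_set0.
  - by move=> A hA; rewrite setTD preimage_setC -setTD; exact: hC.
  - by move=> F hF; rewrite preimage_bigcup; exact: hU.
by move=> V oV; apply: sub_sigma_algebra; apply: open_comp => // ? _; exact: cf.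
Qed.

Lemma borel_setI T (A B : set T) : <<s @open T >> A -> <<s @open T >> B ->
  <<s @open T >> (A `&` B).
Proof.
have [h0 hC hU] := smallest_sigma_algebra (@setT T) (@open T) => hA hB.
have hC' D : <<s @open T >> D -> <<s @open T >> (~` D) by rewrite -setTD; exact: hC.
rewrite -(setCK (A `&` B)) setCI -bigcup2E; apply: (hC' _); apply: hU => -[|[|n]] /=.
- exact: hC'.
- exact: hC'.
- exact: h0.
Qed.

Lemma borel_within_preimage T (X : ptopologicalType) (D : set X) (f : X -> T) (A : set T) :
  open D -> {within D, continuous f} -> <<s @open T >> A ->
  measurable (D `&` f @^-1` A : set (borelType X)).
Proof.
move=> oD cf; have mD := open_borel oD.
apply: (@smallest_sub _ _ _ (fun A => measurable (D `&` f @^-1` A : set (borelType X)))).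
  split.
  - by rewrite preimage_set0 setI0; exact: measurable0.
  - move=> B mB; rewrite setTD preimage_setC.
    rewrite (_ : _ `&` _ = D `\` (D `&` f @^-1` B)); first exact: measurableD.
    by apply/seteqP; split=> x [Dx h]; split=> //; [case=> _|move=> ?; apply: h; split].
  - move=> F mF; rewrite preimage_bigcup setI_bigcupr; exact: bigcupT_measurable.
by move=> V oV; apply: open_borel; exact: within_preimage_open.
Qed.

End BorelSets.

Section QuasiInvariance.
Variables (R : realType) (X : ptopologicalType) (E : twisted_groupoid R X).
Variable mu : probability (borelType X) R.
Hypothesis cX : compact [set: X].
Hypothesis etE : local_homeomorphism (gdom (tw_base E)).
Hypothesis qi : quasi_invariant (tw_base E) mu.
Local Notation C := (cplx R).
Local Notation Sigma := (tw_ext E).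
Local Notation G := (tw_base E).
Local Notation r := (grng Sigma).
Local Notation d := (gdom Sigma).
Local Notation p := (tw_proj E).
Implicit Types (f g : Sigma -> C) (S : set Sigma) (b beta : X -> C) (x : X).

Lemma dom_proj_image S : gdom G @` (p @` S) = d @` S.
Proof. by rewrite image_comp; apply: eq_imagel => s _; exact: tw_dom_proj. Qed.

Lemma rng_proj_image S : grng G @` (p @` S) = r @` S.
Proof. by rewrite image_comp; apply: eq_imagel => s _; exact: tw_rng_proj. Qed.

Lemma cbis_proj S : compact_bisection S -> compact_bisection (p @` S).
Proof.
move=> bS; have [cS iS jS oS oS'] := (cbisP _ (tw_hausdorff E)).1 bS.
apply/(cbisP _ (tw_hausdorff E)); split.
- apply: continuous_compact => //; exact: continuous_within (@tw_proj_continuous _ _ E).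
- move=> _ _ [s Ss <-] [t St <-]; rewrite !tw_dom_proj => e.
  by rewrite (iS s t).
- move=> _ _ [s Ss <-] [t St <-]; rewrite !tw_rng_proj => e.
  by rewrite (jS s t).
- by rewrite dom_proj_image.
- by rewrite rng_proj_image.
Qed.

(** Quasi-invariance speaks of open bisections of G; that d is locally injective on G makes the
    projections of compact bisections of Sigma available for it. *)
Lemma open_proj S : compact_bisection S -> open (p @` S).
Proof.
move=> bS; have [oS _] := clopen_dom_image bS; have iS := cbis_dinj bS.
apply/openP => _ [s0 Ss0 <-].
have [Z [oZ Zs0 [injZ _ _] _]] := etE (p s0).
have oW := within_preimage_open oS
  (within_compT (dsec_continuous bS) (@tw_proj_continuous _ _ E)) oZ.
set W := _ `&` _ in oW.
exists (Z `&` gdom G @^-1` W); split.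
- by apply: openI => //; apply: open_comp => // ? _; exact: gdom_continuous.
- split=> //=; rewrite tw_dom_proj; split; first by exists s0.
  by rewrite /= dsecE.
- move=> g [Zg [/= Sg Zg']]; have [St dt] := dsecP Sg.
  exists (dsec S (gdom G g)) => //; apply: injZ; [exact: mem_set|exact: mem_set|].
  by rewrite tw_dom_proj.
Qed.

(** Quasi-invariance is applied to the part of p(S) with range in N: its range is null, and its
    domain is the set in question. *)
Lemma null_pullback S (N : set X) : compact_bisection S ->
  measurable (N : set (borelType X)) -> mu N = 0%E ->
  mu.-negligible ((d @` S) `&` bis_map S @^-1` N : set (borelType X)).
Proof.
move=> bS mN muN; have [oS _] := clopen_dom_image bS.
have mS := bis_map_measurable bS (open_borel oS) mN.
exists ((d @` S) `&` bis_map S @^-1` N); split=> //.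
have iS := cbis_dinj bS; have cp := cbis_proj bS; have op := open_proj bS.
have := qi op cp (A := (p @` S) `&` grng G @^-1` N).
have -> : gdom G @` (p @` S `&` grng G @^-1` N) = (d @` S) `&` bis_map S @^-1` N.
  apply/seteqP; split=> [_ [_ [[s Ss <-] /= Ns] <-]|x [Sx /= Nx]].
    rewrite tw_rng_proj in Ns; rewrite tw_dom_proj; split; first by exists s.
    by rewrite /= /bis_map dsecE.
  have [St dt] := dsecP Sx; exists (p (dsec S x)); last by rewrite tw_dom_proj.
  by split; [exists (dsec S x)|rewrite /= tw_rng_proj].
move=> h; apply/h.
- apply: borel_setI; first exact: sub_sigma_algebra.
  exact: borel_preimage (@grng_continuous _ G) mN.
- by move=> ? [].
have [_ _ _ _ orS] := (cbisP _ (tw_hausdorff E)).1 bS.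
have -> : grng G @` (p @` S `&` grng G @^-1` N) = (r @` S) `&` N.
  apply/seteqP; split=> [_ [_ [[s Ss <-] /= Ns] <-]|_ [[s Ss <-] Ns]].
    by rewrite tw_rng_proj in Ns *; split=> //; exists s.
  by exists (p s); [split; [exists s|rewrite /= tw_rng_proj]|rewrite tw_rng_proj].
apply/eqP; rewrite eq_le measure_ge0 andbT -muN.
apply: le_measure; [apply/mem_set|exact/mem_set|by move=> ? []].
by apply: measurableI => //; exact: open_borel.
Qed.

Lemma negligible_pullback S (N : set X) : compact_bisection S ->
  mu.-negligible (N : set (borelType X)) ->
  mu.-negligible ((d @` S) `&` bis_map S @^-1` N : set (borelType X)).
Proof.
move=> bS [N' [mN' muN' NN']].
by apply: negligibleS (null_pullback bS mN' muN') => x [? ?]; split=> //; exact: NN'.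
Qed.

(** The fibre sum at x sees the weight at the ranges of arrows over x. Quasi-invariance pulls the
    exceptional null set back along each of the finitely many bisections that carry g. *)
Lemma fibre_sum_weight_ae f g beta beta' : Cc E f -> Cc E g ->
  mu.-negligible [set x : borelType X | beta x <> beta' x] ->
  mu.-negligible [set x : borelType X |
    fibre_sum f (rweight beta g) x <> fibre_sum f (rweight beta' g) x].
Proof.
move=> Cf Cg neg; have ff := Cc_fibre_finite cX Cf; have ef := Cc_equivariant cX Cf.
move: g Cg; apply: (Cc_ind cX) => [|S b g bS cb Cg ih].
  by rewrite !rweight0; apply: negligibleS (negligible_set0 mu) => x /=.
have n1 := negligible_pullback bS neg.
apply: negligibleS (negligibleU n1 ih) => x /= ne.
have [e|ne'] := pselect (fibre_sum f (rweight beta g) x = fibre_sum f (rweight beta' g) x);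
  last by right.
left; rewrite !rweight_cons !fibre_sum_linear_r// e in ne.
rewrite !fibre_sum_term// in ne; move: ne; case: asboolP => [Sx ne|//].
by split=> //= eb; apply: ne; rewrite -/(bis_map S x) eb.
Qed.

End QuasiInvariance.

Section Comparison.
Variables (R : realType) (Y X : ptopologicalType).
Variables (F : twisted_groupoid R Y) (E : twisted_groupoid R X).
Variable m : multiplier_action F E.
Hypotheses (cX : compact [set: X]) (cY : compact [set: Y]).
Local Notation C := (cplx R).
Local Notation Lambda := (tw_ext F).
Local Notation act := (ma_act m).
Local Notation pi := (anchor m).

(* Injectivity of the map h |-> h x from the fibre of H over pi x to the fibre of
   G over x. *)
Definition free_at (x : X) := forall l k, gdom Lambda l = pi x -> gdom Lambda k = pi x ->
  tw_proj E (act l (gunit _ x)) = tw_proj E (act k (gunit _ x)) ->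
  tw_proj F l = tw_proj F k.

Lemma jtilde_free f l x : free_at x -> gdom Lambda l = pi x ->
  jtilde m f (act l (gunit _ x)) = f l.
Proof.
move=> fx lx; rewrite /jtilde dom_act_unit//.
rewrite (@fsbig_single _ _ _ _ l)//.
move=> k /= [kx ek] kl; exfalso; apply: kl.
apply: (@act_fibre_inj _ _ _ _ _ m (act l (gunit _ x))).
- by split; rewrite dom_act_unit.
- by split; rewrite dom_act_unit.
- by apply: fx => //; rewrite ek.
Qed.

(** At such a point h |-> h x embeds the fibre of H over pi x in the fibre of G over x; the images
    under [jtilde] reproduce f and g on the image of this embedding and vanish off it. *)
Lemma fibre_sum_jtilde f g (beta : Y -> C) x : Cc F f -> Cc F g -> free_at x ->
  fibre_sum (jtilde m f) (rweight (beta \o pi) (jtilde m g)) x =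
  fibre_sum f (rweight beta g) (pi x).
Proof.
move=> Cf Cg fx.
have ejf := Cc_equivariant cX (Cc_jtilde m cX cY Cf).
have ejg := Cc_equivariant cX (Cc_jtilde m cX cY Cg).
pose H := [set h | gdom (tw_base F) h = pi x].
have dl h : H h -> gdom Lambda (tw_lift h) = pi x by rewrite dom_lift.
pose phi h := tw_proj E (act (tw_lift h) (gunit _ x)).
rewrite /fibre_sum -(@fsbig_widen _ _ _ _ (phi @` H)); last 2 first.
- by move=> _ [h Hh <-]; rewrite /= /phi tw_dom_proj dom_act_unit// dl.
- move=> k [/= kx nk] /=; rewrite /jtilde -/(act_fibre m (tw_lift k)).
  rewrite [X in Num.conj X]fsbig1 ?rmorph0 ?mul0r// => l [lx lk].
  case: nk; rewrite dom_lift kx in lx lk.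
  exists (tw_proj F l); first by rewrite /H /= tw_dom_proj.
  have [c cc e] := lift_proj l.
  by rewrite /phi e act_scaleE ?grng_unit// proj_scale// lk proj_lift.
rewrite fsbig_image; last first.
  move=> h k /set_mem Hh /set_mem Hk e.
  by rewrite -(proj_lift h) -(proj_lift k); apply: fx => //; exact: dl.
apply: eq_fsbigr => h /set_mem Hh; have lx := dl h Hh.
have [c cc e] := lift_proj (act (tw_lift h) (gunit _ x)).
rewrite /phi e ejf// /rweight ejg// rng_scale//= anchor_rng_act ?grng_unit//.
rewrite !jtilde_free// rng_lift.
have -> : Num.conj (Num.conj c * f (tw_lift h)) = c * Num.conj (f (tw_lift h)).
  by rewrite [LHS](rmorphM (@Num.conj C)) /= conjCK.
by rewrite -[RHS](mul1r) -(circle_mulC cc); ring.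
Qed.

End Comparison.

Section ReducedMeasure.
Variables (R : realType) (X : ptopologicalType) (E : twisted_groupoid R X).
Variable A : reduction E.
Hypothesis cX : compact [set: X].
Hypothesis etE : local_homeomorphism (gdom (tw_base E)).
Variable mu : probability (borelType X) R.
Hypothesis qi : quasi_invariant (tw_base E) mu.
Local Notation T := (circle R).
Local Notation Sigma := (tw_ext E).
Local Notation G := (tw_base E).
Local Notation d := (gdom Sigma).
Local Notation p := (tw_proj E).
Local Notation S := (rd_S A).
Local Notation pi := (rd_pi A).
Local Notation Y := (rd_Y A).
Local Notation F := (rd_twist A cX etE).
Local Notation m := (rd_action A cX etE).
Local Notation AL := (ext_system A cX etE).
Local Notation AH := (base_system A cX etE).
Local Notation Lam := (slice_groupoid AL).
Local Notation H := (slice_groupoid AH).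

Lemma rd_compact : compact [set: Y].
Proof. exact: quot_compact. Qed.

Lemma anchor_rdE : anchor m = pi.
Proof. by apply/funext => x; exact: anchor_rd. Qed.

Lemma act_rd_unit (l : Lam) x i t y : chart AL i t y l -> pi x = y ->
  ma_act m l (gunit Sigma x) = tw_scale E t (dsec (S i) x) /\ S i (dsec (S i) x) /\
  d (dsec (S i) x) = x.
Proof.
move=> cl ex; have [tt Dy el] := cl.
have : (d @` S i) x by rewrite rd_dom /= ex.
move=> /dsecP [Ss ds]; split=> //.
have lg : aset l (tw_scale E t (dsec (S i) x)).
  by rewrite el ext_sliceE; exists (dsec (S i) x); rewrite ds.
rewrite [LHS](rd_actE lg) ?grng_unit ?dom_scale//.
by rewrite -[X in gunit _ X]ds -(dom_scale _ tt) gmulg1.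
Qed.

Hypothesis nwd : forall N : set X, closed N -> nowhere_dense N -> mu N = 0%E.

(** Let l and k, in charts i and j, have translates l x and k x above the same arrow of G. Then x is
    in the agreement set of S_i and S_j, hence, off a null boundary, in one of the clopen sets that
    exhaust it. This set is a union of fibres of pi, so the slices of p(S_i) and p(S_j) over pi x
    coincide. There are only countably many boundaries. *)
Lemma not_free_negligible : mu.-negligible [set x : borelType X | ~ free_at m x].
Proof.
pose e i j := sval (cid (rd_dense A i j)).
have eP i j : [/\ forall k, exists m, S m = gunit Sigma @` e i j k,
    forall k, e i j k `<=` ratio_set (S i) (S j) setT &
    ratio_set (S i) (S j) setT `<=` closure (\bigcup_k e i j k)].
  by rewrite /e; case: cid.
pose N i j := closure (\bigcup_k e i j k) `\` \bigcup_k e i j k.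
have oe i j : open (\bigcup_k e i j k).
  apply: bigcup_open => k _; have [h _ _] := eP i j; have [n en] := h k.
  by rewrite -(unit_e en); case: (e_clopen A n).
have N0 i j : mu.-negligible (N i j : set (borelType X)) by exact: boundary_negligible.
have NN : mu.-negligible (\bigcup_i \bigcup_j N i j : set (borelType X)).
  by apply: negligible_bigcup => i; apply: negligible_bigcup => j; exact: N0.
apply: negligibleS NN => x /= nf; apply: contrapT => nN; apply: nf => l k lx kx ep.
have [i [t [y cl]]] := chart_ex (l : slice_arrow AL).
have [j [s [z ck]]] := chart_ex (k : slice_arrow AL).
rewrite anchor_rdE in lx kx.
have ey : pi x = y by rewrite -(chart_adom cl); exact: esym lx.
have ez : pi x = z by rewrite -(chart_adom ck); exact: esym kx.
subst y z.
have [el [Sl dl]] := act_rd_unit cl erefl; have [ek [Sk dk]] := act_rd_unit ck erefl.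
have tt : T t by case: cl.
have ts : T s by case: ck.
rewrite el ek !proj_scale// in ep.
have rx : ratio_set (S i) (S j) setT x by rewrite -dl; exact: ratio_proj ep.
have [h1 h2 h3] := eP i j.
have [n _ nx] : (\bigcup_n e i j n) x.
  apply: contrapT => ne; apply: nN; exists i => //; exists j => //.
  by split=> //; exact: h3.
have [u eu] := h1 n; have eun := unit_e eu.
apply: (@aset_inj _ _ _ _ AH).
have -> : aset (tw_proj F l : H) = base_slice i t (pi x) by exact: proj_chart cl.
have -> : aset (tw_proj F k : H) = base_slice j s (pi x) by exact: proj_chart ck.
have fib w : pi w = pi x -> ratio_set (S i) (S j) setT w.
  by move=> ew; apply: (h2 n); rewrite -eun; apply: (qpi_sat (esym ew)); rewrite eun.
have [tw_i tw_j] : (forall v, S i v -> pi (d v) = pi x -> exists2 w, S j w & p w = p v) /\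
    (forall w, S j w -> pi (d w) = pi x -> exists2 v, S i v & p w = p v).
  split=> [v Sv dv|w Sw dw].
    have [v' [c [Sv' dv' tc _ Sc]]] := fib _ dv.
    have ev : v' = v by exact: (S_dinj Sv' Sv).
    by subst v'; exists (tw_scale E c v) => //; exact: proj_scale.
  have [v [c [Sv dv tc _ Sc]]] := fib _ dw.
  exists v => //; rewrite -(proj_scale v tc); congr p.
  by apply: (S_dinj Sw Sc); rewrite dom_scale.
apply/seteqP; split=> [g [g' [[v Sv eg] dv ->]]|g [g' [[w Sw eg] dv ->]]]; subst g';
  rewrite tw_dom_proj in dv.
  have [w Sw ew] := tw_i v Sv dv; exists (p v); rewrite tw_dom_proj; split=> //.
  by exists w.
have [v Sv ew] := tw_j w Sw dv; exists (p w); rewrite tw_dom_proj; split=> //.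
by exists v.
Qed.

(** Images of Borel sets need not be Borel in general; here the chart has a continuous section over
    D_i, and the image is a preimage under this section. *)
Lemma chart_part_dom_borel (B : set H) i : <<s @open H >> B ->
  measurable (gdom H @` (B `&` chart_set AH i) : set (borelType Y)).
Proof.
move=> bB; have oD := rd_D_open A i.
have [[l0 _]|h0] := pselect ([set: H] !=set0); last first.
  rewrite (_ : _ @` _ = set0); first exact: measurable0.
  by apply/seteqP; split=> // y [l hl _]; apply: h0; exists l.
pose c (y : Y) : H := xget l0 [set l | chart AH i 1 y l].
have cE y : rd_D i y -> chart AH i 1 y (c y).
  move=> Dy; rewrite /c; case: xgetP => [? _ //|] /=.
  by have [l cl] := @chart_mk _ _ _ _ AH i 1 y (circle1 R) Dy => /(_ l).
have cc : {within rd_D i, continuous c}.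
  apply/withinP => y V Dy oV Vy.
  have [W [N [oW oN Wy N1 h]]] := oV _ _ _ _ (cE y Dy) Vy.
  by exists W; split=> // z Wz Dz; apply: (h z 1) => //; exact: cE.
rewrite (_ : _ @` _ = rd_D i `&` c @^-1` B).
  exact: borel_within_preimage.
apply/seteqP; split=> [_ [l [Bl [t [y cl]]] <-]|y [Dy By]].
  have [_ Dy el] := cl; have ey : gdom H l = y by exact: chart_adom cl.
  split; rewrite ey//=; suff -> : c y = l by [].
  apply: (@aset_inj _ _ _ _ AH); have [_ _ ->] := cE y Dy; rewrite el.
  exact: base_sliceE.
exists (c y); last by apply: chart_adom; exact: cE.
by split=> //; exists 1, y; exact: cE.
Qed.

Lemma chart_inv_set i j : S j = ginv Sigma @` S i ->
  (ginv H) @^-1` chart_set AH j = chart_set AH i.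
Proof.
move=> ej.
have ej' : ss_S AH j = ginv G @` ss_S AH i.
  by rewrite /= /base_S ej !image_comp; apply: eq_imagel => s _; exact: proj_inv.
have ei' : ss_S AH i = ginv G @` ss_S AH j.
  rewrite ej' image_comp -[LHS]image_id; apply: eq_imagel => g _ /=.
  by rewrite ginvK.
apply/seteqP; split=> l [t [y cl]].
  exists (Num.conj t), (arng (ginv H l : slice_arrow AH)).
  by have := chart_inv cl ei'; rewrite ainvK.
exists (Num.conj t), (arng (l : slice_arrow AH)).
exact: chart_inv cl ej'.
Qed.

Lemma chart_part_rng_borel (B : set H) i : <<s @open H >> B ->
  measurable (grng H @` (B `&` chart_set AH i) : set (borelType Y)).
Proof.
move=> bB; have [j ej] := rd_inv A i.
rewrite (_ : _ @` _ = gdom H @` (ginv H @^-1` B `&` chart_set AH j)).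
  by apply: chart_part_dom_borel; exact: borel_preimage (@ginv_continuous _ H) bB.
have ei := chart_inv_set ej.
apply/seteqP; split=> _ [l [Bl cl] <-].
  exists (ginv H l); last exact: gdom_inv.
  split; first by rewrite /preimage /mkset ginvK.
  by rewrite -ei in cl.
exists (ginv H l); last exact: grng_inv.
by split=> //; rewrite -ei /preimage /mkset ginvK.
Qed.

(** Both sets come from one Borel part of the bisection p(S_i) of G, its restriction to the preimage
    of D: one is its range, the other its domain, and quasi-invariance of [mu] on G compares
    them. *)
Lemma chart_part_quasi (B : set H) i : <<s @open H >> B ->
  mu (pi @^-1` (grng H @` (B `&` chart_set AH i))) = 0%E <->
  mu (pi @^-1` (gdom H @` (B `&` chart_set AH i))) = 0%E.
Proof.
move=> bB; have bS := rd_cbis A i; set D := gdom H @` _.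
have mD : measurable (D : set (borelType Y)) by exact: chart_part_dom_borel.
have DD y : D y -> rd_D i y.
  move=> [l [_ [t [z cl]]] <-]; have -> : gdom H l = z by exact: chart_adom cl.
  by case: cl.
pose B' : set G := (p @` S i) `&` gdom G @^-1` (pi @^-1` D).
have bB' : <<s @open G >> B'.
  apply: borel_setI; first by apply: sub_sigma_algebra; exact: open_proj.
  apply: borel_preimage (@gdom_continuous _ G) _.
  exact: borel_preimage (rd_pi_continuous (A := A)) mD.
have := qi (open_proj etE bS) (cbis_proj bS) bB' (fun _ h => h.1).
have -> : gdom G @` B' = pi @^-1` D.
  apply/seteqP; split=> [_ [g [_ Dg] <-]//|x Dx].
  have [s [Ss ds]] := rd_D_full (DD _ Dx) erefl.
  exists (p s); last by rewrite tw_dom_proj.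
  by split; [exists s|rewrite /preimage /mkset tw_dom_proj ds].
suff -> : grng G @` B' = pi @^-1` (grng H @` (B `&` chart_set AH i)) by [].
apply/seteqP; split=> [_ [_ [[s Ss <-] [l [Bl cl] dl]] <-]|x [l [Bl [t [y cl]]] lx]].
  exists l => //; have [t [y cl']] := cl; have [_ _ el] := cl'.
  rewrite tw_rng_proj -(tw_rng_proj s); apply/esym.
  apply: (@arngE _ _ _ _ AH); rewrite el; exists (p s); split=> //; first by exists s.
  by rewrite -(chart_adom cl'); exact: esym dl.
have xr : ss_pi AH x = adom (ginv H l : slice_arrow AH).
  by rewrite -[adom _]/(gdom H (ginv H l)) gdom_inv lx.
have [_ [[g lg <-]]] := @arrow_dfull _ _ _ _ AH _ _ xr; rewrite gdom_inv => gx.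
have [_ _ el] := cl; move: (lg); rewrite el => -[_ [[s Ss <-] ds eg]]; subst g.
exists (p s) => //; split; first by exists s.
exists l; first by split=> //; exists t, y.
rewrite -[RHS]/(ss_pi AH (gdom G (p s))) ds; exact: chart_adom cl.
Qed.

Lemma rd_quasi_invariant :
  quasi_invariant (tw_base F) (pushforward mu (anchor m : borelType X -> borelType Y)).
Proof.
move=> S0 _ _ B bB _; rewrite anchor_rdE /pushforward.
(* Countably many charts cover H, so nullity can be tested chart by chart. *)
have cover (f : H -> Y) : f @` B = \bigcup_i f @` (B `&` chart_set AH i).
  apply/seteqP; split=> [_ [l Bl <-]|y [i _ [l [Bl _] <-]]]; last by exists l.
  have [i [t [y cl]]] := chart_ex (l : slice_arrow AH).
  by exists i => //; exists l => //; split=> //; exists t, y.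
have mpi := continuous_borel (@rd_pi_continuous _ _ _ A).
have mpre (D : set Y) : measurable (D : set (borelType Y)) ->
    measurable (pi @^-1` D : set (borelType X)).
  by move=> mD; rewrite -[X in measurable X]setTI; exact: mpi.
have key (D : nat -> set Y) : (forall i, measurable (D i : set (borelType Y))) ->
    mu (pi @^-1` (\bigcup_i D i)) = 0%E <-> forall i, mu (pi @^-1` D i) = 0%E.
  move=> mD; have mU : measurable (\bigcup_i D i : set (borelType Y)) by exact: bigcupT_measurable.
  split=> [h i|h].
    apply/eqP; rewrite eq_le measure_ge0 andbT -h.
    apply: le_measure; [exact: mem_set (mpre _ (mD i))|exact: mem_set (mpre _ mU)|].
    by move=> x Dx; exists i.
  rewrite preimage_bigcup; apply/negligibleP.
    by apply: bigcupT_measurable => i; exact: (mpre _ (mD i)).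
  by apply: negligible_bigcup => i; apply/negligibleP; [exact: (mpre _ (mD i))|exact: h].
rewrite (cover (grng H)) (cover (gdom H)) !key.
- split=> h i; have [q1 q2] := chart_part_quasi i bB; [exact: (q1 (h i))|exact: (q2 (h i))].
- by move=> i; exact: chart_part_dom_borel.
- by move=> i; exact: chart_part_rng_borel.
Qed.

End ReducedMeasure.

(** * Hilbert spaces *)

Section RealNorm.
Variable R : realType.
Local Notation C := (cplx R).
Local Notation ReC z := (complex.Re (z : R[i])).
Implicit Types (V W : normedModType C) (a : C).

(* The norm of a normed space over C takes its values in C. *)
Definition rnorm V (x : V) : R := ReC `|x|.

Lemma rnormE V (x : V) : `|x| = (rnorm x)%:C%C :> C.
Proof. by have /RRe_real -> : `|x| \is Num.real by rewrite normr_real. Qed.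

Lemma rnorm_ge0 V (x : V) : 0 <= rnorm x.
Proof. by rewrite -lecR -rnormE normr_ge0. Qed.

Lemma rnormD V (x y : V) : rnorm (x + y) <= rnorm x + rnorm y.
Proof. by rewrite -lecR rmorphD /= -!rnormE ler_normD. Qed.

Lemma rnormZ V a (x : V) : rnorm (a *: x) = ReC `|a| * rnorm x.
Proof.
by apply/complexI; rewrite rmorphM /= -!rnormE normrZ; congr (_ * _); exact: rnormE.
Qed.

Lemma Re_norm_ge0 a : 0 <= ReC `|a|.
Proof. exact: (rnorm_ge0 a). Qed.

Lemma rnormN V (x : V) : rnorm (- x) = rnorm x.
Proof. by rewrite /rnorm normrN. Qed.

Lemma rnorm0 V : rnorm (0 : V) = 0.
Proof. by rewrite /rnorm normr0. Qed.

Lemma rnorm_eq0 V (x : V) : rnorm x <= 0 -> x = 0.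
Proof.
by rewrite -lecR -rnormE => h; apply/eqP; rewrite -normr_eq0 eq_le h normr_ge0.
Qed.

Lemma rnormB V (x y : V) : rnorm (x - y) = rnorm (y - x).
Proof. by rewrite -rnormN opprB. Qed.

Lemma rnorm_triangle V (y x z : V) : rnorm (x - z) <= rnorm (x - y) + rnorm (y - z).
Proof. by rewrite -{1}(subrK y x) -addrA; exact: rnormD. Qed.

Lemma rnorm_lt V (x : V) (e : R) : (`|x| < e%:C%C :> C) = (rnorm x < e).
Proof. by rewrite rnormE ltcR. Qed.

Lemma rnorm_dense V (A : set V) : dense A ->
  forall x (e : R), 0 < e -> exists2 a, A a & rnorm (x - a) < e.
Proof.
move=> dA x e e0.
have [|a [/= xa Aa]] := dA [set y | `|x - y| < e%:C%C] _ (open_norm_ball x _).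
  by exists x; rewrite /= subrr normr0 ltcR.
by exists a => //; rewrite -rnorm_lt.
Qed.

Lemma dense_rnorm V (A : set V) :
  (forall x (e : R), 0 < e -> exists2 a, A a & rnorm (x - a) < e) -> dense A.
Proof.
move=> h O [x Ox] oO; have [_ /gt0_cplxE [e e0 ->] eO] := open_norm_ballP oO Ox.
by have [a Aa xa] := h x e e0; exists a; split=> //; apply: eO; rewrite rnorm_lt.
Qed.

Lemma rnorm_continuous V W (f : V -> W) : continuous f ->
  forall x (e : R), 0 < e -> exists2 d : R, 0 < d &
    forall z, rnorm (x - z) < d -> rnorm (f x - f z) < e.
Proof.
move=> cf x e e0.
have oB : open (f @^-1` [set y | `|f x - y| < e%:C%C]).
  by apply: open_comp (open_norm_ball _ _) => ? _; exact: cf.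
have [|_ /gt0_cplxE [d d0 ->] dB] := open_norm_ballP oB (x := x).
  by rewrite /= subrr normr0 ltcR.
by exists d => // z xz; rewrite -rnorm_lt; apply: dB; rewrite rnorm_lt.
Qed.

Lemma lipschitz_continuous V W (f : V -> W) (M : R) :
  (forall x y, rnorm (f x - f y) <= M * rnorm (x - y)) -> continuous f.
Proof.
move=> h; apply: continuous_norm_intro => x _ /gt0_cplxE [e e0 ->].
have M0 : 0 < `|M| + 1 by have := normr_ge0 M; lra.
exists [set y | `|x - y| < (e / (`|M| + 1))%:C%C]; split; first exact: open_norm_ball.
  by rewrite /= subrr normr0 ltcR divr_gt0.
move=> z /=; rewrite !rnorm_lt ltr_pdivlMr// => xz; apply: le_lt_trans (h x z) _.
apply: le_lt_trans xz; rewrite mulrC ler_wpM2l ?rnorm_ge0//.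
by have := ler_norm M; lra.
Qed.

Section LinearProp.
Variables (V W : normedModType C) (f : V -> W).
Hypothesis lf : linear f.

Lemma linear_prop0 : f 0 = 0.
Proof. by have := lf (-1) 0 0; rewrite scaler0 addr0 scaleN1r addNr. Qed.

Lemma linear_propD x y : f (x + y) = f x + f y.
Proof. by have := lf 1 x y; rewrite !scale1r. Qed.

Lemma linear_propZ a x : f (a *: x) = a *: f x.
Proof. by have := lf a x 0; rewrite linear_prop0 !addr0. Qed.

Lemma linear_propB x y : f (x - y) = f x - f y.
Proof. by rewrite linear_propD -scaleN1r linear_propZ scaleN1r. Qed.

End LinearProp.

Lemma continuous_linear_le V W (f : V -> W) : linear f -> continuous f ->
  exists2 k : R, 0 <= k & forall x, rnorm (f x) <= k * rnorm x.
Proof.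
move=> lf cf; have [d d0 hd] := rnorm_continuous cf 0 (ltr01 : 0 < 1 :> R).
have f0 := linear_prop0 lf.
(* A non-zero vector is rescaled to norm d/2, inside the ball of radius d that f maps into the unit
   ball. *)
exists (2 / d) => [|x]; first by rewrite divr_ge0// ltW.
have [xN|x0] := leP (rnorm x) 0; first by rewrite (rnorm_eq0 xN) f0 !rnorm0 mulr0.
pose t := d / 2 / rnorm x; have t0 : 0 < t by rewrite !divr_gt0.
have nt : ReC `|t%:C%C : C| = t.
  by rewrite ger0_norm// ler0c ltW.
have tx : t * rnorm x = d / 2 by rewrite /t divfK// gt_eqF.
have := hd (t%:C%C *: x); rewrite f0 !sub0r !rnormN (linear_propZ lf) !rnormZ nt tx => /(_ _)/ltW h.
have {h} : t * rnorm (f x) <= 1 by apply: h; lra.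
rewrite -(ler_pM2l t0 (rnorm (f x))) mulrCA tx => h; apply: le_trans h _.
by rewrite mulrA divfK ?gt_eqF// divff.
Qed.

Lemma continuous_dense_eq V W (f g : V -> W) (A : set V) : continuous f -> continuous g ->
  dense A -> (forall v, A v -> f v = g v) -> f = g.
Proof.
move=> cf cg dA fg; apply/funext => x; apply/eqP; rewrite -subr_eq0; apply/eqP.
apply: rnorm_eq0; rewrite leNgt; apply/negP => n0.
have n2 : 0 < rnorm (f x - g x) / 2 by rewrite divr_gt0.
have [d1 d10 h1] := rnorm_continuous cf x n2.
have [d2 d20 h2] := rnorm_continuous cg x n2.
have d0 : 0 < Num.min d1 d2 by rewrite lt_min d10.
have [a Aa] := rnorm_dense dA x d0; rewrite lt_min => /andP[/h1 k1 /h2 k2].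
rewrite (fg a Aa) in k1; rewrite rnormB in k2.
have := rnorm_triangle (g a) (f x) (g x); move: k1 k2.
by move: (rnorm _) (rnorm _) (rnorm _) => u v w; lra.
Qed.

End RealNorm.

Section Extension.
Variable R : realType.
Local Notation C := (cplx R).
Local Notation ReC z := (complex.Re (z : R[i])).
Variables V W : completeNormedModType C.
Variables (P : set (V * W)) (M : R).
Hypothesis Plin : forall (a : C) p q, P p -> P q ->
  P (a *: p.1 + q.1, a *: p.2 + q.2).
Hypothesis Pbound : forall p, P p -> rnorm p.2 <= M * rnorm p.1.
Hypothesis Pdense : dense (fst @` P).

Let Q x y := forall e : R, 0 < e ->
  exists p, [/\ P p, rnorm (x - p.1) < e & rnorm (y - p.2) < e].

Let Q_P p : P p -> Q p.1 p.2.
Proof. by move=> Pp e e0; exists p; rewrite !subrr !rnorm0. Qed.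

Let Q_linear (a : C) x y x' y' : Q x y -> Q x' y' -> Q (a *: x + x') (a *: y + y').
Proof.
move=> h h' e e0; pose k := ReC `|a|; have k0 : 0 <= k by exact: Re_norm_ge0.
have e1 : 0 < e / (k + 2) by rewrite divr_gt0//; lra.
have [p [Pp p1 p2]] := h _ e1; have [q [Pq q1 q2]] := h' _ e1.
have ke : k * (e / (k + 2)) + e / (k + 2) < e.
  have : e / (k + 2) * (k + 2) = e by rewrite divfK//; lra.
  by move: e1; move: (_ / _) => t; nra.
have key (U : normedModType C) (u v u' v' : U) : rnorm (u - v) < e / (k + 2) ->
    rnorm (u' - v') < e / (k + 2) -> rnorm (a *: u + u' - (a *: v + v')) < e.
  move=> l1 l2; rewrite opprD addrACA -scalerBr; apply: le_lt_trans (rnormD _ _) _.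
  rewrite rnormZ; apply: le_lt_trans ke; apply: lerD (ltW l2).
  by rewrite ler_wpM2l// ltW.
by exists (a *: p.1 + q.1, a *: p.2 + q.2); split; [exact: Plin|exact: key|exact: key].
Qed.

Let Q_bound x y : Q x y -> rnorm y <= M * rnorm x.
Proof.
move=> h; rewrite leNgt; apply/negP => lt0.
have e0 : 0 < (rnorm y - M * rnorm x) / (`|M| + 2) by rewrite divr_gt0//; lra.
have [p [Pp p1 p2]] := h _ e0; set e := _ / _ in e0 p1 p2.
have ee : e * (`|M| + 2) = rnorm y - M * rnorm x by rewrite /e divfK//; lra.
have b := Pbound Pp.
have y1 := rnormD (y - p.2) p.2; rewrite subrK in y1.
have x1 := rnormD (x - p.1) p.1; rewrite subrK in x1.
have x2 := rnormD (p.1 - x) x; rewrite subrK rnormB in x2.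
move: b y1 x1 x2 p1 p2 ee e0 (ler_norm M) (lerNnormlW (lexx `|M|)).
move: (rnorm_ge0 p.1) (rnorm_ge0 x).
move: (rnorm _) (rnorm _) (rnorm _) (rnorm _) (rnorm _) (rnorm _).
by move=> *; nra.
Qed.

Let Q_fun x y y' : Q x y -> Q x y' -> y = y'.
Proof.
move=> h h'; apply/eqP; rewrite -subr_eq0; apply/eqP; apply: rnorm_eq0.
have := Q_bound (Q_linear (-1) h h'); rewrite !scaleN1r !(addrC (- _)) subrr rnorm0.
by rewrite mulr0 rnormB.
Qed.

(** The values v of P at points u near x generate a Cauchy filter, by linearity and the bound M;
    completeness of W provides its limit. *)
Let Q_total x : exists y, Q x y.
Proof.
pose F : set_system W := fun A => \forall u \near x, forall v, P (u, v) -> A v.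
have near_ex (A : set V) : nbhs x A -> exists p, P p /\ A p.1.
  move=> /nbhs_normP [_ /gt0_cplxE [e e0 ->] eA].
  have [_ [p Pp <-] xp] := rnorm_dense Pdense x e0.
  by exists p; split=> //; apply: eA; rewrite /= rnorm_lt.
have FF : ProperFilter F.
  split; last split.
  - by move=> /near_ex [[u v] [Pp /(_ v Pp)]].
  - by apply: nearW.
  - move=> A B FA FB; apply: (@filterS2 _ (nbhs x) _ _ _ _ _ FA FB) => u a b v Pv.
    by split; [exact: a|exact: b].
  - move=> A B AB FA; apply: (@filterS _ (nbhs x) _ _ _ _ FA) => u a v Pv.
    by apply: AB; exact: a.
have ball_x (e : R) : 0 < e -> nbhs x [set u | rnorm (x - u) < e].
  move=> e0; have := open_nbhs_nbhs (conj (open_norm_ball x e%:C%C) _ : open_nbhs x _).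
  rewrite /= subrr normr0 ltcR => /(_ e0); apply: filterS => u.
  by rewrite /= rnorm_lt.
have cF : cauchy F.
  apply: cauchy_exP => _ /gt0_cplxE [e e0 ->].
  have d0 : 0 < e / 2 / (`|M| + 1) by rewrite !divr_gt0//; lra.
  have [p [Pp xp]] := near_ex _ (ball_x _ d0); exists p.2.
  apply: filterS (ball_x _ d0) => u xu v Puv; rewrite -ball_normE /= rnorm_lt.
  have := Pbound (Plin (-1) Puv Pp); rewrite /= !scaleN1r !(addrC (- _)).
  set d := _ / _ in d0 xp xu; have ed : d * (`|M| + 1) = e / 2 by rewrite /d divfK//; lra.
  have := rnorm_triangle x p.1 u; rewrite (rnormB p.1 x) => t b; apply: le_lt_trans b _.
  rewrite /mkset in xp xu.
  have h1 : M * rnorm (p.1 - u) <= `|M| * rnorm (p.1 - u).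
    by rewrite ler_wpM2r ?rnorm_ge0// ler_norm.
  have h2 : `|M| * rnorm (p.1 - u) <= `|M| * (d + d) by rewrite ler_wpM2l//; lra.
  by have -> : e = `|M| * (d + d) + (d + d); lra.
have [y Fy] : exists y : W, F --> y by exists (lim F); exact: cauchy_cvg cF.
exists y => e e0.
have : F [set v | rnorm (y - v) < e].
  apply: Fy; apply: filterS (open_nbhs_nbhs (conj (open_norm_ball y e%:C%C) _)).
    by move=> v; rewrite /= rnorm_lt.
  by rewrite /= subrr normr0 ltcR.
move=> Fe; have [p [Pp [h1 h2]]] := near_ex _ (@filterI _ (nbhs x) _ _ _ Fe (ball_x e e0)).
by exists p; split=> //; apply: h1; case: (p) Pp.
Qed.

(* The closure of P is the graph of L. *)
Lemma extension_exists : exists L : {linear V -> W},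
  [/\ continuous L, forall p, P p -> L p.1 = p.2 & forall x, rnorm (L x) <= M * rnorm x].
Proof.
pose L x := sval (cid (Q_total x)); have QL x : Q x (L x) by rewrite /L; case: cid.
have linL : linear L by move=> a x y; apply: Q_fun (Q_linear a (QL x) (QL y)).
pose aL := GRing.isLinear.Build C V W *:%R L linL.
pose LL : {linear V -> W} := HB.pack L aL.
exists LL; split.
- apply: (@lipschitz_continuous _ _ _ _ M) => x y; rewrite -linearB; exact: Q_bound.
- by move=> p Pp; apply: Q_fun (QL _) (Q_P Pp).
- by move=> x; exact: Q_bound.
Qed.

End Extension.

Section SeparableFamily.
Variable R : realType.
Local Notation C := (cplx R).

(** Separability passes to subsets: for each point of a dense sequence and each radius 1/(k+1), one
    member of P that close to the point is chosen if there is any. Indices rather than vectors are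
    enumerated, because the data (S, b) behind a class are wanted. *)
Lemma separable_family (V : normedModType C) (I : Type) (P : set I) (c : I -> V) :
  separable_space V -> P !=set0 -> exists u : nat -> I, (forall n, P (u n)) /\
    forall i (e : R), P i -> 0 < e -> exists n, rnorm (c i - c (u n)) < e.
Proof.
move=> [D cD dD] [i0 Pi0].
have [g gD] : exists g : nat -> V, D `<=` range g.
  have /countable_injP [f injf] := cD.
  exists (fun n => xget 0 [set x | D x /\ f x = n]) => x Dx; exists (f x) => //.
  case: xgetP => [y _ [Dy fy]|/(_ x)]; last by case.
  by apply: injf; rewrite ?inE //; exact: mem_set.
pose ok (nk : nat * nat) i := P i /\ rnorm (g nk.1 - c i) < nk.2.+1%:R^-1.
pose v nk : I := match pselect (exists i, ok nk i) with
  | left h => sval (cid h) | right _ => i0 end.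
have Pv nk : P (v nk) by rewrite /v; case: pselect => // h; case: cid => i [].
exists (fun n => if choice.unpickle n is Some nk then v nk else i0); split=> [n|i e Pi e0].
  by case: choice.unpickle.
have [k ke] : exists k : nat, k.+1%:R^-1 < e / 2.
  by have [k _ /(_ k (leqnn k))] := near_infty_natSinv_lt (PosNum (divr_gt0 e0 (ltr0n R 2))); exists k.
have k0 : (0 : R) < k.+1%:R^-1 by rewrite invr_gt0.
have [d Dd id] := rnorm_dense dD (c i) k0; have [n _ gn] := gD d Dd.
have okv : ok (n, k) (v (n, k)).
  rewrite /v; case: pselect => [h|[]]; first by case: cid.
  by exists i; split=> //=; rewrite gn rnormB.
exists (choice.pickle (n, k)); rewrite choice.pickleK.
have [_ /= h] := okv; rewrite gn in h.
have := rnorm_triangle d (c i) (c (v (n, k))).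
move: id h ke k0; move: (_^-1) (rnorm _) (rnorm _) (rnorm _) => *; lra.
Qed.

End SeparableFamily.

Section HilbertSpaces.
Variables (R : realType).
Local Notation C := (cplx R).
Local Notation ReC z := (complex.Re (z : R[i])).
Implicit Types K : hilbert_space R.

Lemma hdotC K (x y : K) : hdot K x y = Num.conj (hdot K y x).
Proof. by rewrite hermC expr0 mul1r. Qed.

Lemma hdot_linear_r K (a : C) (x y z : K) :
  hdot K z (a *: x + y) = Num.conj a * hdot K z x + hdot K z y.
Proof. by rewrite linearPr. Qed.

Lemma hdotBl K (x y z : K) : hdot K (x - y) z = hdot K x z - hdot K y z.
Proof. by rewrite linearBl. Qed.

Lemma hdotBr K (x y z : K) : hdot K z (x - y) = hdot K z x - hdot K z y.
Proof. by rewrite linearBr. Qed.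

Lemma rnorm_sq K (x : K) : ((rnorm x ^+ 2)%:C)%C = hdot K x x.
Proof. by rewrite rmorphXn /= -rnormE hnormE. Qed.

Lemma hdot_CauchySchwarz K (x y : K) : ReC `|hdot K x y| <= rnorm x * rnorm y.
Proof.
set z := hdot K x y; have [y0|yN0] := eqVneq y 0.
  by rewrite /z y0 linear0r normr0 mulr_ge0 ?rnorm_ge0.
pose s := hdot K y y; have s0 : 0 < s by rewrite dnorm_gt0.
have sr : Num.conj s = s by rewrite [RHS]hdotC.
have sN0 : s != 0 by rewrite gt_eqF.
have := dnorm_ge0 (hdot K) (x - (z / s) *: y).
have cM (u v : C) : Num.conj (u * v) = Num.conj u * Num.conj v.
  exact: (rmorphM (@Num.conj C)).
have sV : Num.conj s^-1 = s^-1 by rewrite -[in RHS]sr; exact: (fmorphV (@Num.conj C)).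
have e1 : hdot K x ((z / s) *: y) = `|z| ^+ 2 / s.
  rewrite -[X in hdot K x X]addr0 hdot_linear_r linear0r addr0 cM sV normCK -/z; ring.
have e2 : Num.conj (`|z| ^+ 2 / s) = `|z| ^+ 2 / s.
  by rewrite cM sV normCK cM conjCK (mulrC z).
rewrite dnormB dnormZ e1 e2.
rewrite normrM normfV (gtr0_norm s0) -(rnorm_sq x).
have -> : (`|z| / s) ^+ 2 * s = `|z| ^+ 2 / s by field.
rewrite opprD addrA addrK subr_ge0 ler_pdivrMr// /s -rnorm_sq.
have -> : `|z| = (ReC `|z|)%:C%C :> C by exact: (rnormE (z : C)).
rewrite -rmorphXn -rmorphM /= lecR -exprMn ler_sqr ?nnegrE ?mulr_ge0 ?rnorm_ge0//.
exact: (rnorm_ge0 (z : C)).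
Qed.

(** Polarisation: the norm of x + y gives the real part, and i x in place of x gives the imaginary
    part. *)
Lemma isometry_hdot K K' (J : {linear K -> K'}) : (forall x, rnorm (J x) = rnorm x) ->
  forall x y, hdot K' (J x) (J y) = hdot K x y.
Proof.
move=> iso; have sq x : hdot K' (J x) (J x) = hdot K x x by rewrite -!rnorm_sq iso.
have re x y : ReC (hdot K' (J x) (J y)) = ReC (hdot K x y).
  have := sq (x + y); rewrite linearD !dnormD !sq => /addrI.
  by case: (hdot K' _ _) (hdot K _ _) => a b [c d] /= [e]; lra.
move=> x y; apply: cplx_eq; first exact: re.
have := re (('i : C) *: x) y; rewrite linearZ !linearZl_LR /=.
by case: (hdot K' _ _) (hdot K _ _) => a b [c d] /=; lra.
Qed.

End HilbertSpaces.

Section Completion.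
Variables (R : realType) (X : ptopologicalType) (E : twisted_groupoid R X).
Hypothesis cX : compact [set: X].
Hypothesis etE : local_homeomorphism (gdom (tw_base E)).
Variable mu : probability (borelType X) R.
Variable K : L2_completion E mu.
Local Notation C := (cplx R).
Local Notation ReC z := (complex.Re (z : R[i])).
Local Notation Sigma := (tw_ext E).
Local Notation cls := (L2_class K).
Local Notation int F := (cintegral mu F).
Implicit Types (f g h : Sigma -> C) (S : set Sigma) (b beta : X -> C).

Lemma bounded_real b : (exists M : C, forall x, `|b x| <= M) ->
  exists2 M : R, 0 <= M & forall x, `|b x| <= M%:C%C.
Proof.
move=> [M hM]; have M0 : 0 <= M by apply: le_trans (hM point).
have /RRe_real eM : M \is Num.real by rewrite realE M0.
by exists (ReC M); [rewrite -lecR eM|move=> x; rewrite eM].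
Qed.

Lemma CcB f g : Cc E f -> Cc E g -> Cc E (fun s => f s - g s).
Proof.
move=> Cf Cg; rewrite (_ : (fun s => _) = fun s => (-1) * g s + f s); first exact: Cc_lin.
by apply/funext => s; rewrite mulN1r addrC.
Qed.

Lemma L2_classD f g : Cc E f -> Cc E g -> cls (fun s => f s + g s) = cls f + cls g.
Proof.
move=> Cf Cg; rewrite -[cls f]scale1r -L2_class_linear//; congr cls.
by apply/funext => s; rewrite mul1r.
Qed.

Lemma L2_classB f g : Cc E f -> Cc E g -> cls (fun s => f s - g s) = cls f - cls g.
Proof.
move=> Cf Cg; rewrite addrC -scaleN1r -L2_class_linear//; congr cls.
by apply/funext => s; rewrite mulN1r addrC.
Qed.

Lemma L2_class0 : cls (fun=> 0) = 0.
Proof.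
rewrite -[RHS](subrr (cls (fun=> 0))) -L2_classB; try exact: Cc0.
by congr cls; apply/funext => s; rewrite subr0.
Qed.

Lemma L2_class_norm f : Cc E f -> ((rnorm (cls f) ^+ 2)%:C)%C = int (fibre_norm f).
Proof. by move=> Cf; rewrite rnorm_sq L2_class_dot. Qed.

Lemma L2_class_norm_le f g (M : R) : Cc E f -> Cc E g -> 0 <= M ->
  (forall x, fibre_norm f x <= ((M ^+ 2)%:C)%C * fibre_norm g x) ->
  rnorm (cls f) <= M * rnorm (cls g).
Proof.
move=> Cf Cg M0 h; rewrite -ler_sqr ?nnegrE ?mulr_ge0 ?rnorm_ge0// exprMn -lecR.
rewrite [leRHS]rmorphM /= !L2_class_norm// -cintegralZ; last exact: fibre_norm_borel.
apply: cintegral_le => //; first exact: fibre_norm_borel.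
by apply: bounded_borelM; [exact: bounded_borel_cst|exact: fibre_norm_borel].
Qed.

(** The best t is y/x. Adding e to both terms keeps it defined when x or y vanishes, and e is so
    small that the error k e (x + y) stays below the assumed gap. *)
Lemma AMGM_sup (a k x y : R) : 0 <= k -> 0 <= x -> 0 <= y ->
  (forall t, 0 < t -> a <= k * (t * x ^+ 2 + t^-1 * y ^+ 2)) -> a <= 2 * k * (x * y).
Proof.
move=> k0 x0 y0 h; rewrite leNgt; apply/negP => lt0.
pose e := (a - 2 * k * (x * y)) / (k * (x + y) + 1).
have d0 : 0 < k * (x + y) + 1 by have := mulr_ge0 k0 (addr_ge0 x0 y0); lra.
have e0 : 0 < e by rewrite divr_gt0// subr_gt0.
have ee : e * (k * (x + y) + 1) = a - 2 * k * (x * y) by rewrite /e divfK// gt_eqF.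
have xe : 0 < x + e by lra.
have ye : 0 < y + e by lra.
have := h ((y + e) / (x + e)) (divr_gt0 ye xe); rewrite invf_div.
have aux (u v : R) : 0 <= u -> 0 < v -> v / (u + e) * u ^+ 2 <= v * u.
  move=> u0 v0; have ue : 0 < u + e by lra.
  rewrite mulrAC ler_pdivrMr// expr2 !mulrA ler_wpM2l ?mulr_ge0 ?(ltW v0)//; lra.
have h1 := aux x _ x0 ye; have h2 := aux y _ y0 xe.
have := ler_wpM2l k0 (lerD h1 h2); move: (_ / _) (_ / _) => u v l1 l2.
by have := le_trans l2 l1; move: ee e0; nra.
Qed.

(** The constant 4 is a factor 2 from [cintegral_norm_le] times a factor 2 from [AMGM_sup]. The
    point is continuity of the weighted form in the L^2 norm, which [inner_weight_dense] needs. *)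
Lemma inner_weight_le f g beta (M : R) : Cc E f -> Cc E g -> bounded_borel beta -> 0 <= M ->
  (forall y, `|beta y| <= M%:C%C) ->
  ReC `|inner_Cc mu f (rweight beta g)| <= 4 * M * (rnorm (cls f) * rnorm (cls g)).
Proof.
move=> Cf Cg bb M0 hM.
have -> : 4 * M = 2 * (2 * M) by ring.
apply: AMGM_sup => [|||t t0]; rewrite ?rnorm_ge0 ?mulr_ge0//.
have bf := fibre_norm_borel cX etE Cf; have bg := fibre_norm_borel cX etE Cg.
have bc (k : C) := bounded_borel_cst X k.
have bH := bounded_borelD (bounded_borelM (bc (t%:C%C)) bf)
  (bounded_borelM (bc (t^-1%:C%C)) bg).
have := @cintegral_norm_le _ _ mu _ _ (fibre_sum_borel cX etE Cf Cg bb)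
  (bounded_borelM (bc M%:C%C) bH)
  (fun x => fibre_sum_AMGM x (Cc_fibre_finite cX Cf) (Cc_fibre_finite cX Cg) hM t0).
rewrite cintegralZ// cintegralD; [|exact: bounded_borelM|exact: bounded_borelM].
rewrite !cintegralZ// -!L2_class_norm// (rnormE (_ : C)) -!rmorphM -rmorphD -!rmorphM /=.
rewrite (_ : 2 = 2%:C%C :> C); last by rewrite rmorphMn.
by rewrite -rmorphM lecR mulrA.
Qed.

(** By [fibre_norm_conv_l] the bound is that of the coefficient, whatever the bisection is;
    uniformly bounded coefficients therefore give uniformly bounded operators. *)
Lemma reg_term S b (M : R) : compact_bisection S -> continuous b -> 0 <= M ->
  (forall y, `|b y| <= M%:C%C) ->
  exists2 T : K -> K, is_Reg (Ccterm S b) T & forall x, rnorm (T x) <= M * rnorm x.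
Proof.
move=> bS cb M0 hM; have CS := Cc_term cX bS cb.
pose P := [set q : K * K | exists2 g, Cc E g & q = (cls g, cls (convolution (Ccterm S b) g))].
have [|||T [cT PT bT]] := @extension_exists R K K P M.
- move=> a _ _ [f Cf ->] [g Cg ->]; exists (fun s => a * f s + g s); first exact: Cc_lin.
  rewrite conv_linear_r; last exact: Cc_fibre_finite.
  by rewrite !L2_class_linear//; exact: Cc_conv.
- move=> _ [g Cg ->]; apply: L2_class_norm_le => //; first exact: Cc_conv.
  move=> x; rewrite rmorphXn; apply: fibre_norm_conv_l => //.
    exact: Cc_equivariant.
  exact: Cc_fibre_finite.
- apply: dense_rnorm => x e e0.
  have [_ [g Cg <-] xg] := rnorm_dense (@L2_class_dense _ _ _ _ K) x e0.
  by exists (cls g) => //; exists (cls g, cls (convolution (Ccterm S b) g)) => //; exists g.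
exists T => //; split; first by split=> //; exact: linearP.
by move=> g Cg; apply: (PT (_, _)); exists g.
Qed.

Lemma is_RegD f g T T' : Cc E f -> Cc E g -> is_Reg f T -> is_Reg (K := K) g T' ->
  is_Reg (fun s => f s + g s) (fun x => T x + T' x).
Proof.
move=> Cf Cg [[lT cT] hT] [[lT' cT'] hT']; split; first split.
- by move=> a x y; rewrite lT lT' scalerDr addrACA.
- by move=> x; apply: cvgD; [exact: cT|exact: cT'].
- move=> h Ch; rewrite hT// hT'// -L2_classD; try exact: Cc_conv.
  congr cls; have := @conv_linear_l _ _ E 1 f g h (Cc_fibre_finite cX Cf) (Cc_fibre_finite cX Cg).
  have -> : (fun s => 1 * f s + g s) = (fun s => f s + g s) by apply/funext => s; rewrite mul1r.
  by move=> ->; apply/funext => s; rewrite mul1r.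
Qed.

Lemma is_Reg_unique f T T' : is_Reg f T -> is_Reg (K := K) f T' -> T = T'.
Proof.
move=> [[_ cT] hT] [[_ cT'] hT'].
apply: (continuous_dense_eq cT cT' (@L2_class_dense _ _ _ _ K)) => _ [g Cg <-].
by rewrite hT// hT'.
Qed.

Lemma reg_exists f : Cc E f -> exists T : K -> K, is_Reg f T.
Proof.
move: f; apply: (Cc_ind cX) => [|S b f bS cb Cf [T hT]].
  exists (fun=> 0); split; first split.
  - by move=> a x y; rewrite scaler0 addr0.
  - by move=> x; exact: cvg_cst.
  - by move=> g Cg; rewrite conv0l L2_class0.
have [M M0 hM] := bounded_real (continuous_bounded cX cb).
have [T' hT' _] := reg_term bS cb M0 hM.
exists (fun x => T' x + T x); apply: is_RegD => //; exact: Cc_term.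
Qed.

End Completion.

Section WeakClosure.
Variable R : realType.
Local Notation C := (cplx R).
Implicit Types K : hilbert_space R.

Lemma weak_closure_trans K (A B : set (K -> K)) :
  A `<=` weak_closure B -> weak_closure A `<=` weak_closure B.
Proof.
move=> AB T [bT hT]; split=> // s e e0; have e2 : 0 < e / 2 by rewrite divr_gt0.
have [T0 AT0 h0] := hT s _ e2; have [_ /(_ s _ e2) [T1 BT1 h1]] := AB _ AT0.
exists T1 => // xy sxy.
apply: le_lt_trans (ler_distD (hdot K (T0 xy.1) xy.2) _ _) _.
have -> : e%:C%C = (e / 2)%:C%C + (e / 2)%:C%C :> C by rewrite -rmorphD /= -splitr.
by apply: ltrD; [exact: h0|exact: h1].
Qed.

Lemma weak_closure_mono K (A B : set (K -> K)) :
  A `<=` B -> weak_closure A `<=` weak_closure B.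
Proof.
by move=> AB T [bT h]; split=> // s e e0; have [T0 ? ?] := h s e e0; exists T0 => //; exact: AB.
Qed.

Variables (K1 K2 : hilbert_space R) (J : K1 -> K2) (J' : K2 -> K1).
Hypotheses (linJ : linear J) (linJ' : linear J').
Hypotheses (contJ : continuous J) (contJ' : continuous J').
Hypotheses (JK : cancel J J') (J'K : cancel J' J).
Hypothesis dotJ : forall x y, hdot K2 (J x) (J y) = hdot K1 x y.

Lemma bounded_operator_conj (T : K1 -> K1) : bounded_operator T ->
  bounded_operator (J \o T \o J').
Proof.
move=> [lT cT]; split=> [a x y|x] /=; first by rewrite linJ' lT linJ.
apply: continuous_comp; first exact: contJ'.
by apply: continuous_comp; [exact: cT|exact: contJ].
Qed.

Lemma weak_closure_conj_sub (A : set (K1 -> K1)) :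
  [set J \o T \o J' | T in weak_closure A] `<=` weak_closure [set J \o T \o J' | T in A].
Proof.
move=> _ [T [bT hT] <-]; split; first exact: bounded_operator_conj.
move=> s e e0; have [T0 AT0 h0] := hT [seq (J' q.1, J' q.2) | q <- s] e e0.
exists (J \o T0 \o J'); first by exists T0.
move=> xy sxy; have := h0 _ (map_f (fun q => (J' q.1, J' q.2)) sxy) => /=.
by rewrite -!dotJ !J'K.
Qed.

End WeakClosure.

Section WeakClosureConj.
Variable R : realType.
Variables (K1 K2 : hilbert_space R) (J : K1 -> K2) (J' : K2 -> K1).
Hypotheses (linJ : linear J) (linJ' : linear J').
Hypotheses (contJ : continuous J) (contJ' : continuous J').
Hypotheses (JK : cancel J J') (J'K : cancel J' J).
Hypothesis dotJ : forall x y, hdot K2 (J x) (J y) = hdot K1 x y.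

Lemma weak_closure_conj (A : set (K1 -> K1)) :
  [set J \o T \o J' | T in weak_closure A] = weak_closure [set J \o T \o J' | T in A].
Proof.
apply/seteqP; split; first exact: weak_closure_conj_sub.
move=> T hT; exists (J' \o T \o J); last by apply/funext => x /=; rewrite !J'K.
have dotJ' x y : hdot K1 (J' x) (J' y) = hdot K2 x y by rewrite -dotJ !J'K.
have := @weak_closure_conj_sub _ _ _ J' J linJ' linJ contJ' contJ JK dotJ'
  [set J \o T \o J' | T in A] (J' \o T \o J).
have -> : [set J' \o T0 \o J | T0 in [set J \o T1 \o J' | T1 in A]] = A.
  apply/seteqP; split=> [_ [_ [T0 AT0 <-] <-]|T0 AT0].
    by rewrite (_ : _ \o _ = T0)//; apply/funext => x /=; rewrite !JK.
  exists (J \o T0 \o J'); first by exists T0.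
  by apply/funext => x /=; rewrite !JK.
by apply; exists T.
Qed.

End WeakClosureConj.

(** * The unitary J and conjugation by it *)

Section Transport.
Variables (R : realType) (Y X : ptopologicalType).
Variables (F : twisted_groupoid R Y) (E : twisted_groupoid R X).
Variable m : multiplier_action F E.
Hypotheses (cX : compact [set: X]) (cY : compact [set: Y]).
Hypothesis etE : local_homeomorphism (gdom (tw_base E)).
Hypothesis etF : local_homeomorphism (gdom (tw_base F)).
Variable mu : probability (borelType X) R.
Hypothesis qi : quasi_invariant (tw_base E) mu.
Hypothesis free_ae : mu.-negligible [set x : borelType X | ~ free_at m x].
Local Notation C := (cplx R).
Local Notation pi := (anchor m).
Local Notation nu := (pushforward mu (pi : borelType X -> borelType Y)).
Local Notation j := (jtilde m).

Lemma bounded_borel_comp (beta : Y -> C) : bounded_borel beta -> bounded_borel (beta \o pi).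
Proof.
move=> [[M hM] mR mI]; have mpi := continuous_borel (@anchor_continuous _ _ _ _ _ m).
split; first by exists M => x; exact: hM.
- exact: (measurableT_comp mR mpi).
- exact: (measurableT_comp mI mpi).
Qed.

Lemma inner_jtilde f g (beta : Y -> C) : Cc F f -> Cc F g -> bounded_borel beta ->
  inner_Cc mu (j f) (rweight (beta \o pi) (j g)) = inner_Cc nu f (rweight beta g).
Proof.
move=> Cf Cg bb; have bF := fibre_sum_borel cY etF Cf Cg bb.
rewrite [RHS]cintegral_pushforward//; last exact: anchor_continuous.
apply: cintegral_ae.
- apply: fibre_sum_borel => //; try exact: Cc_jtilde.
  exact: bounded_borel_comp.
- exact: (bounded_borel_comp bF).
- apply: negligibleS free_ae => x /= ne fx; apply: ne.
  exact: fibre_sum_jtilde.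
Qed.

Variable K : L2_completion E mu.
Local Notation clsE := (L2_class K).
Hypothesis jdense : dense [set clsE (j f) | f in Cc F].

(* The completion of Cc F is that of Cc E, with the map f |-> class of jtilde f. *)
Lemma jtilde_completion : inhabited (L2_completion F nu).
Proof.
constructor; apply: (@L2Completion _ _ _ _ K (fun f => clsE (j f))) => //.
- move=> a f g Cf Cg; rewrite jtilde_linear// L2_class_linear//; exact: Cc_jtilde.
- move=> f g Cf Cg; rewrite L2_class_dot; try exact: Cc_jtilde.
  have := inner_jtilde Cf Cg (bounded_borel_cst Y (1 : C)).
  by rewrite !rweight1 => <-; congr inner_Cc; exact: (esym (rweight1 _)).
Qed.

Variable L : L2_completion F nu.
Local Notation clsF := (L2_class L).

Lemma jtilde_isometry f : Cc F f -> rnorm (clsE (j f)) = rnorm (clsF f).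
Proof.
move=> Cf; have Cj := Cc_jtilde m cX cY Cf.
apply/eqP; rewrite -(@eqrXn2 _ 2) ?rnorm_ge0//; apply/eqP/complexI.
rewrite !rnorm_sq !L2_class_dot//.
have := inner_jtilde Cf Cf (bounded_borel_cst Y (1 : C)).
by rewrite !rweight1 => <-; congr inner_Cc; exact: (esym (rweight1 _)).
Qed.

(** The relation between the classes of f and of [jtilde m f] is isometric and is extended in both
    directions; the domains are dense, that of the inverse by [jdense]. *)
Lemma unitary_exists : exists (J : {linear L -> K}) (J' : {linear K -> L}),
  [/\ cancel J J' /\ cancel J' J, continuous J /\ continuous J',
      forall x, rnorm (J x) = rnorm x & forall f, Cc F f -> J (clsF f) = clsE (j f)].
Proof.
pose P := [set q : L * K | exists2 f, Cc F f & q = (clsF f, clsE (j f))].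
have Plin (a : C) p q : P p -> P q -> P (a *: p.1 + q.1, a *: p.2 + q.2).
  move=> [f Cf ->] [g Cg ->]; exists (fun s => a * f s + g s); first exact: Cc_lin.
  by rewrite jtilde_linear// !L2_class_linear//; exact: Cc_jtilde.
have [||J [cJ PJ bJ]] := @extension_exists R L K P 1 Plin.
- by move=> _ [f Cf ->] /=; rewrite mul1r jtilde_isometry.
- apply: dense_rnorm => x e e0.
  have [_ [f Cf <-] xf] := rnorm_dense (@L2_class_dense _ _ _ _ L) x e0.
  by exists (clsF f) => //; exists (clsF f, clsE (j f)) => //; exists f.
have [|||J' [cJ' PJ' bJ']] := @extension_exists R K L [set q | P (q.2, q.1)] 1.
- by move=> a p q; exact: Plin.
- by move=> [y x] /= [f Cf [-> ->]]; rewrite mul1r jtilde_isometry.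
- apply: dense_rnorm => x e e0.
  have [_ [f Cf <-] xf] := rnorm_dense jdense x e0.
  by exists (clsE (j f)) => //; exists (clsE (j f), clsF f) => //; exists f.
have JC f : Cc F f -> J (clsF f) = clsE (j f) by move=> Cf; apply: (PJ (_, _)); exists f.
have J'C f : Cc F f -> J' (clsE (j f)) = clsF f by move=> Cf; apply: (PJ' (_, _)); exists f.
have JK : cancel J J'.
  suff e : J' \o J = id by move=> x; rewrite -[RHS]/(id x) -e.
  apply: (continuous_dense_eq _ _ (@L2_class_dense _ _ _ _ L)) => [x|x|_ [f Cf <-]].
  - by apply: continuous_comp; [exact: cJ|exact: cJ'].
  - exact: cvg_id.
  - by rewrite /= JC// J'C.
have J'K : cancel J' J.
  suff e : J \o J' = id by move=> x; rewrite -[RHS]/(id x) -e.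
  apply: (continuous_dense_eq _ _ jdense) => [x|x|_ [f Cf <-]].
  - by apply: continuous_comp; [exact: cJ'|exact: cJ].
  - exact: cvg_id.
  - by rewrite /= J'C// JC.
exists J, J'; split=> // x; apply/eqP; rewrite eq_le.
have := bJ x; have := bJ' (J x); rewrite !mul1r JK => -> ->.
by [].
Qed.

Section Unitary.
Variables (J : {linear L -> K}) (J' : {linear K -> L}).
Hypotheses (JK : cancel J J') (J'K : cancel J' J).
Hypotheses (cJ : continuous J) (cJ' : continuous J').
Hypothesis isoJ : forall x, rnorm (J x) = rnorm x.
Hypothesis JC : forall f, Cc F f -> J (clsF f) = clsE (j f).

Let dotJ x y : hdot K (J x) (J y) = hdot L x y.
Proof. exact: isometry_hdot. Qed.

Let J'C f : Cc F f -> J' (clsE (j f)) = clsF f.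
Proof. by move=> Cf; rewrite -JC// JK. Qed.

Lemma Reg_conj f T : Cc F f -> is_Reg (K := L) f (J' \o T \o J) <-> is_Reg (K := K) (j f) T.
Proof.
move=> Cf; have Cjf := Cc_jtilde m cX cY Cf; have linJ := @linearP _ _ _ _ J.
have linJ' := @linearP _ _ _ _ J'; split=> [[bT hT]|[bT hT]].
  (* The convolution identity for T is known only on the dense image of [Cc F]; there T is compared
     with the operator Reg of [j f], which exists by [reg_exists]. *)
  have [T' hT'] := reg_exists cX etE K Cjf.
  suff -> : T = T' by [].
  have bT' := bounded_operator_conj linJ linJ' cJ cJ' bT.
  have eT : J \o (J' \o T \o J) \o J' = T by apply/funext => x /=; rewrite !J'K.
  rewrite eT in bT'.
  apply: (continuous_dense_eq bT'.2 hT'.1.2 jdense) => _ [g Cg <-].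
  rewrite hT'.2; last exact: Cc_jtilde.
  have Cfg := Cc_conv cY Cf Cg.
  by rewrite -jtilde_conv// -[LHS]J'K -(JC Cfg) -(hT _ Cg) /= JC.
split; first exact: bounded_operator_conj.
move=> g Cg /=; rewrite JC// hT; last exact: Cc_jtilde.
by rewrite -jtilde_conv// J'C//; exact: Cc_conv.
Qed.

(** Conjugation by J commutes with weak closure and carries Reg(f) to Reg([jtilde m f]). The
    remaining point, that each Reg(f) with f in [Cc E] is a weak limit of operators so obtained, is
    the hypothesis. *)
Lemma Wstar_conj :
  (forall f T, Cc E f -> is_Reg (K := K) f T ->
    weak_closure [set T | exists2 f, Cc F f & is_Reg (K := K) (j f) T] T) ->
  [set J \o T \o J' | T in Wstar L] = Wstar K.
Proof.
move=> approx; rewrite /Wstar (weak_closure_conj _ _ cJ cJ' JK J'K dotJ); last 2 first.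
- exact: linearP.
- exact: linearP.
have -> : [set J \o T \o J' | T in [set T | exists2 f, Cc F f & is_Reg (K := L) f T]] =
    [set T | exists2 f, Cc F f & is_Reg (K := K) (j f) T].
  apply/seteqP; split=> [_ [T [f Cf hT] <-]|T [f Cf hT]].
    exists f => //; apply/Reg_conj => //.
    by rewrite (_ : J' \o _ \o J = T)//; apply/funext => x /=; rewrite !JK.
  exists (J' \o T \o J); last by apply/funext => x /=; rewrite !J'K.
  by exists f => //; apply/Reg_conj.
apply/seteqP; split.
  by apply: weak_closure_mono => T [f Cf hT]; exists (j f) => //; exact: Cc_jtilde.
by apply: weak_closure_trans => T [f Cf hT]; exact: approx hT.
Qed.

(** Both sides are bounded sesquilinear forms in the classes of f and g, the right one by
    [inner_weight_le]; they agree on the dense image of [Cc F]. *)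
Lemma inner_weight_dense (N : K -> K) (b : X -> C) : bounded_operator N -> bounded_borel b ->
  (forall f g, Cc F f -> Cc F g ->
    hdot K (N (clsE (j g))) (clsE (j f)) = inner_Cc mu (j f) (rweight b (j g))) ->
  forall f g, Cc E f -> Cc E g ->
    hdot K (N (clsE g)) (clsE f) = inner_Cc mu f (rweight b g).
Proof.
move=> [lN cN] bb hj f g Cf Cg.
have [M M0 hM] := bounded_real (let: And3 h _ _ := bb in h).
pose D f g := hdot K (N (clsE g)) (clsE f) - inner_Cc mu f (rweight b g).
have [k k0 hk] := continuous_linear_le lN cN.
have innerB_r f1 g1 g2 : Cc E f1 -> Cc E g1 -> Cc E g2 ->
    inner_Cc mu f1 (rweight b (fun s => g1 s - g2 s)) =
    inner_Cc mu f1 (rweight b g1) - inner_Cc mu f1 (rweight b g2).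
  move=> C1 C2 C3; have b1 := fibre_sum_borel cX etE C1 C2 bb.
  have b2 := fibre_sum_borel cX etE C1 C3 bb.
  rewrite addrC -mulN1r -cintegral_linear//; congr cintegral; apply/funext => x.
  rewrite -fibre_sum_linear_r; last exact: Cc_fibre_finite.
  by congr fibre_sum; apply/funext => s; rewrite /rweight; ring.
have innerB_l f1 f2 g1 : Cc E f1 -> Cc E f2 -> Cc E g1 ->
    inner_Cc mu (fun s => f1 s - f2 s) (rweight b g1) =
    inner_Cc mu f1 (rweight b g1) - inner_Cc mu f2 (rweight b g1).
  move=> C1 C2 C3; have b1 := fibre_sum_borel cX etE C1 C3 bb.
  have b2 := fibre_sum_borel cX etE C2 C3 bb.
  rewrite addrC -mulN1r -cintegral_linear//; congr cintegral; apply/funext => x.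
  have -> : (fun s => f1 s - f2 s) = (fun s => -1 * f2 s + f1 s).
    by apply/funext => s; rewrite mulN1r addrC.
  rewrite fibre_sum_linear_l; try exact: Cc_fibre_finite.
  by rewrite (rmorphN1 (@Num.conj C)).
have Dle f1 g1 : Cc E f1 -> Cc E g1 ->
    rnorm (D f1 g1 : C) <= (k + 4 * M) * (rnorm (clsE f1) * rnorm (clsE g1)).
  move=> C1 C2; apply: le_trans (rnormD _ _) _; rewrite rnormN mulrDl; apply: lerD.
    apply: le_trans (hdot_CauchySchwarz _ _) _.
    by rewrite mulrC mulrCA ler_wpM2l ?rnorm_ge0.
  exact: inner_weight_le.
apply/eqP; rewrite -subr_eq0; apply/eqP; apply: (@rnorm_eq0 _ C).
rewrite -/(D f g) leNgt; apply/negP => d0.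
(* With approximations within e <= 1, the two error terms into which D f g splits sum to less than e
   a; e is then chosen with e a at most |D f g|. *)
pose a := (k + 4 * M) * (rnorm (clsE g) + 1 + rnorm (clsE f)) + 1.
have a0 : 0 < a.
  have := mulr_ge0 (addr_ge0 k0 (mulr_ge0 (ler0n R 4) M0))
    (addr_ge0 (addr_ge0 (rnorm_ge0 (clsE g)) ler01) (rnorm_ge0 (clsE f))).
  by rewrite /a; lra.
pose e := Num.min 1 (rnorm (D f g : C) / a).
have e0 : 0 < e by rewrite lt_min ltr01 divr_gt0.
have [_ [f' Cf' <-] ff'] := rnorm_dense jdense (clsE f) e0.
have [_ [g' Cg' <-] gg'] := rnorm_dense jdense (clsE g) e0.
have Cjf := Cc_jtilde m cX cY Cf'; have Cjg := Cc_jtilde m cX cY Cg'.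
have DD : D f g = D f (fun s => g s - j g' s) + D (fun s => f s - j f' s) (j g').
  rewrite /D !L2_classB// innerB_r// innerB_l// hdotBr -[N (_ - _)]/(N (_ - _)).
  have -> : N (clsE g - clsE (j g')) = N (clsE g) - N (clsE (j g')).
    by have := lN (-1) (clsE (j g')) (clsE g); rewrite !scaleN1r !(addrC (- _)).
  by rewrite hdotBl (hj _ _ Cf' Cg'); ring.
have h1 := Dle _ _ Cf (CcB cX Cg Cjg); have h2 := Dle _ _ (CcB cX Cf Cjf) Cjg.
rewrite !L2_classB// in h1 h2.
have := rnormD (D f (fun s => g s - j g' s) : C) (D (fun s => f s - j f' s) (j g') : C).
rewrite -DD => h3.
have le1 : e <= 1 by rewrite ge_min lexx.
have lea : e * a <= rnorm (D f g : C) by rewrite -ler_pdivlMr// ge_min lexx orbT.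
have gj : rnorm (clsE (j g')) <= rnorm (clsE g) + 1.
  have := rnorm_triangle (clsE g) (clsE (j g')) 0; rewrite !subr0 rnormB => h6.
  by apply: le_trans h6 _; rewrite addrC lerD2l (le_trans (ltW gg')).
have km : 0 <= k + 4 * M by lra.
have h4 : (k + 4 * M) * (rnorm (clsE f) * rnorm (clsE g - clsE (j g'))) <=
    (k + 4 * M) * (rnorm (clsE f) * e).
  by rewrite ler_wpM2l// ler_wpM2l ?rnorm_ge0// ltW.
have h5 : (k + 4 * M) * (rnorm (clsE f - clsE (j f')) * rnorm (clsE (j g'))) <=
    (k + 4 * M) * (e * (rnorm (clsE g) + 1)).
  by rewrite ler_wpM2l// ler_pM ?rnorm_ge0// ltW.
have h6 : (k + 4 * M) * (rnorm (clsE f) * e) + (k + 4 * M) * (e * (rnorm (clsE g) + 1)) < e * a.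
  have aux (u v w t : R) : 0 < t -> w * (u * t) + w * (t * (v + 1)) < t * (w * (v + 1 + u) + 1).
    by move=> t0; rewrite -subr_gt0 (_ : _ - _ = t)//; ring.
  exact: aux.
have h7 := le_trans h3 (lerD (le_trans h1 h4) (le_trans h2 h5)).
by have := lt_le_trans (le_lt_trans h7 h6) lea; rewrite ltxx.
Qed.

(** A function b' on Y becomes b' o pi. In the other direction the lift of b agrees with b only
    almost everywhere on X, and [fibre_sum_weight_ae] shows that this does not change the
    operator. *)
Lemma Linfty_conj :
  (forall b : X -> C, bounded_borel b -> exists2 b' : Y -> C, bounded_borel b' &
    mu.-negligible [set x : borelType X | b x <> b' (pi x)]) ->
  [set J \o T \o J' | T in Linfty L] = Linfty K.
Proof.
move=> lift; have linJ := @linearP _ _ _ _ J; have linJ' := @linearP _ _ _ _ J'.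
apply/seteqP; split=> [_ [T [bT [b bb hT]] <-]|T [bT [b bb hT]]].
  have bN := bounded_operator_conj linJ linJ' cJ cJ' bT.
  split=> //; exists (b \o pi); first exact: bounded_borel_comp.
  move=> g Cg f Cf; apply: inner_weight_dense => //; first exact: bounded_borel_comp.
  move=> {Cf Cg}f {}g Cf Cg; rewrite inner_jtilde// /= J'C// -(JC Cf) dotJ.
  exact: hT.
have [b' bb' neg] := lift b bb.
exists (J' \o T \o J); last by apply/funext => x /=; rewrite !J'K.
split; first exact: bounded_operator_conj.
exists b' => // g Cg f Cf /=; rewrite JC// -dotJ J'K JC//.
rewrite (hT _ (Cc_jtilde m cX cY Cg) _ (Cc_jtilde m cX cY Cf)).
rewrite -[RHS]inner_jtilde//.
apply: cintegral_ae.
- by apply: fibre_sum_borel => //; exact: Cc_jtilde.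
- by apply: fibre_sum_borel => //; [exact: Cc_jtilde|exact: Cc_jtilde|exact: bounded_borel_comp].
- by apply: fibre_sum_weight_ae => //; exact: Cc_jtilde.
Qed.

End Unitary.

End Transport.

(** * Approximation *)

Section NullSequences.
Variables (R : realType) (X : ptopologicalType) (mu : probability (borelType X) R).
Local Notation C := (cplx R).
Local Notation ReC z := (complex.Re (z : R[i])).
Implicit Types (F : nat -> X -> C) (A : nat -> set (borelType X)).

Lemma lim_sup_set_null A : (forall n, measurable (A n)) ->
  (forall n, (mu (A n) <= (2 ^- n.+1)%:E)%E) -> mu (lim_sup_set A) = 0%E.
Proof.
move=> mA hA; apply: lim_sup_set_cvg0 => //.
have h := @cvg_geometric_eseries_half R 1 0.
apply: (@le_lt_trans _ _ (\sum_(0 <= n <oo) (1 / (2 ^ (n + 1))%:R)%:E)%E).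
  apply: lee_nneseries => // n _; rewrite addn1 div1r natrX; exact: hA.
by rewrite (cvg_lim _ h)// ltry.
Qed.

(* Chebyshev and Borel-Cantelli. *)
Lemma summable_cvg_ae F : (forall n, bounded_borel (F n)) -> (forall n x, 0 <= F n x) ->
  (forall n, ReC (cintegral mu (F n)) <= (2 ^- n.+1) ^+ 2) ->
  mu.-negligible [set x : borelType X | ~ (ReC (F n x) @[n --> \oo] --> (0 : R))].
Proof.
(* The threshold is the square root of the bound on the integral, so that A n has measure at most
   2^-(n+1). *)
move=> bF F0 hF; pose A n : set (borelType X) := [set x | 2 ^- n.+1 <= ReC (F n x)].
have F0' n x : 0 <= ReC (F n x) by move: (F0 n x); rewrite le_cplx => /andP[].
have mF n : measurable_fun [set: borelType X] (fun x : borelType X => ReC (F n x)).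
  by case: (bF n).
have mA n : measurable (A n).
  rewrite -[A n]setTI (_ : A n = (fun x : borelType X => ReC (F n x)) @^-1` `[2 ^- n.+1, +oo[%classic).
    exact: mF.
  by apply/seteqP; split=> x /=; rewrite in_itv /= andbT.
exists (lim_sup_set A); split.
- by apply: bigcap_measurable => // n _; apply: bigcup_measurable => k _.
- apply: lim_sup_set_null => // n.
  have a0 : (0 : R) < 2 ^- n.+1 by rewrite invr_gt0 exprn_gt0.
  have := @le_integral_abse _ _ _ mu setT measurableT (fun x => (ReC (F n x))%:E) (2 ^- n.+1)
    ((measurable_EFinP _ _).2 (mF n)) a0.
  rewrite setTI (_ : [set x | _] = A n); last first.
    by apply/seteqP; split=> x /=; rewrite lee_fin ger0_norm.
  have -> : (\int[mu]_(x in setT) `|(ReC (F n x))%:E|)%E = (ReC (cintegral mu (F n)))%:E.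
    rewrite /= fineK; last by apply: integrable_fin_num => //; exact: Re_integrable.
    by apply: eq_integral => x _; rewrite /= ger0_norm.
  move=> /le_trans/(_ (_ : _ <= ((2 ^- n.+1) * (2 ^- n.+1))%:E)%E).
  rewrite lee_fin -expr2 => /(_ (hF n)); rewrite expr2 EFinM.
  by rewrite lee_pmul2l// lte_fin.
- move=> x /= nx; apply: contrapT => xA; apply: nx.
  have [N hN] : exists N, forall n, (N <= n)%N -> ReC (F n x) <= 2 ^- n.+1.
    apply: contrapT => h; apply: xA => n _; apply: contrapT => k; apply: h.
    exists n => q nq; rewrite leNgt; apply/negP => l; apply: k; exists q => //; exact: ltW.
  apply: (@squeeze_cvgr _ _ _ _ (fun=> 0) (geometric 2^-1 2^-1)); last 2 first.
  - exact: cvg_cst.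
  - by apply: cvg_geometric; rewrite ger0_norm ?invr_ge0// invf_lt1// ltr1n.
  exists N => // n /= Nn; rewrite F0' /=; apply: le_trans (hN n Nn) _.
  by rewrite -exprVn exprS.
Qed.

Lemma cintegral_dominated F (M : R) : (forall n, bounded_borel (F n)) ->
  (forall n x, 0 <= F n x) -> (forall n x, F n x <= M%:C%C) ->
  mu.-negligible [set x : borelType X | ~ (ReC (F n x) @[n --> \oo] --> (0 : R))] ->
  ReC (cintegral mu (F n)) @[n --> \oo] --> (0 : R).
Proof.
move=> bF F0 FM [N [mN N0 hN]].
have F0' n x : 0 <= ReC (F n x) by move: (F0 n x); rewrite le_cplx => /andP[].
have FM' n x : ReC (F n x) <= M by move: (FM n x); rewrite le_cplx => /andP[].
have mF n : measurable_fun [set: borelType X] (fun x : borelType X => ReC (F n x)).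
  by case: (bF n).
have [||||_ _] := @dominated_convergence _ _ _ mu setT measurableT
  (fun n x => (ReC (F n x))%:E) (cst 0%E) (cst M%:E) (fun n => (measurable_EFinP _ _).2 (mF n)).
- exact: measurable_cst.
- exists N; split=> // x /= nx; apply: hN => /= cx; apply: nx => _.
  by apply/fine_cvgP; split; [exact: nearW|exact: cx].
- apply/integrableP; split; first exact: measurable_cst.
  by rewrite integral_cst//= probability_setT mule1 ltry.
- apply: aeW => x n _; rewrite lee_fin ger0_norm//.
rewrite integral0 => /fine_cvgP[_]; exact.
Qed.

End NullSequences.

Section StrongApproximation.
Variables (R : realType) (X : ptopologicalType) (E : twisted_groupoid R X).
Hypothesis cX : compact [set: X].
Hypothesis etE : local_homeomorphism (gdom (tw_base E)).
Variable mu : probability (borelType X) R.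
Hypothesis qi : quasi_invariant (tw_base E) mu.
Variable K : L2_completion E mu.
Local Notation C := (cplx R).
Local Notation ReC z := (complex.Re (z : R[i])).
Local Notation Sigma := (tw_ext E).
Local Notation cls := (L2_class K).
Local Notation d := (gdom Sigma).
Implicit Types (f g h : Sigma -> C) (S : set Sigma) (b : X -> C).

(** Each of the two cross terms is bounded by the sum of the fibre norms, by [fibre_sum_AMGM] with t
    = 1; hence 3 in place of the optimal 2. *)
Lemma fibre_norm_sub f g x : Cc E f -> Cc E g ->
  fibre_norm (fun s => f s - g s) x <= 3 * (fibre_norm f x + fibre_norm g x).
Proof.
move=> Cf Cg; have ff := Cc_fibre_finite cX Cf; have fg := Cc_fibre_finite cX Cg.
have e : (fun s => f s - g s) = (fun s => -1 * g s + f s).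
  by apply/funext => s; rewrite mulN1r addrC.
have ffg : fibre_finite (fun s => -1 * g s + f s).
  by apply: (Cc_fibre_finite cX); exact: Cc_lin.
rewrite -[leLHS]ger0_norm ?fibre_norm_ge0// {1}/fibre_norm e.
rewrite fibre_sum_linear_r// !fibre_sum_linear_l// (rmorphN1 (@Num.conj C)).
have le1 (u v : Sigma -> C) : fibre_finite u -> fibre_finite v ->
    `|fibre_sum u v x| <= fibre_norm u x + fibre_norm v x.
  move=> fu fv; have := @fibre_sum_AMGM _ _ E u v (fun=> 1) 1 1 x fu fv.
  rewrite rweight1 mul1r invr1 !mul1r; apply=> //.
  by move=> _; rewrite normr1.
set u := fibre_sum g f x; set v := fibre_sum f g x.
have -> : -1 * (-1 * fibre_sum g g x + v) + (-1 * u + fibre_sum f f x) =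
  fibre_norm f x + fibre_norm g x - v - u by rewrite /fibre_norm; ring.
apply: le_trans (ler_normB _ _) _; apply: le_trans (lerD (ler_normB _ _) (lexx _)) _.
have := lerD (lerD (lexx `|fibre_norm f x + fibre_norm g x|) (le1 _ _ ff fg)) (le1 _ _ fg ff).
move=> /le_trans; apply; rewrite ger0_norm ?addr_ge0 ?fibre_norm_ge0//.
by rewrite le_eqVlt; apply/orP; left; apply/eqP; ring.
Qed.

Lemma fibre_norm_termE S b x : compact_bisection S -> continuous b ->
  fibre_norm (Ccterm S b) x = if `[< (d @` S) x >] then `|b x| ^+ 2 else 0.
Proof.
move=> bS cb; have eq1 := Cc_equivariant cX (Cc_term cX bS cb).
rewrite /fibre_norm -{2}(rweight1 (Ccterm S b)) fibre_sum_term// mul1r.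
case: asboolP => // Sx; have [Ss ds] := dsecP Sx.
by rewrite /Ccterm ds Delta1 ?mul1r ?normCK 1?mulrC//; exact: cbis_dinj.
Qed.

Lemma fibre_norm_term S b (M : R) x : compact_bisection S -> continuous b ->
  (forall y, `|b y| <= M%:C%C) -> fibre_norm (Ccterm S b) x <= (M ^+ 2)%:C%C.
Proof.
move=> bS cb hM; have M0 : 0 <= M%:C%C :> C by apply: le_trans (hM x).
rewrite fibre_norm_termE// rmorphXn; case: asboolP => _; last by rewrite exprn_ge0.
by rewrite ler_sqr ?nnegrE.
Qed.

Section Sequence.
Variables (S : set Sigma) (b : X -> C) (M : R).
Variables (S_ : nat -> set Sigma) (b_ : nat -> X -> C).
Variables (T : K -> K) (T_ : nat -> K -> K).
Hypotheses (bS : compact_bisection S) (cb : continuous b).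
Hypothesis hM : forall y, `|b y| <= M%:C%C.
Hypotheses (bS_ : forall n, compact_bisection (S_ n)) (cb_ : forall n, continuous (b_ n)).
Hypothesis hM_ : forall n y, `|b_ n y| <= M%:C%C.
Hypotheses (regT : is_Reg (Ccterm S b) T) (regT_ : forall n, is_Reg (Ccterm (S_ n) (b_ n)) (T_ n)).
Hypothesis small : forall n,
  rnorm (cls (Ccterm S b) - cls (Ccterm (S_ n) (b_ n))) <= 2 ^- n.+1.

Let f := Ccterm S b.
Let f_ n := Ccterm (S_ n) (b_ n).
Let h_ n := fun s => f s - f_ n s.
Let Cf : Cc E f. Proof. exact: (Cc_term cX bS cb). Qed.
Let Cf_ n : Cc E (f_ n). Proof. exact: (Cc_term cX (bS_ n) (@cb_ n)). Qed.
Let Ch n : Cc E (h_ n). Proof. exact: (CcB cX Cf (Cf_ n)). Qed.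

Let M0 : 0 <= M.
Proof. by rewrite -lecR; exact: le_trans (normr_ge0 _) (hM point). Qed.

Let kappa_bound n x : fibre_norm (h_ n) x <= (6 * M ^+ 2)%:C%C.
Proof.
apply: le_trans (fibre_norm_sub x Cf (Cf_ n)) _.
have -> : (6 * M ^+ 2)%:C%C = 3 * ((M ^+ 2)%:C%C + (M ^+ 2)%:C%C) :> C.
  by rewrite rmorphM /= rmorphMn /= rmorph1; ring.
rewrite ler_wpM2l// lerD//; first exact: (fibre_norm_term x bS cb hM).
exact: (fibre_norm_term x (bS_ n) (@cb_ n) (@hM_ n)).
Qed.

Let kappa_ae : mu.-negligible
  [set x : borelType X | ~ (ReC (fibre_norm (h_ n) x) @[n --> \oo] --> (0 : R))].
Proof.
apply: summable_cvg_ae => [n|n x|n]; [exact: fibre_norm_borel|exact: fibre_norm_ge0|].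
rewrite -(L2_class_norm K (Ch n)) /= L2_classB// ler_sqr ?nnegrE ?rnorm_ge0//.
exact: small.
Qed.

Let reg_sub n g : Cc E g -> T (cls g) - T_ n (cls g) = cls (convolution (h_ n) g).
Proof.
move=> Cg; rewrite regT.2// (regT_ n).2// -(L2_classB K (Cc_conv cX Cf Cg) (Cc_conv cX (Cf_ n) Cg)).
congr cls; have -> : h_ n = (fun s => -1 * f_ n s + f s).
  by apply/funext => s; rewrite mulN1r addrC.
rewrite (conv_linear_l _ _ (Cc_fibre_finite cX (Cf_ n)) (Cc_fibre_finite cX Cf)).
by apply/funext => s; rewrite mulN1r addrC.
Qed.

Let cvg_term S' c : compact_bisection S' -> continuous c -> forall e : R, 0 < e ->
  \forall n \near \oo, rnorm (T (cls (Ccterm S' c)) - T_ n (cls (Ccterm S' c))) < e.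
Proof.
move=> bS' cc e e0; have Cg := Cc_term cX bS' cc; set g := Ccterm S' c in Cg *.
have [Mc Mc0 hMc] := bounded_real (continuous_bounded cX cc).
pose F n := fibre_norm (convolution (h_ n) g).
have FE n x : F n x = if `[< (d @` S') x >] then `|c x| ^+ 2 * fibre_norm (h_ n) (bis_map S' x) else 0.
  by apply: fibre_norm_conv_r => //; [exact: Cc_equivariant|exact: Cc_fibre_finite].
have := @cintegral_dominated _ _ mu F (Mc ^+ 2 * (6 * M ^+ 2)).
have cE n : rnorm (T (cls g) - T_ n (cls g)) ^+ 2 = ReC (cintegral mu (F n)).
  by rewrite reg_sub// -(L2_class_norm K (Cc_conv cX (Ch n) Cg)).
move=> dom.
have {}dom : rnorm (T (cls g) - T_ n (cls g)) ^+ 2 @[n --> \oo] --> (0 : R).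
  under eq_cvg do rewrite cE.
  apply: dom => [n|n x|n x|].
  - by apply: fibre_norm_borel => //; exact: Cc_conv.
  - exact: fibre_norm_ge0.
  - rewrite FE; case: asboolP => _; last first.
      by rewrite lecR mulr_ge0 ?exprn_ge0// mulr_ge0// exprn_ge0.
    rewrite rmorphM /= ler_pM ?exprn_ge0 ?fibre_norm_ge0//.
    by rewrite rmorphXn ler_sqr ?nnegrE//= lecR.
  - apply: negligibleS (negligible_pullback etE qi bS' kappa_ae) => x /= nx.
    have [Sx|nSx] := pselect ((d @` S') x); last first.
      exfalso; apply: nx; rewrite (_ : (fun n => _) = (fun=> 0)); first exact: cvg_cst.
      by apply/funext => n; rewrite FE; case: asboolP.
    split=> // kx; apply: nx.
    rewrite (_ : (fun n => _) = (fun n => ReC (`|c x| ^+ 2) * ReC (fibre_norm (h_ n) (bis_map S' x)))).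
      by rewrite -(mulr0 (ReC (`|c x| ^+ 2))); apply: cvgMr.
    apply/funext => n; rewrite FE; case: asboolP => // _.
    have aux (u v : C) : u \is Num.real -> ReC (u * v) = ReC u * ReC v.
      by move=> /RRe_real <-; case: v => v1 v2 /=; rewrite mul0r subr0.
    by apply: aux; rewrite rpredX// normr_real.
have e2 : 0 < e ^+ 2 by rewrite exprn_gt0.
have [N _ hN] := (cvgrPdist_lt _ _).1 dom _ e2; exists N => // n /hN.
by rewrite sub0r normrN ger0_norm ?exprn_ge0 ?rnorm_ge0// ltr_sqr ?nnegrE ?rnorm_ge0// ltW.
Qed.

Let T_bound x : rnorm (T x) <= M * rnorm x.
Proof. by have [T' hT'] := reg_term cX etE K bS cb M0 hM; rewrite (is_Reg_unique regT hT'). Qed.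

Let T__bound n x : rnorm (T_ n x) <= M * rnorm x.
Proof.
have [T' hT'] := reg_term cX etE K (bS_ n) (@cb_ n) M0 (@hM_ n).
by rewrite (is_Reg_unique (regT_ n) hT').
Qed.

(* Right convolution by Ccterm S' c turns the fibre norm kappa of h_n into
   |c|^2 kappa(bis_map S' x). Since the kappa's are bounded and summable in L^1,
   they tend to 0 almost everywhere, and so do their composites with bis_map S' by
   quasi-invariance. *)
Lemma reg_strong_cvg x (e : R) : 0 < e -> \forall n \near \oo, rnorm (T x - T_ n x) < e.
Proof.
have linT := regT.1.1; have linT_ n := (regT_ n).1.1.
have main g : Cc E g -> forall e : R, 0 < e ->
    \forall n \near \oo, rnorm (T (cls g) - T_ n (cls g)) < e.
  move: g; apply: (Cc_ind cX) => [e' e0|S' c g bS' cc Cg ih e' e0].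
    by apply: nearW => n; rewrite L2_class0// (linear_prop0 linT) (linear_prop0 (linT_ n)) subrr rnorm0.
  have e2 : 0 < e' / 2 by rewrite divr_gt0.
  apply: filterS2 (cvg_term bS' cc e2) (ih _ e2) => n h1 h2.
  have Ct := Cc_term cX bS' cc.
  rewrite L2_classD// (linear_propD linT) (linear_propD (linT_ n)) opprD addrACA.
  by apply: le_lt_trans (rnormD _ _) _; rewrite (splitr e') ltrD.
move=> e0; have e2 : 0 < e / 2 by rewrite divr_gt0.
have M1 : 0 < M + 1 by rewrite ltr_wpDl.
(* Replacing x by the class of g costs e/4 for T and e/4 for all [T_ n] at once, by the common bound
   M; e/2 is left for the convergence at that class. *)
have d0 : 0 < e / 4 / (M + 1) by rewrite !divr_gt0.
have [_ [g Cg <-] xg] := rnorm_dense (@L2_class_dense _ _ _ _ K) x d0.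
apply: filterS (main g Cg _ e2) => n hn.
have Md : M * rnorm (x - cls g) < e / 4.
  have := ler_wpM2l M0 (ltW xg); move=> /le_lt_trans; apply.
  rewrite mulrCA -[ltRHS]mulr1 ltr_pM2l ?divr_gt0// ltr_pdivrMr ?mul1r; lra.
have h1 : rnorm (T x - T (cls g)) < e / 4.
  by rewrite -(linear_propB linT); exact: le_lt_trans (T_bound _) Md.
have h2 : rnorm (T_ n (cls g) - T_ n x) < e / 4.
  by rewrite rnormB -(linear_propB (linT_ n)); exact: le_lt_trans (T__bound _ _) Md.
apply: le_lt_trans (rnorm_triangle (T (cls g)) _ _) _.
apply: le_lt_trans (lerD (lexx _) (rnorm_triangle (T_ n (cls g)) _ _)) _.
have -> : e = e / 4 + (e / 2 + e / 4) by lra.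
by rewrite !ltrD.
Qed.

End Sequence.

Lemma weak_closure_strong (B : set (K -> K)) (T : K -> K) (T_ : nat -> K -> K) :
  bounded_operator T -> (forall n, B (T_ n)) ->
  (forall x (e : R), 0 < e -> \forall n \near \oo, rnorm (T x - T_ n x) < e) ->
  weak_closure B T.
Proof.
move=> bT BT h; split=> // s e e0.
have [n hn] : exists n, {in s, forall xy,
    `|hdot K (T xy.1) xy.2 - hdot K (T_ n xy.1) xy.2| < e%:C%C}.
  suff [n _ /(_ n (leqnn n)) hn] : \forall n \near \oo, {in s, forall xy,
      `|hdot K (T xy.1) xy.2 - hdot K (T_ n xy.1) xy.2| < e%:C%C} by exists n.
  elim: s => [|[x y] s ih]; first by apply: nearW.
  have d0 : 0 < e / (rnorm y + 1) by rewrite divr_gt0//; have := rnorm_ge0 y; lra.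
  apply: filterS2 ih (h x _ d0) => n h1 h2 z; rewrite inE => /orP[/eqP ->|]; last exact: h1.
  rewrite /= -hdotBl (rnormE (_ : C)) ltcR; apply: le_lt_trans (hdot_CauchySchwarz _ _) _.
  apply: le_lt_trans (ler_wpM2r (rnorm_ge0 y) (ltW h2)) _.
  rewrite mulrAC ltr_pdivrMr; first by rewrite ltr_pM2l//; lra.
  by have := rnorm_ge0 y; lra.
by exists (T_ n).
Qed.

Lemma weak_closureD (B : set (K -> K)) (T T' : K -> K) :
  (forall U U', B U -> B U' -> B (fun x => U x + U' x)) ->
  weak_closure B T -> weak_closure B T' -> weak_closure B (fun x => T x + T' x).
Proof.
move=> BD [[lT cT] hT] [[lT' cT'] hT']; split; first split.
- by move=> a x y; rewrite lT lT' scalerDr addrACA.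
- by move=> x; apply: cvgD; [exact: cT|exact: cT'].
- move=> s e e0; have e2 : 0 < e / 2 by rewrite divr_gt0.
  have [U BU hU] := hT s _ e2; have [U' BU' hU'] := hT' s _ e2.
  exists (fun x => U x + U' x); first exact: BD.
  move=> xy sxy; rewrite !linearDl opprD addrACA.
  apply: le_lt_trans (ler_normD _ _) _.
  have -> : e%:C%C = (e / 2)%:C%C + (e / 2)%:C%C :> C by rewrite -rmorphD /= -splitr.
  by apply: ltrD; [exact: hU|exact: hU'].
Qed.

(** The weak closure of a set closed under addition is closed under addition, so f may be treated
    term by term. Each term is a strong limit by [reg_strong_cvg], where the bound M on the
    coefficients has to be the same along the sequence. *)
Lemma Reg_weak_closure (P : set (Sigma -> C)) :
  P `<=` Cc E -> P (fun=> 0) -> (forall f g, P f -> P g -> P (fun s => f s + g s)) ->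
  (forall S b, compact_bisection S -> continuous b -> exists2 M : R,
    (forall y, `|b y| <= M%:C%C) & forall e : R, 0 < e -> exists S' b',
      [/\ compact_bisection S', continuous b', (forall y, `|b' y| <= M%:C%C),
          P (Ccterm S' b') & rnorm (cls (Ccterm S b) - cls (Ccterm S' b')) < e]) ->
  forall f T, Cc E f -> is_Reg (K := K) f T ->
    weak_closure [set T | exists2 f, P f & is_Reg (K := K) f T] T.
Proof.
move=> PC P0 PD approx f T Cf; move: f Cf T; apply: (Cc_ind cX) => [T hT|S b f bS cb Cf ih T hT].
  split; first exact: hT.1.
  by move=> s e e0; exists T; [exists (fun=> 0)|move=> xy _; rewrite subrr normr0 ltcR].
have [T2 hT2] := reg_exists cX etE K Cf; have Ct := Cc_term cX bS cb.
have [T1 hT1] := reg_exists cX etE K Ct.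
rewrite (is_Reg_unique hT (is_RegD cX Ct Cf hT1 hT2)).
apply: weak_closureD; [|clear hT|exact: ih].
  move=> U U' [g Pg hU] [g' Pg' hU']; exists (fun s => g s + g' s); first exact: PD.
  by apply: is_RegD => //; exact: PC.
have [M hM ap] := approx S b bS cb.
(* The rate of approximation that [reg_strong_cvg] requires. *)
have a0 n : (0 : R) < 2 ^- n.+1 by rewrite invr_gt0 exprn_gt0.
have /choice [SB hSB] : forall n, exists q : set Sigma * (X -> C),
    [/\ compact_bisection q.1, continuous q.2, (forall y, `|q.2 y| <= M%:C%C),
        P (Ccterm q.1 q.2) & rnorm (cls (Ccterm S b) - cls (Ccterm q.1 q.2)) < 2 ^- n.+1].
  by move=> n; have [S' [b' h]] := ap _ (a0 n); exists (S', b').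
have PT n : P (Ccterm (SB n).1 (SB n).2) by case: (hSB n).
have /choice [U hU] : forall n, exists U : K -> K, is_Reg (Ccterm (SB n).1 (SB n).2) U.
  by move=> n; apply: (reg_exists cX etE K); exact: PC.
apply: (@weak_closure_strong _ T1 U); first exact: hT1.1.
  by move=> n; exists (Ccterm (SB n).1 (SB n).2).
have h1 n : compact_bisection (SB n).1 by case: (hSB n).
have h2 n : continuous (SB n).2 by case: (hSB n).
have h3 n y : `|(SB n).2 y| <= M%:C%C by case: (hSB n).
have h4 n : rnorm (cls (Ccterm S b) - cls (Ccterm (SB n).1 (SB n).2)) <= 2 ^- n.+1.
  by apply: ltW; case: (hSB n).
move=> x e e0; exact: (reg_strong_cvg bS cb hM h1 h2 h3 hT1 hU h4 x e0).
Qed.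

End StrongApproximation.

(** * Borel functions on X as functions of the anchor, almost everywhere *)

Section BorelLift.
Variables (R : realType) (X Y : ptopologicalType) (mu : probability (borelType X) R).
Variable pi : X -> Y.
Local Notation C := (cplx R).
Local Notation ReC z := (complex.Re (z : R[i])).
Hypothesis nwd : forall N : set X, closed N -> nowhere_dense N -> mu N = 0%E.
Hypothesis stX : forall U : set X, open U -> open (closure U).
Hypothesis approx : forall (e : set X) (k : R), open e -> closed e -> 0 < k ->
  exists2 D : set Y, measurable (D : set (borelType Y)) &
    exists2 A : set (borelType X), measurable A &
      (mu A <= k%:E)%E /\ [set x | ~ (e x <-> D (pi x))] `<=` A.

Definition lifts (A : set X) := exists2 D : set Y, measurable (D : set (borelType Y)) &
  mu.-negligible [set x : borelType X | ~ (A x <-> D (pi x))].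

(** By Borel-Cantelli almost every x is outside A n for all large n. For such x the statements [e x]
    and [D n (pi x)] agree from some n on, so the superior limit of the D n decides [e x]. *)
Lemma clopen_lifts e : open e -> closed e -> lifts e.
Proof.
move=> oe ce; have k0 n : (0 : R) < 2 ^- n.+1 by rewrite invr_gt0 exprn_gt0.
have /choice [D hD] : forall n, exists D : set Y, measurable (D : set (borelType Y)) /\
    exists A : set (borelType X), [/\ measurable A, (mu A <= (2 ^- n.+1)%:E)%E &
      [set x | ~ (e x <-> D (pi x))] `<=` A].
  by move=> n; have [D mD [A mA [h1 h2]]] := approx oe ce (k0 n); exists D; split=> //; exists A.
have /choice [A hA] : forall n, exists A : set (borelType X),
    [/\ measurable A, (mu A <= (2 ^- n.+1)%:E)%E & [set x | ~ (e x <-> D n (pi x))] `<=` A].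
  by move=> n; case: (hD n).
have mA n : measurable (A n) by case: (hA n).
exists (lim_sup_set D).
  apply: (@bigcap_measurable _ (borelType Y)) => // n _; apply: bigcup_measurable => k _.
  by case: (hD k).
exists (lim_sup_set A); split.
- by apply: bigcap_measurable => // n _; apply: bigcup_measurable => k _.
- by apply: lim_sup_set_null => // n; case: (hA n).
- move=> x /= nx n _; apply: contrapT => nA; apply: nx.
  have xA k : (n <= k)%N -> (e x <-> D k (pi x)).
    move=> nk; apply: contrapT => h; apply: nA; exists k => //.
    by case: (hA k) => _ _; apply.
  split=> [ex k _|Dx].
    by exists (maxn n k); [rewrite /= leq_maxr|apply/(xA _ (leq_maxl _ _))].
  by have [k nk Dk] := Dx n I; apply/(xA k nk).
Qed.

(** The sets that lift form a sigma-algebra; an open set belongs to it because it differs from its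
    clopen closure by a null boundary. *)
Lemma borel_lifts (A : set X) : measurable (A : set (borelType X)) -> lifts A.
Proof.
apply: (@smallest_sub _ _ _ lifts); first split.
- exists set0; first exact: measurable0.
  by apply: negligibleS (negligible_set0 mu) => x /=; apply; split.
- move=> B [D mD neg]; exists (~` D); first exact: measurableC.
  by rewrite setTD; apply: negligibleS neg => x /= h1 h2; apply: h1; rewrite /setC /= h2.
- move=> B hB; have /choice [D hD] : forall n, exists D : set Y,
      measurable (D : set (borelType Y)) /\
      mu.-negligible [set x : borelType X | ~ (B n x <-> D (pi x))].
    by move=> n; have [D ? ?] := hB n; exists D.
  exists (\bigcup_n D n); first by apply: bigcupT_measurable => n; case: (hD n).
  have N0 : mu.-negligible (\bigcup_n [set x : borelType X | ~ (B n x <-> D n (pi x))]).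
    by apply: negligible_bigcup => n; case: (hD n).
  apply: negligibleS N0 => x /= nx; apply: contrapT => h; apply: nx.
  have BD n : B n x <-> D n (pi x).
    by apply: contrapT => k; apply: h; exists n.
  by split=> -[n _ Bx]; exists n => //; apply/BD.
move=> U oU; have [D mD neg] := clopen_lifts (stX oU) (@closed_closure _ U).
exists D => //.
have N0 : mu.-negligible (closure U `\` U : set (borelType X)) by exact: boundary_negligible.
apply: negligibleS (negligibleU neg N0) => x /= nx.
have [Ux|nUx] := pselect (U x).
  by left=> h; apply: nx; rewrite -h; split=> // _; exact: subset_closure.
have [cx|ncx] := pselect (closure U x); first by right.
by left=> h; apply: nx; rewrite -h; split.
Qed.

Lemma bounded_fun_lift (b : X -> R) (M : R) :
  measurable_fun [set: borelType X] (b : borelType X -> R) ->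
  (forall x, `|b x| <= M) -> exists b' : Y -> R,
    [/\ measurable_fun [set: borelType Y] (b' : borelType Y -> R), forall y, `|b' y| <= M &
        mu.-negligible [set x : borelType X | b x <> b' (pi x)]].
Proof.
move=> mb hM.
pose q n : R := if choice.unpickle n is Some r then ratr (r : rat) else 0.
have hA n : lifts [set x | q n < b x].
  apply: borel_lifts; rewrite -[X in measurable X]setTI.
  rewrite (_ : [set x | _] = (b : borelType X -> R) @^-1` `]q n, +oo[%classic); first exact: mb.
  by apply/seteqP; split=> x /=; rewrite in_itv /= andbT.
have /choice [D hD] : forall n, exists D : set Y, measurable (D : set (borelType Y)) /\
    mu.-negligible [set x : borelType X | ~ (q n < b x <-> D (pi x))].
  by move=> n; have [D ? ?] := hA n; exists D.
(* b' is the supremum of the rationals q for which y belongs to the lift of the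
   set where q < b. *)
pose D' n : set (borelType Y) := if `|q n| <= M then D n else set0.
have mD' n : measurable (D' n).
  by rewrite /D'; case: ifP => _; [case: (hD n)|exact: measurable0].
(* The value is q n on D' n and -M elsewhere. Discarding the q n with |q n| > M keeps b' between -M
   and M at every point of Y, not just almost everywhere. *)
pose h n (y : borelType Y) : R := (q n + M) * \1_(D' n) y - M.
have hE n y : h n y = if `[< D' n y >] then q n else - M.
  rewrite /h indicE; case: asboolP => Dy; first by rewrite mem_set// mulr1 addrK.
  by rewrite memNset// mulr0 add0r.
have hle n y : - M <= h n y <= M.
  have M0 : 0 <= M by apply: le_trans (hM point).
  rewrite hE; case: asboolP; last by rewrite lexx/=; lra.
  by rewrite /D'; case: ifP => // qM _; rewrite -ler_norml.
have ub y : has_ubound (range (h ^~ y)).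
  by exists M => _ [n _ <-]; case/andP: (hle n y).
have nonempty y : range (h ^~ y) !=set0 by exists (h 0%N y), 0%N.
pose b' y := sup (range (h ^~ y)).
have lb y : - M <= b' y.
  have := sup_upper_bound (conj (nonempty y) (ub y)); case/andP: (hle 0%N y) => h1 _.
  by move=> /(_ (h 0%N y)) h2; apply: le_trans h1 (h2 _); exists 0%N.
exists b'; split.
- rewrite (_ : b' = (fun y => sups (h ^~ y) 0)).
    apply: measurable_fun_sups => [y _|n]; first exact: ub.
    apply: measurable_funB; last exact: measurable_cst.
    apply: measurable_funM; first exact: measurable_cst.
    exact: measurable_indic (mD' n).
  apply/funext => y; rewrite /b' /sups; congr sup.
  by apply/seteqP; split=> _ [n hn <-]; exists n.
- move=> y; rewrite ler_norml lb /=; apply: ge_sup; first exact: nonempty.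
  by move=> _ [n _ <-]; case/andP: (hle n y).
- have N0 : mu.-negligible (\bigcup_n [set x : borelType X | ~ (q n < b x <-> D n (pi x))]).
    by apply: negligible_bigcup => n; case: (hD n).
  apply: negligibleS N0 => x /= nx; apply: contrapT => k; apply: nx.
  have BD n : q n < b x <-> D n (pi x).
    by apply: contrapT => k'; apply: k; exists n.
  have /andP[bl bu] : - M <= b x <= M by rewrite -ler_norml.
  apply/eqP; rewrite eq_le; apply/andP; split; last first.
    apply: ge_sup; first exact: nonempty.
    move=> _ [n _ <-]; rewrite hE; case: asboolP => //.
    by rewrite /D'; case: ifP => // _ /BD /ltW.
  rewrite leNgt; apply/negP => lt.
  have [r /andP[r1 r2]] : exists r : rat, b' (pi x) < ratr r < b x.
    by have [r] := rat_in_itvoo lt; rewrite in_itv; exists r.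
  have qr : q (choice.pickle r) = ratr r by rewrite /q choice.pickleK.
  have qM : `|q (choice.pickle r)| <= M.
    by rewrite qr ler_norml; have := lb (pi x); lra.
  have Dr : D' (choice.pickle r) (pi x) by rewrite /D' qM; apply/BD; rewrite qr.
  have hr : h (choice.pickle r) (pi x) = ratr r by rewrite hE; case: asboolP.
  have := sup_upper_bound (conj (nonempty (pi x)) (ub (pi x))).
  move=> /(_ (ratr r))/(_ (ex_intro2 _ _ (choice.pickle r) I hr)).
  by rewrite leNgt; move: r1; rewrite /b' => ->.
Qed.

Lemma bounded_borel_lift (b : X -> C) : bounded_borel b -> exists2 b' : Y -> C, bounded_borel b' &
  mu.-negligible [set x : borelType X | b x <> b' (pi x)].
Proof.
move=> bb; have [M hM] := bounded_borelP bb; have [_ mR mI] := bb.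
have [u [mu' uM nu]] := bounded_fun_lift mR (fun x => (hM x).1).
have [v [mv vM nv]] := bounded_fun_lift mI (fun x => (hM x).2).
exists (fun y => (u y +i* v y)%C).
  split=> //; exists ((M + M)%:C)%C => y; apply: le_trans (normc_le_ReIm _) _.
  by rewrite lecR; apply: lerD; [exact: uM|exact: vM].
apply: negligibleS (negligibleU nu nv) => x /= nx.
have [e|] := pselect (ReC (b x) = u (pi x)); last by left.
right=> e'; apply: nx; exact: cplx_eq.
Qed.

End BorelLift.

(** * The isomorphism *)

Section ChartBisections.
Variables (R : realType) (X : ptopologicalType) (E : twisted_groupoid R X).
Variable A : reduction E.
Hypothesis cX : compact [set: X].
Hypothesis etE : local_homeomorphism (gdom (tw_base E)).
Local Notation C := (cplx R).
Local Notation Sigma := (tw_ext E).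
Local Notation d := (gdom Sigma).
Local Notation S := (rd_S A).
Local Notation pi := (rd_pi A).
Local Notation Y := (rd_Y A).
Local Notation F := (rd_twist A cX etE).
Local Notation m := (rd_action A cX etE).
Local Notation AL := (ext_system A cX etE).
Local Notation Lam := (slice_groupoid AL).

(** The copy of S_i in Lambda, cut out by the scalar 1. Acting on the units it gives S_i back, so
    [jtilde] reaches functions carried by S_i. *)
Definition chart_bisection i : set (tw_ext F) := [set l | exists y, chart AL i 1 y l].

Lemma chart_bisection_ex i y : rd_D i y -> exists2 l, chart_bisection i l & gdom Lam l = y.
Proof.
move=> Dy; have [l cl] := @chart_mk _ _ _ _ AL i 1 y (circle1 R) Dy.
by exists l; [exists y|exact: chart_adom cl].
Qed.

Lemma chart_bisection_dinj i : dinj (chart_bisection i).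
Proof.
move=> l k [y cl] [z ck] e; have yz : y = z.
  by rewrite -(chart_adom cl) -(chart_adom ck); exact: e.
by subst z; exact: chart_uniq cl ck.
Qed.

Lemma chart_bisection_dom i : gdom Lam @` chart_bisection i = rd_D i.
Proof.
apply/seteqP; split=> [_ [l [y cl] <-]|y Dy].
  by have [_ Dy _] := cl; rewrite [gdom _ _](chart_adom cl).
by have [l cl <-] := chart_bisection_ex Dy; exists l.
Qed.

Lemma chart_bisection_inv i j l : S j = ginv Sigma @` S i ->
  chart_bisection i l -> chart_bisection j (ginv Lam l).
Proof.
move=> ej [y cl]; exists (arng (l : Lam)); have := chart_inv cl ej.
by rewrite (rmorph1 (@Num.conj C)).
Qed.

Lemma cbis_chart i : compact_bisection (chart_bisection i).
Proof.
have [j ej] := rd_inv A i.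
have ei : S i = ginv Sigma @` S j.
  by rewrite ej image_comp -[LHS]image_id; apply: eq_imagel => g _ /=; rewrite ginvK.
have rE : grng Lam @` chart_bisection i = rd_D j.
  rewrite -chart_bisection_dom; apply/seteqP; split=> _ [l cl <-].
    by exists (ginv Lam l); [exact: chart_bisection_inv cl|exact: gdom_inv].
  by exists (ginv Lam l); [exact: chart_bisection_inv cl|exact: grng_inv].
apply/(cbisP _ (tw_hausdorff F)); split.
- have [[l0 _]|h0] := pselect ([set: Lam] !=set0); last first.
    rewrite (_ : chart_bisection i = set0); first exact: compact0.
    by apply/seteqP; split=> // l _; apply: h0; exists l.
  pose c (y : Y) : Lam := xget l0 [set l | chart AL i 1 y l].
  have cE y : rd_D i y -> chart AL i 1 y (c y).
    move=> Dy; rewrite /c; case: xgetP => [? _ //|] /=.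
    by have [l cl] := @chart_mk _ _ _ _ AL i 1 y (circle1 R) Dy => /(_ l).
  have -> : chart_bisection i = c @` rd_D i.
    apply/seteqP; split=> [l [y cl]|_ [y Dy <-]]; last by exists y; exact: cE.
    have [_ Dy _] := cl; exists y => //; exact: chart_uniq (cE y Dy) cl.
  apply: continuous_compact; last exact: rd_D_compact.
  apply/withinP => y V Dy oV Vy.
  have [W [N [oW oN Wy N1 h]]] := oV _ _ _ _ (cE y Dy) Vy.
  by exists W; split=> // z Wz Dz; apply: (h z 1) => //; exact: cE.
- exact: chart_bisection_dinj.
- move=> l k cl ck e; rewrite -(ginvK l) -(ginvK k); congr (ginv _ _).
  apply: (@chart_bisection_dinj j); try exact: (chart_bisection_inv ej).
  by rewrite !gdom_inv.
- by rewrite [X in open X]chart_bisection_dom; exact: rd_D_open.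
- by rewrite [X in open X]rE; exact: rd_D_open.
Qed.

Lemma chart_bisection_act i : bisection_act m (chart_bisection i) = S i.
Proof.
apply/seteqP; split=> [s [l [y cl] [dl ls]]|s Ss].
  have ey : pi (d s) = y.
    by rewrite -(chart_adom cl); move: dl; rewrite anchor_rdE => /esym.
  have [e [Ss _]] := act_rd_unit cl ey.
  by rewrite -ls e scale1.
have Dy : rd_D (A := A) i (pi (d s)) by exists (d s) => //; exists s.
have [l [y cl] dl] := chart_bisection_ex Dy.
have ey : pi (d s) = y by rewrite -dl; exact: chart_adom cl.
have [e [Sd dd]] := act_rd_unit cl ey.
exists l; first by exists y.
split; first by rewrite anchor_rdE.
by rewrite e scale1; apply: (S_dinj Sd Ss).
Qed.

Lemma jtilde_chart i (b : Y -> C) :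
  jtilde m (Ccterm (chart_bisection i) b) = Ccterm (S i) (b \o pi).
Proof. by rewrite (jtilde_term _ _ (cbis_chart i)) chart_bisection_act anchor_rdE. Qed.

(** Closures of the level sets of b are unions of fibres of pi, so no disc of the base can separate
    the values at two points of a fibre. The images of these closures are open in Y and serve as
    neighbourhoods for the continuity of b'. *)
Lemma factor_continuous (b : X -> C) : continuous b ->
  (forall n, exists k, rd_e A k = closure (b @^-1` cplx_base R n)) ->
  exists2 b' : Y -> C, continuous b' & b = b' \o pi.
Proof.
move=> cb lev.
have level n (x : X) : closure (b @^-1` cplx_base R n) x -> closure (cplx_base R n) (b x).
  move=> cx V /(cb x) Vx; have [z [h1 h2]] := cx _ Vx.
  by exists (b z).
have inside n (x : X) : cplx_base R n (b x) -> closure (b @^-1` cplx_base R n) x.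
  by move=> h; exact: subset_closure.
have const x x' : pi x = pi x' -> b x = b x'.
  move=> e; apply: contrapT => ne.
  have oN : open (~` [set b x'] : set C).
    apply: closed_openC.
    exact: (accessible_closed_set1 (hausdorff_accessible (@norm_hausdorff C C))).
  have [n [bx clV]] := @cplx_baseP R (b x) _ oN ne.
  have [k ek] := lev n; have := inside n x bx; rewrite -ek => /(qpi_sat e).
  by rewrite -/(rd_e A k) ek => /level/clV; exact.
pose b' (y : Y) := b (sval (cid (qpi_surj y))).
have b'E x : b' (pi x) = b x by rewrite /b'; case: cid => z ez; exact: const.
exists b'; last by apply/funext => x; rewrite /= b'E.
apply/contP => y V oV Vy; have [x ex] := qpi_surj y.
have bx : b' y = b x by rewrite -ex [LHS]b'E.
rewrite bx in Vy; have [n [bn clV]] := @cplx_baseP R (b x) _ oV Vy.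
have [k ek] := lev n; exists (rd_D (A := A) k); split; first exact: rd_D_open.
  by rewrite -ex; exists x => //; rewrite ek; exact: inside.
by move=> _ [z zk <-]; apply: clV; rewrite [b' _]b'E; apply: level; rewrite -ek.
Qed.

End ChartBisections.
Arguments chart_bisection {R X E A} cX etE i _.

Section SeparableReduction.
Variables (R : realType) (X : ptopologicalType) (E : twisted_groupoid R X).
Variable mu : probability (borelType X) R.
Variable K : L2_completion E mu.
Local Notation C := (cplx R).
Local Notation Sigma := (tw_ext E).
Local Notation cls := (L2_class K).
Implicit Types (S : set Sigma) (b : X -> C) (e : set X).

(** The indicator of e on the unit space, as an element of the twisted algebra. By [unit_ind_dist],
    approximating clopen sets in measure is approximating such functions in L^2. *)
Definition unit_ind e : Sigma -> C := Ccterm (gunit Sigma @` setT) (fun x => \1_e x).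

Lemma separable_reduction : stonian_space X -> local_homeomorphism (gdom (tw_base E)) ->
  (forall U : set X, open U -> U !=set0 -> (0 < mu U)%E) -> separable_space K ->
  exists A : reduction E,
    (forall S b, compact_bisection S -> continuous b -> exists2 M : R,
      (forall y, `|b y| <= M%:C%C) & forall k : R, 0 < k -> exists i b',
        [/\ continuous b', (forall y, `|b' y| <= M%:C%C),
            (forall n, exists j, rd_e A j = closure (b' @^-1` cplx_base R n)) &
            rnorm (cls (Ccterm S b) - cls (Ccterm (rd_S A i) b')) < k]) /\
    (forall e, clopen e -> forall k : R, 0 < k ->
      exists n, rnorm (cls (unit_ind e) - cls (unit_ind (rd_e A n))) < k).
Proof.
move=> stX etE pos sep; have [cX _ clo] := stX.
have c1 : compact_bisection (gunit Sigma @` setT).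
  exact: (cbis_unit _ (tw_hausdorff E) cX (conj openT closedT)).
(* Separability is applied for each integer M to the terms with coefficient bounded by M, so that
   the approximants obey the same bound as the term. *)
pose P (M : nat) := [set q : set Sigma * (X -> C) |
  [/\ compact_bisection q.1, continuous q.2 & forall y, `|q.2 y| <= (M%:R%:C)%C]].
have /choice [u hu] : forall M, exists u : nat -> set Sigma * (X -> C), (forall n, P M (u n)) /\
    forall q (k : R), P M q -> 0 < k ->
    exists n, rnorm (cls (Ccterm q.1 q.2) - cls (Ccterm (u n).1 (u n).2)) < k.
  move=> M; apply: (@separable_family R K _ (P M) (fun q => cls (Ccterm q.1 q.2)) sep).
  exists (gunit Sigma @` setT, fun=> 0); split=> //=; first by move=> x; exact: cvg_cst.
  by move=> y; rewrite normr0 lecR.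
have [v [cv hv]] : exists v : nat -> set X, (forall n, clopen (v n)) /\
    forall e (k : R), clopen e -> 0 < k ->
    exists n, rnorm (cls (unit_ind e) - cls (unit_ind (v n))) < k.
  apply: (@separable_family R K _ clopen (fun e => cls (unit_ind e)) sep).
  by exists setT; split; [exact: openT|exact: closedT].
(* The family to be closed up: bisections of the approximating terms, closed level sets of their
   coefficients, which make the coefficients factor through pi by [factor_continuous], and the
   approximating clopen sets. *)
pose S0 n : set Sigma := match choice.unpickle n with
  | Some (inl (inl q)) => (u q.1 q.2).1
  | Some (inl (inr q)) => gunit Sigma @` closure ((u q.1.1 q.1.2).2 @^-1` cplx_base R q.2)
  | Some (inr q) => gunit Sigma @` v q
  | None => gunit Sigma @` setT
  end : set Sigma.
have bS0 n : compact_bisection (S0 n).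
  rewrite /S0; case: choice.unpickle => [[[[M k]|[[M k] l]]|k]|//].
  - by have [/(_ k) [bS _ _] _] := hu M.
  - apply: (cbis_unit _ (tw_hausdorff E) cX); split; last exact: closed_closure.
    have [/(_ k) [_ cb _] _] := hu M; apply: clo.
    by apply: open_comp; [move=> ? _; exact: cb|exact: cplx_base_open].
  - exact: (cbis_unit _ (tw_hausdorff E) cX (cv k)).
have [A hA] := reduction_exists stX pos etE bS0.
exists A; split=> [S b bS cb|e ce k k0]; last first.
  have [n hn] := hv e k ce k0.
  have [j ej] := hA (choice.pickle (inr n : nat * nat + nat * nat * nat + nat)).
  by exists j; rewrite (unit_e (B := v n)) // ej /S0 choice.pickleK.
have [M0 M00 hM0] := bounded_real (continuous_bounded cX cb).
pose M := (Num.truncn M0).+1.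
have MM : M0 <= M%:R by apply: ltW; rewrite /M truncnS_gt.
have PM : P M (S, b).
  by split=> // y; apply: le_trans (hM0 y) _; rewrite lecR.
have [hP hK] := hu M; exists M%:R; first by case: PM.
move=> k k0; have [n hn] := hK _ k PM k0; have [bS' cb' hM'] := hP n.
have [i ei] := hA (choice.pickle (inl (inl (M, n)) : nat * nat + nat * nat * nat + nat)).
have eS : rd_S A i = (u M n).1 by rewrite ei /S0 choice.pickleK.
exists i, (u M n).2; rewrite eS; split=> // l.
have [j ej] := hA (choice.pickle (inl (inr (M, n, l)) : nat * nat + nat * nat * nat + nat)).
by exists j; apply: unit_e; rewrite ej /S0 choice.pickleK.
Qed.

End SeparableReduction.

Section UnitIndicators.
Variables (R : realType) (X : ptopologicalType) (E : twisted_groupoid R X).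
Hypothesis cX : compact [set: X].
Variable mu : probability (borelType X) R.
Variable K : L2_completion E mu.
Local Notation C := (cplx R).
Local Notation Sigma := (tw_ext E).
Local Notation cls := (L2_class K).
Implicit Types (e : set X).

Lemma indic_continuous e : clopen e -> continuous (fun x => \1_e x : C).
Proof.
move=> [oe ce]; apply/contP => x V oV; rewrite /= indicE.
have [ex|nex] := pselect (e x).
  rewrite mem_set// => V1; exists e; split=> // z ez.
  by rewrite /= indicE mem_set.
rewrite memNset// => V0; exists (~` e); split=> //; first exact: closed_openC.
by move=> z ez; rewrite /= indicE memNset.
Qed.

Lemma clopen_symdiff_borel e e' : clopen e -> clopen e' ->
  measurable [set x : borelType X | ~ (e x <-> e' x)].
Proof.
move=> ce ce'; rewrite (_ : [set x | _] = (e `\` e') `|` (e' `\` e)).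
  by apply: measurableU; apply: measurableD; exact: clopen_borel.
apply/seteqP; split=> x /=.
  by have [ex|nex] := pselect (e x); have [ex'|nex'] := pselect (e' x) => h;
    [exfalso; apply: h|left|right|exfalso; apply: h].
by case=> -[h1 h2] [h3 h4]; apply: h2; [exact: h3|exact: h4].
Qed.

Lemma unit_ind_dist e e' : clopen e -> clopen e' ->
  mu [set x : borelType X | ~ (e x <-> e' x)] =
  (rnorm (cls (unit_ind e) - cls (unit_ind e')) ^+ 2)%:E.
Proof.
move=> ce ce'; have ci := indic_continuous ce; have ci' := indic_continuous ce'.
have bU := cbis_unit (tw_ext E) (tw_hausdorff E) cX (conj openT (@closedT X)).
have mD := clopen_symdiff_borel ce ce'; set D := [set x | _] in mD *.
have C1 : Cc E (unit_ind e) := Cc_term cX bU ci.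
have C2 : Cc E (unit_ind e') := Cc_term cX bU ci'.
have cb : continuous (fun x => \1_e x - \1_e' x : C).
  by move=> x; apply: cvgB; [exact: ci|exact: ci'].
have eD : (fun s : Sigma => unit_ind e s - unit_ind e' s) =
    Ccterm (gunit Sigma @` setT) (fun x => \1_e x - \1_e' x : C).
  by apply/funext => s; rewrite /unit_ind /Ccterm mulrBr.
have nD : fibre_norm (fun s : Sigma => unit_ind e s - unit_ind e' s) = (fun x => (\1_D x)%:C%C : C).
  apply/funext => x; rewrite eD (fibre_norm_termE cX x bU cb) dom_image_unit.
  case: asboolP => [_|/(_ I)//]; rewrite !indicE.
  have [ex|nex] := pselect (e x); have [ex'|nex'] := pselect (e' x).
  - have nDx : ~ D x by move=> h; apply: h.
    by rewrite (mem_set ex) (mem_set ex') (memNset nDx) subrr normr0 expr0n.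
  - have Dx : D x by move=> h; exact/nex'/h.
    by rewrite (mem_set ex) (memNset nex') (mem_set Dx) subr0 normr1 expr1n.
  - have Dx : D x by move=> h; exact/nex/h.
    by rewrite (memNset nex) (mem_set ex') (mem_set Dx) sub0r normrN normr1 expr1n.
  - have nDx : ~ D x by move=> h; apply: h.
    by rewrite (memNset nex) (memNset nex') (memNset nDx) subrr normr0 expr0n.
rewrite -L2_classB// -[LHS]fineK ?fin_num_measure//; congr (_%:E).
apply/complexI; rewrite (L2_class_norm K (CcB cX C1 C2)) nD.
by apply: cplx_eq; rewrite /= ?integral0// integral_indic// setIT.
Qed.

End UnitIndicators.

Theorem theorem3p8 (R : realType) (X : ptopologicalType)
    (E : twisted_groupoid R X) (mu : probability (borelType X) R)
    (L2E : L2_completion E mu) :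
  twisted_stonian_measure_groupoid E mu ->
  separable_space L2E ->
  exists (Y : ptopologicalType) (F : twisted_groupoid R Y)
         (a : multiplier_action F E),
    let nu := pushforward mu (anchor a : borelType X -> borelType Y) in
    [/\ twisted_boolean F /\ twisted_second_countable F,
        quasi_invariant (tw_base F) nu,
        Cc_star_hom (jtilde a),
        inhabited (L2_completion F nu) &
        forall L2F : L2_completion F nu,
          exists (J : {linear L2F -> L2E}) (Jinv : L2E -> L2F),
            [/\ cancel J Jinv /\ cancel Jinv J,
                forall xi, `|J xi| = `|xi|,
                forall f, Cc F f ->
                  J (L2_class L2F f) = L2_class L2E (jtilde a f),
                [set (J \o T \o Jinv : L2E -> L2E) | T in Wstar L2F] =
                  Wstar L2E &
                [set (J \o M \o Jinv : L2E -> L2E) | M in Linfty L2F] =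
                  Linfty L2E]].
Proof.
move=> [[tb stX] qi pos nwd'] sep.
have nwd (N : set X) : closed N -> nowhere_dense N -> mu N = 0%E.
  by move=> cN; apply: nwd'; exact: closed_borel.
have [[_ _ etE] _] := tb; have [cX _ clo] := stX.
have [A [apx apx_unit]] := separable_reduction stX etE pos sep.
have cY := @rd_compact _ _ _ A cX.
pose F := rd_twist A cX etE; pose a := rd_action A cX etE.
have tF : twisted_boolean F := rd_twisted_boolean A cX etE.
have [[_ _ etF] _] := tF.
have anc : anchor a = rd_pi A := anchor_rdE A cX etE.
have free := @not_free_negligible _ _ _ A cX etE mu nwd.
pose P : set (tw_ext E -> cplx R) := [set f | exists2 f', Cc F f' & f = jtilde a f'].
have PC : P `<=` Cc E by move=> _ [f Cf ->]; exact: Cc_jtilde.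
have P0 : P (fun=> 0).
  by exists (fun=> 0); [exact: Cc0|rewrite jtilde0].
have PD f g : P f -> P g -> P (fun s => f s + g s).
  move=> [f' Cf ->] [g' Cg ->]; exists (fun s => 1 * f' s + g' s); first exact: Cc_lin.
  by rewrite jtilde_linear//; apply/funext => s; rewrite mul1r.
have approx S b : compact_bisection S -> continuous b -> exists2 M : R,
    (forall y, `|b y| <= M%:C%C) & forall e : R, 0 < e -> exists S' b',
      [/\ compact_bisection S', continuous b', (forall y, `|b' y| <= M%:C%C),
          P (Ccterm S' b') &
          rnorm (L2_class L2E (Ccterm S b) - L2_class L2E (Ccterm S' b')) < e].
  move=> bS cb; have [M hM h] := apx S b bS cb; exists M => // e e0.
  have [i [b' [cb' hM' lev lt]]] := h e e0.
  exists (rd_S A i), b'; split=> //; first exact: rd_cbis.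
  have [b2 cb2 eb] := factor_continuous cb' lev.
  exists (Ccterm (chart_bisection (A := A) cX etE i) b2).
    by apply: Cc_term => //; exact: cbis_chart.
  by rewrite jtilde_chart eb.
have jdense : dense [set L2_class L2E (jtilde a f) | f in Cc F].
  apply: dense_rnorm => x e e0; have e2 : 0 < e / 2 by rewrite divr_gt0.
  have [_ [g Cg <-] xg] := rnorm_dense (@L2_class_dense _ _ _ _ L2E) x e2.
  suff [_ [f Cf ->] lt] : exists2 f, P f & rnorm (L2_class L2E g - L2_class L2E f) < e / 2.
    exists (L2_class L2E (jtilde a f)); first by exists f.
    by apply: le_lt_trans (rnorm_triangle (L2_class L2E g) _ _) _; rewrite (splitr e) ltrD.
  move: (e / 2) e2 => k; clear x e e0 xg.
  move: g Cg k; apply: (Cc_ind cX) => [k k0|S b g bS cb Cg ih k k0].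
    by exists (fun=> 0) => //; rewrite subrr rnorm0.
  have k2 : 0 < k / 2 by rewrite divr_gt0.
  have [f Pf lf] := ih _ k2; have [M _ h] := approx S b bS cb.
  have [S' [b' [bS' cb' _ PS' lt]]] := h _ k2.
  exists (fun s => Ccterm S' b' s + f s); first exact: PD.
  rewrite L2_classD//; [|exact: Cc_term]; rewrite L2_classD; [|exact: PC|exact: PC].
  by rewrite opprD addrACA (splitr k); apply: le_lt_trans (rnormD _ _) _; exact: ltrD.
have lift (b : X -> cplx R) : bounded_borel b ->
    exists2 b' : rd_Y A -> cplx R, bounded_borel b' &
      mu.-negligible [set x : borelType X | b x <> b' (anchor a x)].
  move=> bb; rewrite anc; apply: bounded_borel_lift => // e k oe ce k0.
  (* The measure of a symmetric difference is a squared L^2 distance, hence approximation within the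
     square root of k. *)
  have s0 : 0 < Num.sqrt k by rewrite sqrtr_gt0.
  have [n hn] := apx_unit e (conj oe ce) _ s0.
  have cn := e_clopen A n.
  exists (rd_D (A := A) n); first exact: open_borel (rd_D_open A n).
  exists [set x | ~ (e x <-> rd_e A n x)].
    exact: (clopen_symdiff_borel (conj oe ce) cn).
  split.
    rewrite (unit_ind_dist cX L2E (conj oe ce) cn) lee_fin -(sqr_sqrtr (ltW k0)).
    by rewrite ler_sqr ?nnegrE ?rnorm_ge0 ?sqrtr_ge0// ltW.
  move=> x /= h1 h2; apply: h1; rewrite h2 -[rd_e A n x]/((gdom _ @` rd_S A n) x).
  by rewrite rd_dom.
exists (rd_Y A), F, a; split.
- by split=> //; exact: rd_second_countable.
- exact: rd_quasi_invariant.
- exact: jtilde_star_hom.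
- exact: (jtilde_completion cX cY etE etF free jdense).
move=> L2F.
have [J [J' [[JK J'K] [cJ cJ'] iso JC]]] := unitary_exists cX cY etE etF free jdense L2F.
exists J, J'; split=> //.
- by move=> x; rewrite !rnormE iso.
- apply: Wstar_conj => //.
  move=> f T Cf hT; have h := Reg_weak_closure cX etE qi PC P0 PD approx Cf hT.
  apply: weak_closure_mono h => U [_ [f' Cf' ->] hU].
  by exists f'.
- exact: Linfty_conj.
Qed.
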